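(* Let $(\rho(t))_{t\ge 0}$ denote the solution of the stochastic master equation described in the context, and let $\hat\rho(t)=\mathbb E[\rho(t)]$. Let $\mathcal H_S$ be a subspace of $\mathcal H$. Then $\mathcal H_S$ is invariant in mean if and only if it is invariant almost surely. Moreover, $\mathcal H_S$ is GAS in mean if and only if it is GAS almost surely.
   Context: $\mathcal H$ is a finite-dimensional complex Hilbert space, $\mathcal B(\mathcal H)$ the linear operators on it, and $\mathcal S(\mathcal H)=\{\rho\in\mathcal B(\mathcal H):\rho\ge 0,\ \mathrm{tr}\,\rho=1\}$. Fix integers $0\le p\le n$, operators $C_0,\dots,C_n\in\mathcal B(\mathcal H)$ and a self-adjoint $H\in\mathcal B(\mathcal H)$. Set $\mathcal L(\rho)=-i[H,\rho]+\sum_{i=0}^n\big(C_i\rho C_i^*-\tfrac12(C_i^*C_i\rho+\rho C_i^*C_i)\big)$, $\mathcal J_i(\rho)=C_i\rho C_i^*$, $\mathcal G_i(\rho)=C_i\rho+\rho C_i^*-\mathrm{tr}[(C_i+C_i^* )\rho]\rho$. Stochastic master equation: on a filtered probability space $(\Omega,\mathcal F,(\mathcal F_t),\mathbb P)$ satisfying the usual conditions, let $W_0,\dots,W_p$ be independent standard Wiener processes and $N_{p+1},\dots,N_n$ independent Poisson point processes on $\mathbb R\times\mathbb R_+$ of intensity $dx\,dt$, independent of the Wiener processes; $(\mathcal F_t)$ is their natural filtration. For each (deterministic) initial state $\rho_0\in\mathcal S(\mathcal H)$, $(\rho(t))$ is the unique $\mathcal S(\mathcal H)$-valued solution (existence and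 uniqueness are known) of $\rho(t)=\rho_0+\int_0^t\mathcal L(\rho(s-))ds+\sum_{i=0}^p\int_0^t\mathcal G_i(\rho(s-))dW_i(s)+\sum_{i=p+1}^n\int_0^t\int_{\mathbb R}\Big(\frac{\mathcal J_i(\rho(s-))}{\mathrm{tr}[\mathcal J_i(\rho(s-))]}-\rho(s-)\Big)\mathbf 1_{0<x<\mathrm{tr}[\mathcal J_i(\rho(s-))]}[N_i(dx,ds)-dx\,ds]$. One has $\frac{d}{dt}\hat\rho(t)=\mathcal L(\hat\rho(t))$. Let $P_S$ be the orthogonal projector onto $\mathcal H_S$ and $\mathcal I_S(\mathcal H)=\{\rho\in\mathcal S(\mathcal H):\mathrm{tr}(P_S\rho)=1\}$. Definitions. $\mathcal H_S$ is invariant in mean if $\rho_0\in\mathcal I_S(\mathcal H)$ implies $\hat\rho(t)\in\mathcal I_S(\mathcal H)$ for all $t>0$; invariant almost surely if $\rho_0\in\mathcal I_S(\mathcal H)$ implies that a.s. $\rho(t)\in\mathcal I_S(\mathcal H)$ for all $t>0$. $\mathcal H_S$ is GAS in mean if for all $\rho_0\in\mathcal S(\mathcal H)$, $\lim_{t\to\infty}\|\hat\rho(t)-P_S\hat\rho(t)P_S\|=0$; GAS almost surely if for all $\rho_0\in\mathcal S(\mathcal H)$, $\lim_{t\to\infty}\|\rho(t)-P_S\rho(t)P_S\|=0$ a.s. *)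

(* Defs.v *)
From mathcomp Require Import all_boot all_order all_algebra.
From mathcomp Require Import all_classical all_reals all_analysis.
From mathcomp Require Import measurable_realfun complex.
Import Order.TTheory GRing.Theory Num.Theory.
Import numFieldNormedType.Exports.

Set Implicit Arguments.
Unset Strict Implicit.
Unset Printing Implicit Defensive.

Local Open Scope classical_set_scope.
Local Open Scope complex_scope.
Local Open Scope sesquilinear_scope.
Local Open Scope ring_scope.

(* The Hilbert space is C^m with its standard inner product: vectors are the
   columns 'cV[R[i]]_m, operators are the matrices 'M[R[i]]_m. *)
Section operators.
Variables (R : realType) (m : nat).
Implicit Types A B rho C H P : 'M[R[i]]_m.

Definition psd A : Prop :=
  forall v : 'cV[R[i]]_m, 0 <= (v ^t* *m A *m v) 0 0.

Definition states : set 'M[R[i]]_m := [set rho | psd rho /\ \tr rho = 1].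

Definition orth_projector (V : {vspace 'cV[R[i]]_m}) P : Prop :=
  forall v : 'cV[R[i]]_m,
    P *m v \in V /\
    forall u : 'cV[R[i]]_m, u \in V -> (u ^t* *m (v - P *m v)) 0 0 = 0.

Definition states_on P : set 'M[R[i]]_m :=
  [set rho | states rho /\ \tr (P *m rho) = 1].

Definition hs_norm A : R := Num.sqrt (complex.Re (\tr (A ^t* *m A))).

Definition lindblad n (H : 'M[R[i]]_m) (C : 'I_n.+1 -> 'M[R[i]]_m) rho :=
  - ('i *: (H *m rho - rho *m H))
  + \sum_(i < n.+1)
      (C i *m rho *m (C i) ^t*
       - 2^-1 *: ((C i) ^t* *m C i *m rho + rho *m ((C i) ^t* *m C i))).

Definition jump C rho := C *m rho *m C ^t*.

Definition diffusion C rho :=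
  C *m rho + rho *m C ^t* - \tr ((C + C ^t* ) *m rho) *: rho.

(* The integrand of the i-th Poisson integral at the mark x.  The trace of
   jump C rho is real when rho is a state; when it vanishes, the indicator
   makes the quotient irrelevant. *)
Definition jump_integrand C rho (x : R) : 'M[R[i]]_m :=
  if 0 < x < complex.Re (\tr (jump C rho))
  then (\tr (jump C rho))^-1 *: jump C rho - rho else 0.

(* Operations and properties of real functions, extended to matrix-valued
   functions through the real and imaginary parts of the entries. *)
Definition mx_lift (T : Type) (Phi : (T -> R) -> R) (f : T -> 'M[R[i]]_m) :=
  \matrix_(j, k) (Phi (fun x => complex.Re (f x j k))
                  +i* Phi (fun x => complex.Im (f x j k))).

Definition mx_all (T : Type) (Q : (T -> R) -> Prop) (f : T -> 'M[R[i]]_m) :=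
  forall j k, Q (fun x => complex.Re (f x j k)) /\
              Q (fun x => complex.Im (f x j k)).

Definition left_limit (x : R -> 'M[R[i]]_m) (t : R) : 'M[R[i]]_m :=
  mx_lift (fun f : R -> R => lim (f s @[s --> t^'-])) x.

End operators.

Definition cadlag (R : realType) (f : R -> R) : Prop :=
  (forall t, 0 <= t -> f s @[s --> t^'+] --> f t) /\
  (forall t, 0 < t -> cvg (f s @[s --> t^'-])).

Section noises.
Context d (Omega : measurableType d) (R : realType) (P : probability Omega R).

Definition mutually_independent (I : finType) (G : I -> set_system Omega) :=
  forall (J : {set I}) (E : I -> set Omega),
    (forall i, i \in J -> G i (E i)) ->
    P (\bigcap_(i in [set` J]) E i) = (\prod_(i in J) P (E i))%E.

(* The events about a process during the set of times T. *)
Definition process_events (W : R -> Omega -> R) (T : set R) :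
    set_system Omega :=
  [set A | exists t B, [/\ T t, measurable B & A = W t @^-1` B]].

Definition wiener_process (W : R -> Omega -> R) : Prop :=
  [/\ forall t, 0 <= t -> measurable_fun setT (W t),
      {ae P, forall w, W 0 w = 0},
      {ae P, forall w, {within `[0, +oo[, continuous (fun t => W t w)}},
      forall (s t : R) B, 0 <= s < t -> measurable B ->
        P [set w | B (W t w - W s w)] = normal_prob 0 (Num.sqrt (t - s)) B
    & forall (s t : R) A B, 0 <= s < t ->
        <<s process_events W `[0, s] >> A -> measurable B ->
        P (A `&` [set w | B (W t w - W s w)]) =
        (P A * P [set w | B (W t w - W s w)%R])%E].

Notation RR := (measurableTypeR R * measurableTypeR R)%type.

(* A point (x, t) of the plane has mark x and time t; T is a set of times. *)
Definition strip (T : set R) : set RR := [set: R] `*` T.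

Definition point_events (N : Omega -> {measure set RR -> \bar R})
    (T : set R) : set_system Omega :=
  [set A | exists U (B : set \bar R), [/\ measurable U, U `<=` strip T, measurable B
                         & A = (fun w => N w U) @^-1` B]].

Definition plane_measure : {measure set RR -> \bar R} :=
  (@lebesgue_measure R \x @lebesgue_measure R)%E.

(* The Poisson weights are written out because the library's [poisson_pmf]
   is constantly 1 at rate 0. *)
Definition poisson_point_process (N : Omega -> {measure set RR -> \bar R}) :=
  [/\ forall U : set RR, measurable U -> U `<=` strip `[0, +oo[ ->
        measurable_fun setT (fun w => N w U),
      forall w (r : R) (U : set RR), measurable U -> U `<=` `[- r, r] `*` `[0, r] ->
        exists k : nat, N w U = k%:R%:E,
      forall (U : set RR) (r : R) k, measurable U -> U `<=` strip `[0, +oo[ ->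
        plane_measure U = r%:E ->
        P [set w | N w U = k%:R%:E] = (expR (- r) * r ^+ k / k`!%:R)%:E
    & forall k (U : 'I_k -> set RR), (forall i, measurable (U i)) ->
        (forall i, U i `<=` strip `[0, +oo[) -> trivIset setT U ->
        mutually_independent
          (fun i => preimage_set_system setT (fun w => N w (U i)) measurable)].

Definition measurable_wrt (G : set_system Omega) (X : Omega -> R) :=
  forall B, measurable B -> G (X @^-1` B).

Definition usual_conditions (F : R -> set_system Omega) : Prop :=
  [/\ measure_is_complete P,
      forall t, 0 <= t -> sigma_algebra setT (F t) /\ F t `<=` measurable,
      forall s t, 0 <= s <= t -> F s `<=` F t,
      P.-negligible `<=` F 0
    & forall t, 0 <= t -> F t = \bigcap_(u in `]t, +oo[) F u].

(* The process  w, s |-> \sum_k sp_val k w * 1_(]sp_time k, sp_time k.+1])(s),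
   k < sp_size. *)
Record simple_process := SimpleProcess {
  sp_size : nat;
  sp_time : nat -> R;
  sp_val : nat -> Omega -> R }.

Definition sp_predictable (F : R -> set_system Omega) (f : simple_process) :=
  [/\ 0 <= sp_time f 0,
      forall k, sp_time f k <= sp_time f k.+1
    & forall k, measurable_wrt (F (sp_time f k)) (sp_val f k) /\
                exists c, forall w, `|sp_val f k w| <= c].

Definition sp_fun (f : simple_process) (s : R) (w : Omega) : R :=
  \sum_(k < sp_size f) sp_val f k w * \1_`]sp_time f k, sp_time f k.+1] s.

Definition sp_integral (f : simple_process) (W : R -> Omega -> R) (t : R)
    (w : Omega) : R :=
  \sum_(k < sp_size f) sp_val f k w *
    (W (Num.min t (sp_time f k.+1)) w - W (Num.min t (sp_time f k)) w).

(* I is (a version of) the Ito integral of Y over ]0, t] against W: the L^2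
   limit of the integrals of simple processes converging to Y. *)
Definition ito_integral (F : R -> set_system Omega) (W Y : R -> Omega -> R)
    (t : R) (I : Omega -> R) : Prop :=
  [/\ measurable_fun ([set: Omega] `*` (`]0, t] : set (measurableTypeR R)))
        (fun z => Y z.2 z.1),
      measurable_fun setT I
    & exists f : nat -> simple_process,
      [/\ forall l, sp_predictable F (f l),
          (\int[P]_w \int[lebesgue_measure]_(s in `]0%R, t])
             ((sp_fun (f l) s w - Y s w) ^+ 2)%:E)%E @[l --> \oo] --> 0%E
        & (\int[P]_w ((sp_integral (f l) W t w - I w) ^+ 2)%:E)%E
             @[l --> \oo] --> 0%E]].

End noises.

Section master_equation.
Context d (Omega : measurableType d) (R : realType) (P : probability Omega R).
Variables (m n p : nat).
Variables (H : 'M[R[i]]_m) (C : 'I_n.+1 -> 'M[R[i]]_m).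

Notation RR := (measurableTypeR R * measurableTypeR R)%type.

(* Only the W i with i <= p and the N i with p < i are used. *)
Variables (W : 'I_n.+1 -> R -> Omega -> R).
Variables (N : 'I_n.+1 -> Omega -> {measure set RR -> \bar R}).

Definition noise_events (i : 'I_n.+1) (T : set R) : set_system Omega :=
  if (i <= p)%N then process_events (W i) T else point_events (N i) T.

Definition driving_noises : Prop :=
  [/\ forall i : 'I_n.+1, (i <= p)%N -> wiener_process P (W i),
      forall i : 'I_n.+1, (p < i)%N -> poisson_point_process P (N i)
    & mutually_independent P (fun i => <<s noise_events i `[0, +oo[ >>)].

Definition natural_filtration (t : R) : set_system Omega :=
  <<s (\bigcup_i noise_events i `[0, t]) `|` P.-negligible >>.

Definition compensated_integral (i : 'I_n.+1) (t : R) (w : Omega)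
    (f : RR -> 'M[R[i]]_m) : 'M[R[i]]_m :=
  mx_lift (fun g => \int[N i w]_(z in strip `]0, t]) g z) f -
  mx_lift (fun g => \int[@plane_measure R]_(z in strip `]0, t]) g z) f.

Definition sme_solution (F : R -> set_system Omega) (rho0 : 'M[R[i]]_m)
    (rho : R -> Omega -> 'M[R[i]]_m) : Prop :=
  let rhol s w := left_limit (rho ^~ w) s in
  [/\ forall t w, 0 <= t -> states (rho t w),
      forall w, mx_all (@cadlag R) (rho ^~ w),
      forall t, 0 <= t -> mx_all (measurable_wrt (F t)) (rho t)
    & exists M : 'I_n.+1 -> R -> Omega -> 'M[R[i]]_m,
      (forall (i : 'I_n.+1) t j k, (i <= p)%N -> 0 <= t ->
        ito_integral P F (W i)
          (fun s w => complex.Re (diffusion (C i) (rhol s w) j k)) t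
          (fun w => complex.Re (M i t w j k)) /\
        ito_integral P F (W i)
          (fun s w => complex.Im (diffusion (C i) (rhol s w) j k)) t
          (fun w => complex.Im (M i t w j k))) /\
      forall t, 0 <= t -> {ae P, forall w,
        rho t w = rho0
          + mx_lift (fun g => \int[lebesgue_measure]_(s in `]0, t]) g s)
              (fun s => lindblad H C (rhol s w))
          + \sum_(i < n.+1 | (i <= p)%N) M i t w
          + \sum_(i < n.+1 | (p < i)%N)
              compensated_integral i t w
                (fun z => jump_integrand (C i) (rhol z.2 w) z.1)}].

End master_equation.

Section stability.
Context d (Omega : measurableType d) (R : realType) (P : probability Omega R).
Variable m : nat.

Definition mean_state (X : Omega -> 'M[R[i]]_m) : 'M[R[i]]_m :=
  mx_lift (fun f => fine 'E_P[f]) X.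

(* rho rho0 is the process started from the state rho0. *)
Variables (PS : 'M[R[i]]_m) (rho : 'M[R[i]]_m -> R -> Omega -> 'M[R[i]]_m).

Definition invariant_in_mean : Prop :=
  forall rho0, states_on PS rho0 ->
    forall t, 0 < t -> states_on PS (mean_state (rho rho0 t)).

Definition invariant_almost_surely : Prop :=
  forall rho0, states_on PS rho0 ->
    {ae P, forall w, forall t, 0 < t -> states_on PS (rho rho0 t w)}.

Definition GAS_in_mean : Prop :=
  forall rho0, states rho0 ->
    hs_norm (mean_state (rho rho0 t) - PS *m mean_state (rho rho0 t) *m PS)
      @[t --> +oo] --> (0 : R).

Definition GAS_almost_surely : Prop :=
  forall rho0, states rho0 ->
    {ae P, forall w,
      hs_norm (rho rho0 t w - PS *m rho rho0 t w *m PS)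
        @[t --> +oo] --> (0 : R)}.

End stability.

(* Main.v *)
(* Let L be the Lindblad generator and leakage rho = Re tr((1 - P_S) rho).  On
   states the leakage is nonnegative, vanishes exactly on I_S, and tends to 0 if
   and only if ||rho - P_S rho P_S|| does; so both equivalences concern this
   real-linear functional.  A nonnegative variable of mean 0 vanishes almost
   surely, which gives the first one, all times being reached by right
   continuity.  Dominated convergence gives "GAS almost surely => GAS in mean".

   For the converse, the functionals whose mean tends to 0 from every initial
   state form a space stable under the adjoint of L (Barbalat), on which this
   adjoint is injective; by Cayley-Hamilton the space contains phi with
   phi(L rho) = - leakage rho on states.  Then phi(rho(t)) is a supermartingale,
   nonnegative since its mean decreases to 0, hence it tends to 0 almost surely by
   the maximal inequality.  Comparing phi(rho0) with the mean of phi(rho(h)) for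
   small h gives leakage^2 <= c phi, so the leakage tends to 0 as well.

   The stochastic integrals are martingales: for the Wiener part by the Ito
   isometry, for the jump part because the point process and its intensity have
   the same mean on predictable rectangles and the left limits are predictable. *)
From HB Require Import structures.
Require Import Defs.
From mathcomp Require Import all_boot all_order all_algebra.
From mathcomp Require Import all_classical all_reals all_analysis.
From mathcomp Require Import measurable_realfun complex.
From mathcomp Require Import ring lra.
Import Order.TTheory GRing.Theory Num.Theory.
Import numFieldNormedType.Exports.
Local Open Scope classical_set_scope.
Local Open Scope complex_scope.
Local Open Scope sesquilinear_scope.
Local Open Scope ring_scope.

Set Implicit Arguments.
Unset Strict Implicit.
Unset Printing Implicit Defensive.

(** * Positive matrices, projectors and leakage *)

(** Every observable of the solution that occurs below is real-linear. Applied to the equation, such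
    a functional leaves a martingale plus the time integral of phi o L, so its mean increments on
    past events are explicit ([sme_increment]); all estimates rest on this identity. The generator L
    preserves the trace, hence is singular, and phi o L = - leakage cannot be solved for an
    arbitrary right-hand side. Stability makes it solvable: a functional with phi o L = 0 on states
    has a constant mean, which tends to 0 only if phi vanishes on states. This cancels the powers of
    X in the characteristic polynomial. Inequalities on phi are proved at an arbitrary state, taken
    as the initial state of a solution, and then used at the random values of one trajectory. The
    Euler expansion gives phi >= h leakage - K h^2 for all h >= 0; the best h is leakage / (2 K),
    whence the quadratic bound. *)

Notation re := complex.Re.
Notation im := complex.Im.

Section complex_parts.
Variable R : realType.
Implicit Types x y z : R[i].

Lemma reD x y : re (x + y) = re x + re y. Proof. by case: x; case: y. Qed.
Lemma imD x y : im (x + y) = im x + im y. Proof. by case: x; case: y. Qed.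
Lemma reN x : re (- x) = - re x. Proof. by case: x. Qed.
Lemma imN x : im (- x) = - im x. Proof. by case: x. Qed.
Lemma reM x y : re (x * y) = re x * re y - im x * im y.
Proof. by case: x; case: y. Qed.
Lemma imM x y : im (x * y) = re x * im y + im x * re y.
Proof. by case: x; case: y. Qed.
Lemma re_conj x : re (Num.conj x) = re x. Proof. by case: x. Qed.
Lemma im_conj x : im (Num.conj x) = - im x. Proof. by case: x. Qed.

Lemma re_sum (I : Type) (r : seq I) (Q : pred I) (F : I -> R[i]) :
  re (\sum_(i <- r | Q i) F i) = \sum_(i <- r | Q i) re (F i).
Proof. by elim/big_rec2: _ => [|i y x _ <-] //; rewrite reD. Qed.

Lemma im_sum (I : Type) (r : seq I) (Q : pred I) (F : I -> R[i]) :
  im (\sum_(i <- r | Q i) F i) = \sum_(i <- r | Q i) im (F i).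
Proof. by elim/big_rec2: _ => [|i y x _ <-] //; rewrite imD. Qed.

Lemma complex_eqP x y : re x = re y -> im x = im y -> x = y.
Proof. by case: x => a b; case: y => c e /= -> ->. Qed.

Lemma ge0_re_im x : 0 <= x <-> 0 <= re x /\ im x = 0.
Proof.
rewrite lecE /=; split; first by move=> /andP[/eqP -> ->].
by move=> [-> ->]; rewrite eqxx.
Qed.

End complex_parts.

Section adjoint.
Variable R : realType.

Lemma adjE p q (A : 'M[R[i]]_(p, q)) i j : A ^t* i j = Num.conj (A j i).
Proof. by rewrite !mxE. Qed.

Lemma adjM p q r (A : 'M[R[i]]_(p, q)) (B : 'M[R[i]]_(q, r)) :
  (A *m B) ^t* = B ^t* *m A ^t*.
Proof. by rewrite trmx_mul map_mxM. Qed.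

Lemma adjK p q (A : 'M[R[i]]_(p, q)) : A ^t* ^t* = A.
Proof. by apply/matrixP => i j; rewrite !adjE conjCK. Qed.

Lemma adjD p q (A B : 'M[R[i]]_(p, q)) : (A + B) ^t* = A ^t* + B ^t*.
Proof. by rewrite linearD map_mxD. Qed.

Lemma adjZ p q c (A : 'M[R[i]]_(p, q)) : (c *: A) ^t* = Num.conj c *: A ^t*.
Proof. by rewrite linearZ map_mxZ. Qed.

End adjoint.

Section psd_matrices.
Variables (R : realType) (m : nat).
Implicit Types (A rho : 'M[R[i]]_m) (u v : 'cV[R[i]]_m).

Definition sform A u v : R[i] := (u ^t* *m A *m v) 0 0.

Lemma sformDl A u u' v : sform A (u + u') v = sform A u v + sform A u' v.
Proof. by rewrite /sform adjD !mulmxDl mxE. Qed.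

Lemma sformDr A u v v' : sform A u (v + v') = sform A u v + sform A u v'.
Proof. by rewrite /sform mulmxDr mxE. Qed.

Lemma sformZl A c u v : sform A (c *: u) v = Num.conj c * sform A u v.
Proof. by rewrite /sform adjZ -!scalemxAl mxE. Qed.

Lemma sformZr A c u v : sform A u (c *: v) = c * sform A u v.
Proof. by rewrite /sform -scalemxAr mxE. Qed.

Lemma sform_mul A p (B D : 'M[R[i]]_(m, p)) (u v : 'cV[R[i]]_p) :
  (u ^t* *m (B ^t* *m A *m D) *m v) 0 0 = sform A (B *m u) (D *m v).
Proof. by rewrite /sform adjM !mulmxA. Qed.

Lemma sform_delta A j k : sform A (delta_mx j 0) (delta_mx k 0) = A j k.
Proof.
rewrite /sform; have -> : (delta_mx j 0 : 'cV[R[i]]_m) ^t* = delta_mx 0 j.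
  by apply/matrixP => a b; rewrite adjE !mxE andbC rmorph_nat.
by rewrite -rowE -colE !mxE.
Qed.

(** Polarization: the form is real at u + v, which settles the imaginary parts, and at u + i v,
    which settles the real parts. *)
Lemma psd_sform_herm A u v : psd A -> sform A v u = Num.conj (sform A u v).
Proof.
move=> pA.
have real w : im (sform A w w) = 0 by have /ge0_re_im[] := pA w.
have h1 : im (sform A u v) + im (sform A v u) = 0.
  have := real (u + v); rewrite !(sformDl, sformDr) !imD !real; lra.
have h2 : re (sform A u v) = re (sform A v u).
  have := real (u + 'i *: v).
  rewrite !(sformDl, sformDr, sformZl, sformZr) !(imD, imM, reM, re_conj, im_conj) !real /=.
  lra.
by apply: complex_eqP; rewrite ?re_conj ?im_conj; lra.
Qed.

Lemma psd_re_sform A (t : R) u v : psd A ->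
  - (2 * t * re (sform A u v)) <= t ^+ 2 * re (sform A u u) + re (sform A v v).
Proof.
move=> pA; have /ge0_re_im[+ _] := pA (t%:C *: u + v).
rewrite -/(sform _ _ _) !(sformDl, sformDr, sformZl, sformZr).
rewrite (psd_sform_herm u v pA) !(reD, imM, reM, re_conj, im_conj) /=.
lra.
Qed.

(** Cauchy-Schwarz in arithmetic-geometric form. The free weight t replaces a product of square
    roots and is chosen by the caller. *)
Lemma psd_sform_bound A (t : R) u v : psd A -> 0 < t ->
  let b := (t * re (sform A u u) + re (sform A v v) / t) / 2 in
  `|re (sform A u v)| <= b /\ `|im (sform A u v)| <= b.
Proof.
move=> pA t0 /=.
(* Rotating u by a unit number c leaves the right-hand side unchanged; c = 1, -1, i, -i then bound
   the real and imaginary parts from both sides. *)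
have key c : Num.conj c * c = 1 ->
    - (re (sform A (c *: u) v)) <= (t * re (sform A u u) + re (sform A v v) / t) / 2.
  move=> c1; have := psd_re_sform t (c *: u) v pA.
  rewrite [sform A (c *: u) (c *: u)]sformZl sformZr mulrA c1 mul1r => h.
  rewrite -(ler_pM2l t0) -(ler_pM2l (ltr0n R 2)).
  have -> : 2 * (t * ((t * re (sform A u u) + re (sform A v v) / t) / 2)) =
            t ^+ 2 * re (sform A u u) + re (sform A v v).
    by field; rewrite gt_eqF.
  lra.
have := key 1; have := key (-1); have := key 'i; have := key (- 'i).
rewrite !(sformZl, reM, imM, re_conj, im_conj, reN, imN) /=.
rewrite !(mul0r, mul1r, oppr0, sub0r, subr0, mulN1r, mulNr, opprK, add0r, addr0).
move=> k1 k2 k3 k4; split; rewrite ler_norml; apply/andP; split.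
- rewrite lerNl; apply: k4; by apply: complex_eqP; rewrite !(reM, imM, re_conj, im_conj) /=; ring.
- apply: k3; by apply: complex_eqP; rewrite !(reM, imM, re_conj, im_conj) /=; ring.
- rewrite lerNl; apply: k2; by apply: complex_eqP; rewrite !(reM, imM, re_conj, im_conj) /=; ring.
- apply: k1; by apply: complex_eqP; rewrite !(reM, imM, re_conj, im_conj) /=; ring.
Qed.

Lemma psd_diag A j : psd A -> 0 <= re (A j j) /\ im (A j j) = 0.
Proof. by move=> pA; apply/ge0_re_im; have := pA (delta_mx j 0); rewrite -/(sform _ _ _) sform_delta. Qed.

Lemma psd_diag_le_tr A j : psd A -> re (A j j) <= re (\tr A).
Proof.
move=> pA; rewrite /mxtrace re_sum (bigD1 j) //= lerDl sumr_ge0 // => i _.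
by have [] := psd_diag i pA.
Qed.

Lemma psd_tr A : psd A -> 0 <= re (\tr A) /\ im (\tr A) = 0.
Proof.
move=> pA; rewrite /mxtrace re_sum im_sum; split.
  by apply: sumr_ge0 => i _; have [] := psd_diag i pA.
by apply: big1 => i _; have [] := psd_diag i pA.
Qed.

Lemma psd_entry_le_tr A j k : psd A ->
  `|re (A j k)| <= re (\tr A) /\ `|im (A j k)| <= re (\tr A).
Proof.
move=> pA; have := psd_sform_bound (delta_mx j 0) (delta_mx k 0) pA ltr01.
rewrite /= !sform_delta mul1r divr1; have := psd_diag_le_tr j pA.
by have := psd_diag_le_tr k pA; lra.
Qed.

Lemma psd_mul A (B : 'M[R[i]]_m) : psd A -> psd (B *m A *m B ^t*).
Proof.
move=> pA v; rewrite -[X in _ *m (X *m A *m _)]adjK sform_mul; exact: pA.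
Qed.

Lemma tr_mul_adj A (B : 'M[R[i]]_m) :
  \tr (B ^t* *m A *m B) = \sum_j sform A (B *m delta_mx j 0) (B *m delta_mx j 0).
Proof.
apply: eq_bigr => j _.
by rewrite -sform_mul -/(sform _ _ _) sform_delta.
Qed.

Lemma psd_tr_conj A (B : 'M[R[i]]_m) : psd A ->
  0 <= re (\tr (B ^t* *m A *m B)).
Proof.
move=> pA; rewrite tr_mul_adj re_sum sumr_ge0 // => j _.
by have /ge0_re_im[] := pA (B *m delta_mx j 0).
Qed.

Lemma sform_conj_le_tr A (B : 'M[R[i]]_m) j : psd A ->
  re (sform A (B *m delta_mx j 0) (B *m delta_mx j 0)) <= re (\tr (B ^t* *m A *m B)).
Proof.
move=> pA; rewrite tr_mul_adj re_sum (bigD1 j) //= lerDl sumr_ge0 // => k _.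
by have /ge0_re_im[] := pA (B *m delta_mx k 0).
Qed.

Lemma hs_norm_ge A j k : `|re (A j k)| <= hs_norm A /\ `|im (A j k)| <= hs_norm A.
Proof.
have sq : re (\tr (A ^t* *m A)) = \sum_b \sum_a (re (A a b) ^+ 2 + im (A a b) ^+ 2).
  rewrite /mxtrace re_sum; apply: eq_bigr => b _; rewrite !mxE re_sum.
  by apply: eq_bigr => a _; rewrite adjE reM re_conj im_conj; ring.
rewrite /hs_norm sq -!sqrtr_sqr !ler_sqrt ?sqr_ge0 //; last first.
  1,2: by apply: sumr_ge0 => b _; apply: sumr_ge0 => a _; rewrite addr_ge0 ?sqr_ge0.
have h : re (A j k) ^+ 2 + im (A j k) ^+ 2 <= \sum_b \sum_a (re (A a b) ^+ 2 + im (A a b) ^+ 2).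
  rewrite (bigD1 k) //= (bigD1 j) //= -addrA lerDl addr_ge0 //.
    by apply: sumr_ge0 => a _; rewrite addr_ge0 ?sqr_ge0.
  by apply: sumr_ge0 => b _; apply: sumr_ge0 => a _; rewrite addr_ge0 ?sqr_ge0.
by split; apply: le_trans h; rewrite ?lerDl ?lerDr sqr_ge0.
Qed.

(** The squared norm is at most 2 m^2 e^2; the cruder constant 2 m avoids the square root of 2. *)
Lemma hs_norm_le A (e : R) : 0 <= e ->
  (forall j k, `|re (A j k)| <= e /\ `|im (A j k)| <= e) ->
  hs_norm A <= (2 * m)%:R * e.
Proof.
move=> e0 h.
have -> : (2 * m)%:R * e = Num.sqrt (((2 * m)%:R * e) ^+ 2).
  by rewrite sqrtr_sqr ger0_norm // mulr_ge0.
rewrite /hs_norm ler_wsqrtr //.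
have -> : re (\tr (A ^t* *m A)) = \sum_b \sum_a (re (A a b) ^+ 2 + im (A a b) ^+ 2).
  rewrite /mxtrace re_sum; apply: eq_bigr => b _; rewrite !mxE re_sum.
  by apply: eq_bigr => a _; rewrite adjE reM re_conj im_conj; ring.
apply: (@le_trans _ _ (\sum_(b < m) \sum_(a < m) (e ^+ 2 + e ^+ 2))).
  apply: ler_sum => b _; apply: ler_sum => a _.
  have [h1 h2] := h a b.
  by apply: lerD; rewrite -[X in X <= _]real_normK ?num_real // lerXn2r // nnegrE.
rewrite !sumr_const !card_ord -mulrnA -[X in X <= _]mulr_natl !natrM.
have := sqr_ge0 (m%:R * e : R); set c : R := m%:R; nra.
Qed.

End psd_matrices.

(** * Orthogonal projectors and leakage out of the subspace *)

Section projectors.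
Variables (R : realType) (m : nat) (V : {vspace 'cV[R[i]]_m}) (P : 'M[R[i]]_m).
Hypothesis hP : orth_projector V P.

(** The vector e_k - P e_k is orthogonal to the subspace, in particular to P e_j; entry by entry
    this reads P^* (1 - P) = 0. *)
Lemma orth_projector_adj_mul : P ^t* *m P = P ^t*.
Proof.
apply/matrixP => j k; pose ej : 'cV[R[i]]_m := delta_mx j 0.
pose ek : 'cV[R[i]]_m := delta_mx k 0.
have [_ /(_ (P *m ej) (hP ej).1) h] := hP ek.
have : sform (P ^t* *m (1%:M - P)) ej ek = 0.
  by rewrite -h /sform adjM -!mulmxA mulmxBl mul1mx mulmxA.
rewrite sform_delta mulmxBr mulmx1 !mxE => /eqP.
by rewrite subr_eq0 => /eqP ->.
Qed.

Lemma orth_projector_herm : P ^t* = P.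
Proof. by rewrite -{2}(adjK P) -orth_projector_adj_mul adjM adjK orth_projector_adj_mul. Qed.

Lemma orth_projector_idem : P *m P = P.
Proof. by rewrite -{1}orth_projector_herm orth_projector_adj_mul orth_projector_herm. Qed.

Lemma orth_projectorC_herm : (1%:M - P) ^t* = 1%:M - P.
Proof.
apply/matrixP => j k; rewrite adjE -{2}orth_projector_herm !mxE rmorphB /=.
by rewrite rmorph_nat eq_sym.
Qed.

Lemma orth_projectorC_idem : (1%:M - P) *m (1%:M - P) = 1%:M - P.
Proof.
by rewrite mulmxBl mul1mx mulmxBr mulmx1 orth_projector_idem subrr subr0.
Qed.

(** Cyclicity and idempotence bring the trace to the shape B^* rho B, whose trace is nonnegative by
    [psd_tr_conj]. *)
Lemma tr_orth_projectorC rho :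
  \tr ((1%:M - P) *m rho) = \tr ((1%:M - P) ^t* *m rho *m (1%:M - P)).
Proof.
rewrite orth_projectorC_herm [RHS]mxtrace_mulC mulmxA.
by rewrite orth_projectorC_idem.
Qed.

Lemma tr_orth_projector rho :
  \tr (P *m rho) = \tr (P ^t* *m rho *m P).
Proof.
by rewrite orth_projector_herm [RHS]mxtrace_mulC mulmxA orth_projector_idem.
Qed.

Definition leakage (rho : 'M[R[i]]_m) : R := re (\tr ((1%:M - P) *m rho)).

Lemma leakageE rho : states rho -> leakage rho = 1 - re (\tr (P *m rho)).
Proof.
by move=> [_ tr1]; rewrite /leakage mulmxBl mul1mx linearB /= tr1 reD reN.
Qed.

Lemma leakage_ge0 rho : states rho -> 0 <= leakage rho.
Proof. by move=> [ps _]; rewrite /leakage tr_orth_projectorC psd_tr_conj. Qed.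

Lemma tr_projector_ge0 rho : states rho -> 0 <= re (\tr (P *m rho)).
Proof. by move=> [ps _]; rewrite tr_orth_projector psd_tr_conj. Qed.

Lemma leakage_le1 rho : states rho -> leakage rho <= 1.
Proof. by move=> st; rewrite leakageE // gerBl tr_projector_ge0. Qed.

Lemma im_tr_projector rho : states rho -> im (\tr (P *m rho)) = 0.
Proof.
move=> [ps _]; rewrite tr_orth_projector tr_mul_adj im_sum big1 // => j _.
by have /ge0_re_im[] := ps (P *m delta_mx j 0).
Qed.

Lemma states_on_leakage rho : states rho ->
  states_on P rho <-> leakage rho = 0.
Proof.
move=> st; rewrite leakageE //; split=> [[_ ->]|h]; first by rewrite subrr.
split=> //; apply: complex_eqP; last by rewrite im_tr_projector.
by rewrite /=; lra.
Qed.

(** The leakage is the trace of rho - P rho P, and each of its m diagonal entries is at most the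
    norm. *)
Lemma leakage_le_hs_norm rho :
  leakage rho <= m%:R * hs_norm (rho - P *m rho *m P).
Proof.
have -> : leakage rho = re (\tr (rho - P *m rho *m P)).
  rewrite /leakage mulmxBl mul1mx !linearB /=.
  by rewrite (mxtrace_mulC (P *m rho)) mulmxA orth_projector_idem.
rewrite /mxtrace re_sum (le_trans (ler_norm _)) // (le_trans (ler_norm_sum _ _ _)) //.
rewrite (le_trans (ler_sum _ (fun j _ => (hs_norm_ge _ j j).1))) //.
by rewrite sumr_const card_ord mulr_natl.
Qed.

(* rho - P rho P = Q rho + P rho Q with Q = 1 - P, and the weight t balances
   the two sides of the Cauchy-Schwarz inequality for the form of rho. *)
Lemma hs_norm_le_leakage rho t : states rho -> 0 < t ->
  hs_norm (rho - P *m rho *m P) <= (2 * m)%:R * (t * leakage rho + t^-1).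
Proof.
move=> st t0; have [ps tr1] := st.
have g0 := leakage_ge0 st.
apply: hs_norm_le; first by rewrite addr_ge0 ?mulr_ge0 ?invr_ge0 ?(ltW t0).
move=> j k; set Q := 1%:M - P.
have -> : rho - P *m rho *m P = Q ^t* *m rho *m 1%:M + P ^t* *m rho *m Q.
  rewrite orth_projectorC_herm orth_projector_herm /Q.
  by rewrite mulmx1 mulmxBl mul1mx mulmxBr mulmx1 addrA subrK.
rewrite mxE reD imD.
rewrite -[(Q ^t* *m _ *m _) j k]sform_delta -[(P ^t* *m _ *m _) j k]sform_delta.
rewrite /sform !sform_mul mul1mx.
have qle i : re (sform rho (Q *m delta_mx i 0) (Q *m delta_mx i 0)) <= leakage rho.
  by rewrite /leakage tr_orth_projectorC sform_conj_le_tr.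
have ple i : re (sform rho (P *m delta_mx i 0) (P *m delta_mx i 0)) <= 1.
  apply: le_trans (sform_conj_le_tr _ _ ps) _.
  by rewrite -tr_orth_projector; have := leakageE st; lra.
have ele i : re (sform rho (delta_mx i 0) (delta_mx i 0)) <= 1.
  by rewrite sform_delta; have := psd_diag_le_tr i ps; rewrite tr1.
have [a1 a2] := psd_sform_bound (Q *m delta_mx j 0) (delta_mx k 0) ps t0.
have it0 : 0 < t^-1 by rewrite invr_gt0.
have [b1 b2] := psd_sform_bound (P *m delta_mx j 0) (Q *m delta_mx k 0) ps it0.
rewrite invrK in b1 b2.
have q1 := qle j; have q2 := qle k; have p1 := ple j; have e1 := ele k.
have c1 : t * re (sform rho (Q *m delta_mx j 0) (Q *m delta_mx j 0)) <= t * leakage rho.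
  by rewrite ler_pM2l.
have c2 : re (sform rho (Q *m delta_mx k 0) (Q *m delta_mx k 0)) * t <= t * leakage rho.
  by rewrite mulrC ler_pM2l.
have c3 : t^-1 * re (sform rho (P *m delta_mx j 0) (P *m delta_mx j 0)) <= t^-1.
  by rewrite ger_pMr.
have c4 : re (sform rho (delta_mx k 0) (delta_mx k 0)) / t <= t^-1.
  by rewrite ger_pMl.
split; apply: le_trans (ler_normD _ _) _; lra.
Qed.

End projectors.

(** * Real-linear functionals *)

Section real_linear_functionals.
Variables (R : realType) (m : nat).
Implicit Types (A rho : 'M[R[i]]_m) (phi : 'M[R[i]]_m -> R).

(** Linearity over the reals only, so that real and imaginary parts of entries, traces and forms all
    qualify. *)
Definition rlin phi :=
  (forall A B, phi (A + B) = phi A + phi B) /\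
  (forall (a : R) A, phi (a%:C *: A) = a * phi A).

Lemma rlin0 phi : rlin phi -> phi 0 = 0.
Proof. by move=> [_ hZ]; rewrite -(scale0r (0 : 'M[R[i]]_m)) hZ mul0r. Qed.

Lemma rlinN phi A : rlin phi -> phi (- A) = - phi A.
Proof.
move=> h; apply/eqP; rewrite -addr_eq0 -h.1 addrC subrr; exact/eqP/rlin0.
Qed.

Lemma rlinB phi A B : rlin phi -> phi (A - B) = phi A - phi B.
Proof. by move=> h; rewrite h.1 rlinN. Qed.

Lemma rlin_sum phi (I : Type) (r : seq I) (Q : pred I) (F : I -> 'M[R[i]]_m) :
  rlin phi -> phi (\sum_(i <- r | Q i) F i) = \sum_(i <- r | Q i) phi (F i).
Proof.
move=> h; elim/big_rec2: _ => [|i y x _ <-]; first exact: rlin0.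
by rewrite h.1.
Qed.

(** Transfers to every functional what is known for the parts of the entries: bounds, limits,
    measurability, integrals and the martingale property. *)
Lemma rlin_coord phi : rlin phi -> exists a b : 'I_m -> 'I_m -> R,
  forall A, phi A = \sum_j \sum_k (a j k * re (A j k) + b j k * im (A j k)).
Proof.
move=> h; exists (fun j k => phi (delta_mx j k)), (fun j k => phi ('i *: delta_mx j k)) => A.
rewrite {1}(matrix_sum_delta A) rlin_sum //; apply: eq_bigr => j _.
rewrite rlin_sum //; apply: eq_bigr => k _.
have -> : A j k *: delta_mx j k = (re (A j k))%:C *: delta_mx j k +
    (im (A j k))%:C *: ('i *: delta_mx j k) :> 'M[R[i]]_m.
  by rewrite scalerA -scalerDl {1}(complexE (A j k)) (mulrC 'i).
by rewrite h.1 !h.2 !(mulrC (phi _)).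
Qed.

Lemma rlin_re j k : rlin (fun A => re (A j k)).
Proof. by split=> [A B|a A]; rewrite !mxE ?reD ?reM /= ?mul0r ?subr0. Qed.

Lemma rlin_im j k : rlin (fun A => im (A j k)).
Proof. by split=> [A B|a A]; rewrite !mxE ?imD ?imM /= ?mul0r ?addr0. Qed.

Lemma rlin_tr c (B : 'M[R[i]]_m) : rlin (fun A => re (c * \tr (B *m A))).
Proof.
split=> [A D|a A]; first by rewrite mulmxDr linearD mulrDr reD.
by rewrite -scalemxAr linearZ /= mulrCA reM /= mul0r subr0.
Qed.

Lemma rlin_comp phi (f : {linear 'M[R[i]]_m -> 'M[R[i]]_m}) :
  rlin phi -> rlin (phi \o f).
Proof. by move=> h; split=> [A B|a A] /=; rewrite ?linearD ?linearZ ?h.1 ?h.2. Qed.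

Lemma rlin_leakage (P : 'M[R[i]]_m) : rlin (leakage P).
Proof.
have := rlin_tr 1 (1%:M - P); congr (rlin _); apply/funext => A.
by rewrite mul1r.
Qed.

Lemma state_entry rho j k : states rho -> `|re (rho j k)| <= 1 /\ `|im (rho j k)| <= 1.
Proof. by move=> [ps tr1]; have := psd_entry_le_tr j k ps; rewrite tr1. Qed.

(** With [state_entry] it bounds each functional uniformly on states, the source of the constants K
    in the estimates on solutions. *)
Lemma rlin_entry_bound phi : rlin phi -> exists K, 0 <= K /\
  forall A (M : R), (forall j k, `|re (A j k)| <= M /\ `|im (A j k)| <= M) -> `|phi A| <= K * M.
Proof.
move=> /rlin_coord[a [b h]].
exists (\sum_j \sum_k (`|a j k| + `|b j k|)); split.
  by apply: sumr_ge0 => j _; apply: sumr_ge0 => k _; rewrite addr_ge0.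
move=> A M hM; rewrite h mulr_suml (le_trans (ler_norm_sum _ _ _)) //.
apply: ler_sum => j _; rewrite mulr_suml (le_trans (ler_norm_sum _ _ _)) //.
apply: ler_sum => k _; rewrite (le_trans (ler_normD _ _)) // !normrM mulrDl.
by have [h1 h2] := hM j k; apply: lerD; rewrite ler_wpM2l.
Qed.

Lemma rlin_state_bound phi : rlin phi -> exists K, 0 <= K /\
  forall rho, states rho -> `|phi rho| <= K.
Proof.
move=> /rlin_entry_bound[K [K0 h]]; exists K; split=> // rho st.
by rewrite -[K]mulr1; apply: h => j k; exact: state_entry.
Qed.

Lemma lindblad_is_linear n H (C : 'I_n.+1 -> 'M[R[i]]_m) : linear (lindblad H C).
Proof.
move=> c A B; rewrite /lindblad.
have -> : c *: (- ('i *: (H *m A - A *m H)) + \sum_(i < n.+1)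
    (C i *m A *m (C i) ^t* - 2^-1 *: ((C i) ^t* *m C i *m A + A *m ((C i) ^t* *m C i)))) =
  - ('i *: (H *m (c *: A) - (c *: A) *m H)) + \sum_(i < n.+1)
    (C i *m (c *: A) *m (C i) ^t* -
     2^-1 *: ((C i) ^t* *m C i *m (c *: A) + (c *: A) *m ((C i) ^t* *m C i))).
  rewrite scalerDr scalerN scaler_sumr; congr (- _ + _).
    by rewrite -scalemxAr -scalemxAl -scalerBr !scalerA mulrC.
  apply: eq_bigr => i _.
  by rewrite -!scalemxAr -!scalemxAl -scalerDr scalerBr !scalerA (mulrC c).
set X := c *: A; rewrite addrACA; congr (_ + _).
  by rewrite -opprD -scalerDr mulmxDr mulmxDl opprD addrACA.
rewrite -big_split /=; apply: eq_bigr => i _.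
rewrite addrACA -opprD -scalerDr mulmxDr !mulmxDl mulmxDr; congr (_ - _ *: _).
by rewrite addrACA.
Qed.

HB.instance Definition _ n H (C : 'I_n.+1 -> 'M[R[i]]_m) :=
  GRing.isLinear.Build R[i] 'M[R[i]]_m 'M[R[i]]_m *:%R (lindblad H C)
    (lindblad_is_linear H C).

End real_linear_functionals.

(* The observables that vanish along all trajectories form an invariant
   subspace of the adjoint generator, on which the latter is injective by [van_inj];
   Cayley-Hamilton inverts it there. *)
Section vanishing_observables.
Variables (R : realType) (d : nat) (Lam : 'M[R[i]]_d) (f : 'rV[R[i]]_d -> R[i]).
Hypotheses (fD : forall x y, f (x + y) = f x + f y)
  (fZ : forall c x, f (c *: x) = c * f x).
Variables (S : set 'rV[R[i]]_d) (van : ('rV[R[i]]_d -> R) -> Prop).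

Let obs c (A : 'M[R[i]]_d) (x : 'rV[R[i]]_d) : R := re (c * f (x *m A)).

Hypothesis vanD : forall g h, van g -> van h -> van (fun x => g x + h x).
Hypothesis van_f : forall c, van (fun x => re (c * f x)).
Hypothesis van_gen : forall c A, van (obs c A) -> van (obs c (Lam *m A)).
Hypothesis van_inj : forall c A, van (obs c A) ->
  (forall x, S x -> obs c (Lam *m A) x = 0) -> forall x, S x -> obs c A x = 0.

(** Write the characteristic polynomial of Lam as q X^k with q(0) != 0. Cayley-Hamilton and
    injectivity make q(Lam) vanish on the observables; with q = r X + a and a != 0, the observable f
    o r(Lam) / a is then a preimage of - f. Row vectors are multiplied on the right, so [Lam *m A]
    applies the generator first. *)
Lemma vanishing_potential : (0 < d)%N -> exists c A, van (obs c A) /\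
  forall x, S x -> obs c (Lam *m A) x = - re (f x).
Proof.
case: d Lam f S van @obs fD fZ vanD van_f van_gen van_inj => // d' L g T v o gD gZ vD vg vL vinj _.
have o_scale c a A : o c (a *: A) = o (c * a) A.
  by apply/funext => x; rewrite /o -scalemxAr gZ mulrA.
(* Stability under the generator spreads from f to every polynomial in L, by induction along the
   Horner form. *)
have good p : forall c, v (o c (horner_mx L p)).
  elim/poly_ind: p => [|p a ih] c.
    have := vg 0; congr v; apply/funext => x.
    rewrite /o rmorph0.
    by rewrite mulmx0 -(scale0r (0 : 'rV_d'.+1)) gZ !mul0r mulr0.
  rewrite rmorphD rmorphM /= horner_mx_X horner_mx_C.
  have -> : o c (horner_mx L p * L + a%:M) =
      (fun x => o c (L *m horner_mx L p) x + re (c * a * g x)).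
    apply/funext => x; rewrite /o mulmxDr gD mulrDr reD mul_mx_scalar gZ mulrA.
    by congr (re (c * g (x *m _)) + _); apply: comm_horner_mx.
  by apply: vD; [apply: vL | exact: vg].
have [k [q]] := multiplicity_XsubC (char_poly L) 0.
rewrite monic_neq0 ?char_poly_monic //= => q0 eq_char.
have CH : horner_mx L q *m L ^+ k = 0.
  have := Cayley_Hamilton L.
  by rewrite eq_char rmorphM rmorphXn /= subr0 horner_mx_X.
have LXq j : L ^+ j *m horner_mx L q = horner_mx L q *m L ^+ j.
  have := comm_horner_mx2 L q ('X^j); rewrite rmorphXn /= horner_mx_X => h.
  by symmetry; exact: h.
(* The factors L of L^k q(L) = 0 are cancelled one at a time by [vinj]; [good] keeps every L^j q(L)
   among the vanishing observables. *)
have qS c x : T x -> o c (horner_mx L q) x = 0.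
  have : forall c x, T x -> o c (L ^+ k *m horner_mx L q) x = 0.
    move=> c' x' _; rewrite LXq CH /o mulmx0.
    by rewrite -(scale0r (0 : 'rV_d'.+1)) gZ mul0r mulr0.
  elim: (k) c x => [|j ih] c x hj Tx; first by have := hj c x Tx; rewrite expr0 mul1mx.
  apply: ih => // c' x' Tx'.
  apply: (vinj c' _ _ _ x' Tx') => [|y Ty].
    by have := good ('X^j * q) c'; rewrite rmorphM rmorphXn /= horner_mx_X.
  by have := hj c' y Ty; rewrite exprS -mulmxA.
have [r [a qE]] : exists r a, q = r * 'X + a%:P.
  by elim/poly_ind: (q) => [|r a _]; [exists 0, 0; rewrite mul0r addr0 | exists r, a].
have a0 : a != 0 by move: q0; rewrite qE rootE !hornerE.
exists a^-1, (horner_mx L r); split; first exact: good.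
move=> x Tx; have := qS a^-1 x Tx.
rewrite qE rmorphD rmorphM /= horner_mx_X horner_mx_C /o mulmxDr gD mulrDr reD.
rewrite mul_mx_scalar gZ mulrA mulVf // mul1r => /eqP; rewrite addr_eq0 => /eqP <-.
by congr (re (_ * g (x *m _))); apply: comm_mx_horner.
Qed.

End vanishing_observables.

(** * Independence of the noise from the past *)

Section independence.
Context d (Omega : measurableType d) (R : realType) (P : probability Omega R).
Implicit Types (G : set_system Omega) (A D : set Omega).

Lemma g_sigma_setI G : setI_closed <<s G >>.
Proof. by move=> A B GA GB; exact: (@measurableI _ (g_sigma_algebraType G)). Qed.

Lemma g_sigma_sub G : G `<=` measurable -> <<s G >> `<=` measurable.
Proof. by move=> Gm; apply: smallest_sub => //; exact: sigma_algebra_measurable. Qed.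

(** Dynkin's argument: for fixed D, the measurable events independent of D form a lambda-system. *)
Lemma indep_g_sigma G D : setI_closed G -> G `<=` measurable -> measurable D ->
  (forall A, G A -> P (A `&` D) = (P A * P D)%E) ->
  forall A, <<s G >> A -> P (A `&` D) = (P A * P D)%E.
Proof.
move=> GI Gm mD GD.
pose L := [set A | measurable A /\ P (A `&` D) = (P A * P D)%E].
suff : <<s G >> `<=` L by move=> h A /h[].
have PDfin := fin_num_measure P _ mD.
apply: lambda_system_subset => //; last by move=> A GA; split; [exact: Gm|exact: GD].
split=> //.
- by split; [exact: measurableT | rewrite setTI probability_setT mul1e].
- move=> A B BA [mA hA] [mB hB]; split; first exact: measurableD.
  have -> : (A `\` B) `&` D = (A `&` D) `\` (B `&` D).
    by rewrite [RHS]setDE setCI setIUr -[A `&` D `&` ~` D]setIA setICr setI0 setU0 setDE setIAC.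
  have mBD : measurable (B `&` D) by exact: measurableI.
  have mAD : measurable (A `&` D) by exact: measurableI.
  have BAD : B `&` D `<=` A `&` D by exact: setSI.
  rewrite measureD ?ltey_eq ?fin_num_measure // (setIidr BAD).
  rewrite measureD ?ltey_eq ?fin_num_measure // (setIidr BA).
  transitivity (P A * P D - P B * P D)%E; first by congr (_ - _)%E.
  by rewrite -muleBl // fin_num_adde_defl // fin_numN fin_num_measure.
- move=> F ndF hF; have mF n : measurable (F n) by have [] := hF n.
  split; first exact: bigcupT_measurable.
  have c1 : P (F n `&` D) @[n --> \oo] --> P (\bigcup_n F n `&` D).
    rewrite setI_bigcupl; apply: nondecreasing_cvg_mu.
    - by move=> n; exact: measurableI.
    - by apply: bigcupT_measurable => n; exact: measurableI.
    - by move=> a b ab; apply/subsetPset; apply: setSI; exact/subsetPset/ndF.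
  have c2 : (P (F n) * P D)%E @[n --> \oo] --> (P (\bigcup_n F n) * P D)%E.
    apply: cvgeZr => //; apply: nondecreasing_cvg_mu => //.
    exact: bigcupT_measurable.
  have e : (fun n => P (F n `&` D)) = (fun n => P (F n) * P D)%E.
    by apply/funext => n; have [] := hF n.
  by rewrite e in c1; exact: cvg_unique c1 c2.
Qed.

(** Intersections of one event from each [Gi], together with the negligible events, form a pi-system
    that contains all the generators. Completeness makes the negligible events measurable. *)
Lemma indep_join (I : finType) (Gi : I -> set_system Omega) D :
  measure_is_complete P ->
  (forall i, setI_closed (Gi i)) -> (forall i, Gi i setT) ->
  (forall i, Gi i `<=` measurable) -> measurable D ->
  (forall E : I -> set Omega, (forall i, Gi i (E i)) ->
    P (\bigcap_i E i `&` D) = (P (\bigcap_i E i) * P D)%E) ->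
  forall A, <<s (\bigcup_i Gi i) `|` P.-negligible >> A ->
    P (A `&` D) = (P A * P D)%E.
Proof.
move=> cP GI GT Gm mD GD A.
pose H := [set A | (exists E, (forall i, Gi i (E i)) /\ A = \bigcap_i E i) \/
                   P.-negligible A].
have sub : (\bigcup_i Gi i) `|` P.-negligible `<=` H.
  move=> B [[i _ GB]|nB]; [left|by right].
  exists (fun j => if j == i then B else setT); split.
    by move=> j; case: eqP => [->|].
  apply/seteqP; split=> [w Bw j _|w /(_ i Logic.I)]; last by rewrite eqxx.
  by case: eqP.
move=> /(sub_smallest2r (@smallest_sigma_algebra _ setT H) sub).
have mcap E : (forall i, Gi i (E i)) -> measurable (\bigcap_(i : I) E i).
  move=> hE; apply: fin_bigcap_measurable => // i _; exact: (Gm i).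
have negl B : P.-negligible B -> measurable B /\ P B = 0%E.
  by move=> nB; have mB := cP _ nB; split=> //; exact: measure_negligible.
apply: indep_g_sigma => //.
- move=> B B' [[E [hE ->]]|nB]; last first.
    by move=> _; right; apply: negligibleS nB; exact: subIsetl.
  move=> [[E' [hE' ->]]|nB]; last first.
    by right; apply: negligibleS nB; exact: subIsetr.
  left; exists (fun i => E i `&` E' i); split; first by move=> i; exact: GI.
  by rewrite bigcapI.
- by move=> B [[E [hE ->]]|/negl[]//]; exact: mcap.
- move=> B [[E [hE ->]]|nB]; first exact: GD.
  have [mB ->] := negl B nB; rewrite mul0e.
  by apply: measure_negligible; [exact: measurableI|apply: negligibleS nB; exact: subIsetl].
Qed.

(** The reindexing by h turns the families over ['I_k] of [poisson_point_process] into families over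
    any finite type. *)
Lemma mutually_independent_full (I J : finType) (h : J -> I) (G : I -> set_system Omega) :
  bijective h -> mutually_independent P (fun j => G (h j)) ->
  forall E : I -> set Omega, (forall i, G i (E i)) ->
    P (\bigcap_i E i) = (\prod_i P (E i))%E.
Proof.
move=> bh mi E hE.
have := mi [set: J]%SET (fun j => E (h j)) (fun j _ => hE (h j)).
rewrite (reindex h) /=; last exact/onW_bij.
have [k hk kh] := bh.
have -> : \bigcap_(i in [set` [set: J]%SET]) E (h i) = \bigcap_i E i.
  apply/seteqP; split=> w hw i _.
    by rewrite -(kh i); apply: hw; rewrite /= inE.
  exact: hw.
by move=> ->; apply: eq_bigl => j; rewrite inE.
Qed.

End independence.

(** * One Poisson process: later points against earlier ones *)

Section poisson_past.
Context d (Omega : measurableType d) (R : realType) (P : probability Omega R).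
Notation RR := (measurableTypeR R * measurableTypeR R)%type.
Variable N : Omega -> {measure set RR -> \bar R}.
Hypotheses (cP : measure_is_complete P) (hN : poisson_point_process P N).

Let mN U : measurable U -> U `<=` strip `[0, +oo[ -> measurable_fun setT (fun w => N w U).
Proof. by case: hN => h _ _ _; exact: h. Qed.

Let pre (U : set RR) := preimage_set_system setT (fun w => N w U) measurable.

Let pre_sigma U : sigma_algebra setT (pre U).
Proof. by apply: sigma_algebra_preimage; exact: sigma_algebra_measurable. Qed.

Let preI U : setI_closed (pre U).
Proof.
move=> A B [A' mA <-] [B' mB <-]; exists (A' `&` B'); first exact: measurableI.
by rewrite !setTI.
Qed.

Let preT U : pre U setT.
Proof. by exists setT => //; rewrite setTI preimage_setT. Qed.

Let pre_measurable U : measurable U -> U `<=` strip `[0, +oo[ -> pre U `<=` measurable.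
Proof. by move=> mU sU _ [B mB <-]; exact: mN. Qed.

Section atoms.
Variables (K : nat) (U : 'I_K -> set RR) (S V : set RR) (D : set Omega).
Hypotheses (mU : forall j, measurable (U j)) (US : forall j, U j `<=` S)
  (mS : measurable S) (S0 : S `<=` strip `[0, +oo[) (mV : measurable V)
  (V0 : V `<=` strip `[0, +oo[) (SV : S `&` V = set0) (hD : pre V D).

(** Overlapping regions carry dependent counts. The atoms of the algebra generated by the U j inside
    S are disjoint, so that the independence of counts on disjoint regions applies to them. *)
Let atom (J : {set 'I_K}) : set RR :=
  S `&` \bigcap_(j : 'I_K) (if j \in J then U j else ~` U j).

Let matom J : measurable (atom J).
Proof.
apply: measurableI => //; apply: fin_bigcap_measurable => // j _.
by case: ifP => // _; exact: measurableC.
Qed.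

Let atom0 J : atom J `<=` strip `[0, +oo[.
Proof. by move=> z [/S0]. Qed.

Let atom_inj J J' z : atom J z -> atom J' z -> J = J'.
Proof.
move=> [_ h] [_ h']; apply/setP => j.
have := h j Logic.I; have := h' j Logic.I.
by case: ifP => _; case: ifP.
Qed.

Let U_atoms j : U j = \bigcup_(J in [set J : {set 'I_K} | j \in J]) atom J.
Proof.
apply/seteqP; split=> [z Uz|z [J /= jJ [_ /(_ j Logic.I)]]]; last by rewrite jJ.
exists [set i | `[< U i z >]]%SET; first by rewrite /= inE; exact/asboolP.
split; first exact: US Uz.
move=> i _; rewrite inE; case: asboolP => //.
Qed.

(** The index [None] holds the later region V, which is disjoint from all atoms. *)
Let ext (o : option {set 'I_K}) := if o is Some J then atom J else V.

Let atoms_indep (E : option {set 'I_K} -> set Omega) :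
  (forall o, pre (ext o) (E o)) -> P (\bigcap_o E o) = (\prod_o P (E o))%E.
Proof.
apply: (mutually_independent_full (G := fun o => pre (ext o))
  (@enum_val_bij (option {set 'I_K}))).
case: hN => _ _ _ h; apply: h.
- by move=> i; case: (enum_val i) => [J|] /=.
- by move=> i; case: (enum_val i) => [J|] /=.
- apply/trivIsetP => i j _ _ ij.
  have : enum_val i != enum_val j by rewrite (inj_eq enum_val_inj).
  case: (enum_val i) => [J|]; case: (enum_val j) => [J'|] //= ne.
  + apply/seteqP; split=> // z [h1 h2]; move: ne.
    by rewrite (atom_inj h1 h2) eqxx.
  + by apply/seteqP; split=> // z [[Sz _] Vz]; rewrite -SV.
  + by apply/seteqP; split=> // z [Vz [Sz _]]; rewrite -SV.
Qed.

(** The count on U j is the sum of the counts on the atoms that it contains, so events about the U j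
    are events about the atoms. *)
Lemma poisson_atoms_indep A : <<s \bigcup_j pre (U j) >> A ->
  P (A `&` D) = (P A * P D)%E.
Proof.
move=> hA.
have mD : measurable D by exact: pre_measurable hD.
have : <<s (\bigcup_J pre (atom J)) `|` P.-negligible >> A.
  have : <<s \bigcup_J pre (atom J) >> A; last first.
    apply: sub_smallest2r; first exact: smallest_sigma_algebra.
    exact: subsetUl.
  move: A hA; apply: smallest_sub; first exact: smallest_sigma_algebra.
  move=> A [j _ [B mB <-]].
  pose T := g_sigma_algebraType (\bigcup_J pre (atom J)).
  have mf J : measurable_fun [set: T] (fun w : T => N w (atom J)).
    move=> _ Y mY; apply: sub_sigma_algebra; exists J => //; by exists Y.
  have : measurable_fun [set: T]
      (fun w : T => \sum_(J \in [set J : {set 'I_K} | j \in J]) N w (atom J))%E.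
    by apply: emeasurable_fsum => //; exact: finite_finset.
  have -> : (fun w : T => \sum_(J \in [set J : {set 'I_K} | j \in J]) N w (atom J))%E
      = (fun w => N w (U j)).
    apply/funext => w; rewrite U_atoms measure_fin_bigcup //; first exact: finite_finset.
    by move=> J J' _ _ [z [h1 h2]]; exact: atom_inj h1 h2.
  by move=> /(_ measurableT B mB).
apply: indep_join => //.
- by move=> J; exact: pre_measurable.
- move=> E hE.
  (* Comparing the product formula with D and with the sure event at index [None] isolates the
     factor P D. *)
  have h := atoms_indep (E := fun o => if o is Some J then E J else D).
  have h' := atoms_indep (E := fun o => if o is Some J then E J else setT).
  have cap X : \bigcap_o (if o is Some J then E J else X) = \bigcap_J E J `&` X.
    apply/seteqP; split=> [w hw|w [hw Xw] [J|] _] //; last exact: hw.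
    by split=> [J _|]; [exact: (hw (Some J))|exact: (hw None)].
  move: h h'; rewrite !cap setIT => -> //; last by case.
  move=> ->; last by case.
  rewrite (bigD1 None) //= [in RHS](bigD1 None) //= probability_setT mul1e muleC.
  by congr (_ * _)%E; apply: eq_bigr; case.
Qed.

End atoms.

(** Events that depend on finitely many regions before s form a pi-system: two finite families are
    concatenated. For each of them the atoms give independence. *)
Lemma poisson_indep_past s V D : 0 <= s -> measurable V ->
  V `<=` strip `]s, +oo[ -> preimage_set_system setT (fun w => N w V) measurable D ->
  forall A, <<s point_events N `[0, s] >> A -> P (A `&` D) = (P A * P D)%E.
Proof.
move=> s0 mV Vs hD.
pose S : set RR := strip `[0, s].
have mS : measurable S by apply: measurableX.
have S0 : S `<=` strip `[0, +oo[.
  move=> [x u] [_ /=]; rewrite in_itv /= => /andP[u0 _]; split=> //=.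
  by rewrite in_itv /= u0.
have V0 : V `<=` strip `[0, +oo[.
  move=> [x u] /Vs[_ /=]; rewrite !in_itv /= !andbT => su; split=> //=.
  by rewrite in_itv /= andbT (le_trans s0) // ltW.
have SV : S `&` V = set0.
  apply/seteqP; split=> // -[x u] [[_ /=]] + /Vs[_ /=].
  by rewrite !in_itv /= andbT => /andP[_ us]; rewrite ltNge us.
pose fam K (U : 'I_K -> set RR) := \bigcup_j pre (U j).
pose G := [set A | exists K (U : 'I_K -> set RR),
  [/\ forall j, measurable (U j), forall j, U j `<=` S & <<s fam K U >> A]].
have mD : measurable D by exact: pre_measurable hD.
have sub : point_events N `[0, s] `<=` G.
  move=> _ [U [B [mU US mB ->]]]; exists 1, (fun=> U); split=> //.
  by apply: sub_sigma_algebra; exists ord0 => //; exists B => //; rewrite setTI.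
move=> A /(sub_smallest2r (@smallest_sigma_algebra _ setT G) sub).
apply: indep_g_sigma => //.
- move=> B B' [K [U [mU US hB]]] [K' [U' [mU' US' hB']]].
  exists (K + K')%N, (fun i : 'I_(K + K') => match fintype.split i with inl j => U j | inr j => U' j end).
  split; try by move=> i; case: (fintype.split i).
  apply: g_sigma_setI.
    move: B hB; apply: sub_smallest2r; first exact: smallest_sigma_algebra.
    move=> B [j _ hB]; exists (lshift K' j) => //.
    by have := unsplitK (inl j : 'I_K + 'I_K') => /= ->.
  move: B' hB'; apply: sub_smallest2r; first exact: smallest_sigma_algebra.
  move=> B' [j _ hB']; exists (rshift K j) => //.
  by have := unsplitK (inr j : 'I_K + 'I_K') => /= ->.
- move=> B [K [U [mU US hB]]]; apply: (g_sigma_sub _ hB) => C [j _].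
  by apply: pre_measurable => //; apply: subset_trans S0.
- move=> B [K [U [mU US hB]]].
  exact: (poisson_atoms_indep mU US mS S0 mV V0 SV hD).
Qed.

End poisson_past.

(** * The future of one noise against the past of all noises *)

Section noise_past.
Context d (Omega : measurableType d) (R : realType) (P : probability Omega R).
Notation RR := (measurableTypeR R * measurableTypeR R)%type.
Variables (n p : nat) (W : 'I_n.+1 -> R -> Omega -> R).
Variable N : 'I_n.+1 -> Omega -> {measure set RR -> \bar R}.
Hypotheses (cP : measure_is_complete P) (hnoise : driving_noises P p W N).

Lemma noise_events_mono i S T : S `<=` T ->
  noise_events p W N i S `<=` noise_events p W N i T.
Proof.
move=> ST; rewrite /noise_events; case: ifP => _ A.
  by move=> [t [B [St mB ->]]]; exists t, B; split=> //; exact: ST.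
move=> [U [B [mU US mB ->]]]; exists U, B; split=> //.
by move=> z /US[h1 h2]; split=> //; exact: ST.
Qed.

Lemma noise_events_measurable i : noise_events p W N i `[0, +oo[ `<=` measurable.
Proof.
case: hnoise => hW hN _; rewrite /noise_events; case: leqP => ip A.
  move=> [t [B [/= t0 mB ->]]]; have [mW _ _ _ _] := hW i ip.
  rewrite -[X in measurable X]setTI; apply: mW => //.
  by move: t0; rewrite in_itv /= andbT.
move=> [U [B [mU US mB ->]]]; have [mN _ _ _] := hN i ip.
by rewrite -[X in measurable X]setTI; exact: mN.
Qed.

(** Between different noises independence is part of [driving_noises]; within the i-th noise it is
    the hypothesis on D. Both are needed because the filtration mixes all the noises. *)
Lemma indep_noise_past i s D : 0 <= s ->
  <<s noise_events p W N i `[0, +oo[ >> D ->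
  (forall A, <<s noise_events p W N i `[0, s] >> A -> P (A `&` D) = (P A * P D)%E) ->
  forall A, natural_filtration P p W N s A -> P (A `&` D) = (P A * P D)%E.
Proof.
move=> s0 hD iD A; rewrite /natural_filtration => hA.
pose G i := <<s noise_events p W N i `[0, s] >>.
have Gsub j : G j `<=` <<s noise_events p W N j `[0, +oo[ >>.
  apply: sub_smallest2r; first exact: smallest_sigma_algebra.
  by apply: noise_events_mono => u /=; rewrite !in_itv /= => /andP[->].
have Gm j : <<s noise_events p W N j `[0, +oo[ >> `<=` measurable.
  by apply: g_sigma_sub; exact: noise_events_measurable.
have mi := hnoise; case: mi => _ _.
move=> /(mutually_independent_full (G := fun i => <<s noise_events p W N i `[0, +oo[ >>)
  (@inv_bij _ id (fun=> erefl))) mi.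
have GT j : G j setT by exact: (@measurableT _ (g_sigma_algebraType _)).
have : <<s (\bigcup_i G i) `|` P.-negligible >> A.
  apply: sub_smallest2r hA; first exact: smallest_sigma_algebra.
  apply: setSU => B [j _ hB]; exists j => //; exact: sub_sigma_algebra.
apply: indep_join => //.
- by move=> j; exact: g_sigma_setI.
- by move=> j; apply: subset_trans (Gm j).
- exact: Gm hD.
move=> E hE.
(* D is absorbed into the i-th factor, which remains an event about the i-th noise alone; mutual
   independence then applies before and after absorption. *)
have -> : \bigcap_j E j `&` D = \bigcap_j (if j == i then E j `&` D else E j).
  apply/seteqP; split=> [w [h1 h2] j _|w h].
    by case: (eqVneq j i) => _; [split=> //|]; exact: h1.
  split; last by have := h i Logic.I; rewrite eqxx => -[].
  by move=> j _; have := h j Logic.I; case: (eqVneq j i) => // _ [].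
rewrite !mi; last first.
- by move=> j; exact: (Gsub _ _ (hE j)).
- move=> j; case: (eqVneq j i) => [->|_]; last exact: (Gsub _ _ (hE j)).
  exact: (g_sigma_setI (Gsub _ _ (hE i)) hD).
have -> : (\prod_j P (E j) = P (E i) * \prod_(j | j != i) P (E j))%E by rewrite (bigD1 i).
rewrite (bigD1 i) //= eqxx muleAC; congr (_ * _)%E; first exact: (iD _ (hE i)).
by apply: eq_bigr => j /negPf ->.
Qed.

Lemma wiener_indep_past (i : 'I_n.+1) s t B : (i <= p)%N -> 0 <= s < t -> measurable B ->
  forall A, natural_filtration P p W N s A ->
  P (A `&` [set w | B (W i t w - W i s w)]) =
  (P A * P [set w | B (W i t w - W i s w)%R])%E.
Proof.
move=> ip st mB; have /andP[s0 lst] := st.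
case: hnoise => hW _ _; have [_ _ _ _ hi] := hW i ip.
apply: (indep_noise_past (i := i)) => //.
  rewrite /noise_events ip.
  pose T := g_sigma_algebraType (process_events (W i) `[0, +oo[).
  have mW u : 0 <= u -> measurable_fun [set: T] (W i u : T -> R).
    move=> u0 _ Y mY; rewrite setTI; apply: sub_sigma_algebra.
    by exists u, Y; split=> //=; rewrite in_itv /= andbT.
  have : measurable_fun [set: T] ((W i t : T -> R) \- (W i s : T -> R)).
    by apply: measurable_funB; apply: mW => //; rewrite (le_trans s0) // ltW.
  by move=> /(_ measurableT B mB); rewrite setTI.
by rewrite /noise_events ip => A hA; exact: hi.
Qed.

Lemma poisson_indep_past_all (i : 'I_n.+1) s V D : (p < i)%N -> 0 <= s -> measurable V ->
  V `<=` strip `]s, +oo[ -> preimage_set_system setT (fun w => N i w V) measurable D ->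
  forall A, natural_filtration P p W N s A -> P (A `&` D) = (P A * P D)%E.
Proof.
move=> pi s0 mV Vs hD; case: hnoise => _ hN _.
apply: (indep_noise_past (i := i)) => //; rewrite /noise_events leqNgt pi /=.
  case: hD => B mB <-; apply: sub_sigma_algebra.
  exists V, B; rewrite setTI; split=> //.
  move=> [x u] /Vs[_ /=]; rewrite !in_itv /= !andbT => su; split=> //=.
  by rewrite in_itv /= andbT (le_trans s0) // ltW.
exact: (poisson_indep_past cP (hN i pi) s0 mV Vs hD).
Qed.

End noise_past.

(** * Integration *)

Section ge0_measurable_ind.
Context d (T : measurableType d) (R : realType).
Import HBNNSimple.

(** The standard machine: a nonnegative measurable function is an increasing limit of finite sums of
    scaled indicators of level sets. *)
Lemma ge0_measurable_ind (Q : (T -> \bar R) -> Prop) :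
  (forall A, measurable A -> Q (EFin \o \1_A)) ->
  (forall (r : R) f, 0 <= r -> (forall x, 0 <= f x)%E -> measurable_fun setT f ->
     Q f -> Q (fun x => r%:E * f x)%E) ->
  (forall f g, (forall x, 0 <= f x)%E -> measurable_fun setT f ->
     (forall x, 0 <= g x)%E -> measurable_fun setT g ->
     Q f -> Q g -> Q (fun x => f x + g x)%E) ->
  (forall (f_ : nat -> T -> \bar R) f, (forall n x, 0 <= f_ n x)%E ->
     (forall n, measurable_fun setT (f_ n)) ->
     (forall x, nondecreasing_seq (f_ ^~ x)) ->
     (forall x, f_ n x @[n --> \oo] --> f x) ->
     (forall n, Q (f_ n)) -> Q f) ->
  forall f, (forall x, 0 <= f x)%E -> measurable_fun setT f -> Q f.
Proof.
move=> Qi QZ QD Ql f f0 mf.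
pose f_ := nnsfun_approx measurableT mf.
apply: (Ql (fun n => EFin \o f_ n)).
- by move=> n x; rewrite lee_fin.
- by move=> n; exact/measurable_EFinP.
- by move=> x a b ab; rewrite lee_fin; exact/lefP/nd_nnsfun_approx.
- by move=> x; apply: cvg_nnsfun_approx.
move=> n; have [s [nn e]] : exists s : seq R, (forall r, r \in s -> 0 <= r) /\
    forall x, f_ n x = \sum_(r <- s) r * \1_(f_ n @^-1` [set r]) x.
  exists (finmap.enum_fset (fset_set (range (f_ n)))); split.
    by move=> r; rewrite in_fset_set // inE => -[x _ <-].
  by move=> x; rewrite {1}fimfunE fsbig_finite.
have mS (r : R) : measurable (f_ n @^-1` [set r]) by exact: measurable_sfunP.
have -> : EFin \o f_ n = (fun x => \sum_(r <- s) (r%:E * (\1_(f_ n @^-1` [set r]) x)%:E)%E).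
  by apply/funext => x /=; rewrite e sumEFin.
(* Nonnegativity and measurability of the partial sums are carried through the induction because
   [QD] asks for them. *)
suff gen (S : R -> set T) : (forall r, measurable (S r)) ->
   [/\ Q (fun x => \sum_(r <- s) (r%:E * (\1_(S r) x)%:E))%E,
   forall x, (0 <= \sum_(r <- s) (r%:E * (\1_(S r) x)%:E))%E &
   measurable_fun setT (fun x => \sum_(r <- s) (r%:E * (\1_(S r) x)%:E))%E].
  by have [] := gen (fun r => f_ n @^-1` [set r]) mS.
move=> {e}{}mS.
have mi (r : R) : measurable_fun setT (EFin \o (\1_(S r) : T -> R)).
  exact/measurable_EFinP.
elim: s nn => [|r s ih] nn.
  have -> : (fun x : T => \sum_(r <- [::]) (r%:E * (\1_(S r) x)%:E)%E) = EFin \o \1_set0.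
    by apply/funext => x; rewrite big_nil /= indic0.
  split; [exact: Qi|by move=> x; rewrite big_nil|exact/measurable_EFinP].
have [|Qs s0 ms] := ih; first by move=> q qs; apply: nn; rewrite inE qs orbT.
have r0 : 0 <= r by apply: nn; rewrite inE eqxx.
have m1 : measurable_fun setT (fun x => r%:E * (\1_(S r) x)%:E)%E.
  by apply: measurable_funeM; exact: mi.
have p1 x : (0 <= r%:E * (\1_(S r) x)%:E)%E by rewrite mule_ge0 // lee_fin.
have -> : (fun x => \sum_(q <- r :: s) (q%:E * (\1_(S q) x)%:E))%E =
    (fun x => r%:E * (\1_(S r) x)%:E + \sum_(q <- s) (q%:E * (\1_(S q) x)%:E))%E.
  by apply/funext => x; rewrite big_cons.
split.
- apply: QD => //; apply: (QZ r (EFin \o \1_(S r))) => //.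
  + by move=> x; rewrite lee_fin.
  + exact: Qi.
- by move=> x; rewrite big_cons adde_ge0.
- exact: emeasurable_funD.
Qed.

End ge0_measurable_ind.

Section density.
Context d (T : measurableType d) (R : realType) (mu nu : {measure set T -> \bar R}).
Variable g : T -> R.
Hypotheses (g0 : forall x, 0 <= g x) (mg : measurable_fun setT g).
Hypothesis nuE : forall A, measurable A -> nu A = (\int[mu]_(x in A) (g x)%:E)%E.

Lemma ge0_integral_density (f : T -> \bar R) : (forall x, 0 <= f x)%E ->
  measurable_fun setT f -> (\int[nu]_x f x = \int[mu]_x (f x * (g x)%:E))%E.
Proof.
have mgE : measurable_fun setT (EFin \o g) by exact/measurable_EFinP.
have gE0 x : (0 <= (g x)%:E)%E by rewrite lee_fin.
move: f; apply: ge0_measurable_ind.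
- move=> A mA; rewrite integral_indic // setIT nuE // integral_mkcond.
  by apply: eq_integral => x _ /=; rewrite patchE indicE; case: (x \in A); rewrite ?mul1e ?mul0e.
- move=> r f r0 f0 mf ih; rewrite ge0_integralZl_EFin // ih -ge0_integralZl_EFin //.
  + by apply: eq_integral => x _; rewrite muleA.
  + by move=> x _; rewrite mule_ge0.
  + exact: emeasurable_funM.
- move=> f h f0 mf h0 mh ihf ihh; rewrite ge0_integralD // ihf ihh -ge0_integralD //.
  + by apply: eq_integral => x _; rewrite ge0_muleDl.
  + by move=> x _; rewrite mule_ge0.
  + exact: emeasurable_funM.
  + by move=> x _; rewrite mule_ge0.
  + exact: emeasurable_funM.
- move=> f_ f f0 mf ndf fl ih.
  have c1 : (\int[nu]_x f_ n x)%E @[n --> \oo] --> (\int[nu]_x f x)%E.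
    have -> : (\int[nu]_x f x = \int[nu]_x limn (f_ ^~ x))%E.
      by apply: eq_integral => x _; apply/esym/cvg_lim.
    by apply: cvg_monotone_convergence => // x _; exact: ndf.
  have c2 : (\int[mu]_x (f_ n x * (g x)%:E))%E @[n --> \oo] --> (\int[mu]_x (f x * (g x)%:E))%E.
    have cl x : (f_ n x * (g x)%:E)%E @[n --> \oo] --> (f x * (g x)%:E)%E.
      by apply: cvgeZr.
    have -> : (\int[mu]_x (f x * (g x)%:E) = \int[mu]_x limn (fun n => f_ n x * (g x)%:E))%E.
      by apply: eq_integral => x _; apply/esym/cvg_lim => //; exact: cl.
    apply: cvg_monotone_convergence => //.
    + by move=> n; exact: emeasurable_funM.
    + by move=> n x _; rewrite mule_ge0.
    + by move=> x _ a b ab; apply: lee_wpmul2r => //; exact: ndf.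
  have e : (fun n => \int[nu]_x f_ n x)%E = (fun n => \int[mu]_x (f_ n x * (g x)%:E))%E.
    by apply/funext => n; exact: ih.
  by rewrite e in c1; exact: cvg_unique c1 c2.
Qed.

(** Used with a normal density for the law of a Wiener increment, and with an indicator for a
    measure restricted to a box. *)
Lemma integral_density (f : T -> R) : measurable_fun setT f ->
  (\int[nu]_x (f x)%:E = \int[mu]_x (f x * g x)%:E)%E.
Proof.
move=> mf; have mfE : measurable_fun setT (EFin \o f) by exact/measurable_EFinP.
rewrite integralE [RHS]integralE; congr (_ - _)%E.
- rewrite ge0_integral_density //; last exact: measurable_funepos.
  apply: eq_integral => x _; rewrite !funeposE /= -!EFin_max -EFinM; congr EFin.
  by rewrite maxr_pMl // mul0r.
- rewrite ge0_integral_density //; last exact: measurable_funeneg.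
  apply: eq_integral => x _; rewrite !funenegE /= -!EFin_max -EFinM; congr EFin.
  by rewrite maxr_pMl // mul0r mulNr.
Qed.

End density.

Section expectation_tools.
Context d (T : measurableType d) (R : realType).

Lemma integrable_dominated (mu : {measure set T -> \bar R}) (f g : T -> R) :
  measurable_fun setT f -> mu.-integrable setT (EFin \o g) ->
  (forall x, `|f x| <= g x) -> mu.-integrable setT (EFin \o f).
Proof.
move=> mf ig fg; apply: le_integrable ig => //; first exact/measurable_EFinP.
by move=> x _; rewrite /= lee_fin (le_trans (fg x)) // ler_norm.
Qed.

Lemma Rintegral_cvg (mu : {measure set T -> \bar R}) (f_ : nat -> T -> R) (f g : T -> R) :
  (forall n, measurable_fun setT (f_ n)) -> (forall x, f_ n x @[n --> \oo] --> f x) ->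
  mu.-integrable setT (EFin \o g) -> (forall n x, `|f_ n x| <= g x) ->
  mu.-integrable setT (EFin \o f) /\
  (\int[mu]_x f_ n x) @[n --> \oo] --> \int[mu]_x f x.
Proof.
move=> mf_ cf ig fg.
have mf : measurable_fun setT f.
  by apply: (measurable_fun_cvg mf_) => x _; exact: cf.
have h1 x : (EFin \o f_ n) x @[n --> \oo] --> (EFin \o f) x.
  by apply: cvg_EFin; [exact: nearW|exact: cf].
have [] := @dominated_convergence _ _ _ mu setT measurableT
    (fun n => EFin \o f_ n) (EFin \o f) (EFin \o g).
- by move=> n; exact/measurable_EFinP.
- exact/measurable_EFinP.
- by apply: aeW => x _; exact: h1.
- by [].
- by apply: aeW => x n _; rewrite /= lee_fin.
move=> fi _ h; split=> //; apply: fine_cvg.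
by rewrite fineK //; exact: integrable_fin_num.
Qed.

Variable mu : {finite_measure set T -> \bar R}.

Lemma integrable_bounded (f : T -> R) (M : R) :
  measurable_fun setT f -> (forall x, `|f x| <= M) -> mu.-integrable setT (EFin \o f).
Proof.
move=> mf fM; apply: integrable_dominated fM => //.
exact: finite_measure_integrable_cst.
Qed.

End expectation_tools.

Section independent_product.
Context d (T : measurableType d) (R : realType) (P : probability T R).
Variables X Y : T -> R.
Hypotheses (mX : measurable_fun setT X) (mY : measurable_fun setT Y).
Hypothesis indXY : forall A B : set R, measurable A -> measurable B ->
  P (X @^-1` A `&` Y @^-1` B) = (P (X @^-1` A) * P (Y @^-1` B))%E.
Hypotheses (iX : P.-integrable setT (EFin \o X)) (iY : P.-integrable setT (EFin \o Y)).

Let X' : {RV P >-> R} := HB.pack X (isMeasurableFun.Build _ _ _ _ _ mX).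
Let Y' : {RV P >-> R} := HB.pack Y (isMeasurableFun.Build _ _ _ _ _ mY).
Let mXY : measurable_fun setT (fun w => (X w, Y w)).
Proof. exact: measurable_fun_pair. Qed.
Let XY' : {mfun T >-> (R * R)%type} := HB.pack (fun w => (X w, Y w))
  (isMeasurableFun.Build _ _ _ _ _ mXY).

Let joint A : measurable A ->
  (distribution P X' \x distribution P Y')%E A = distribution P XY' A.
Proof.
apply: product_measure_unique => A' B mA mB.
by rewrite /distribution /= /pushforward /= -indXY.
Qed.

Let mp : measurable_fun setT (fun z : R * R => (z.1 * z.2)%:E).
Proof. by apply/measurable_EFinP; exact: measurable_funM. Qed.

Let lt_abs Z (Z' : {RV P >-> R}) : Z' = Z :> (T -> R) ->
  P.-integrable setT (EFin \o Z) -> (\int[distribution P Z']_x `|x%:E| < +oo)%E.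
Proof.
move=> e /integrableP[_]; rewrite ge0_integral_pushforward //=; last exact: measurableT_comp.
by rewrite e.
Qed.

Let prod_integrable :
  (distribution P X' \x distribution P Y')%E.-integrable setT (fun z : R * R => (z.1 * z.2)%:E).
Proof.
apply/integrable12ltyP => //.
under eq_integral => x _.
  under eq_integral => y _ do rewrite /= normrM EFinM.
  rewrite ge0_integralZl_EFin //; last by apply: measurableT_comp.
  over.
rewrite /= ge0_integralZr //; last 2 first.
- by apply: measurableT_comp.
- exact: integral_ge0.
apply: lte_mul_pinfty.
- exact: integral_ge0.
- rewrite ge0_fin_numE; last exact: integral_ge0.
  exact: lt_abs iX.
- exact: lt_abs iY.
Qed.

Lemma indep_integrableM : P.-integrable setT (EFin \o (fun w => X w * Y w)).
Proof.
apply/integrableP; split; first by apply/measurable_EFinP; exact: measurable_funM.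
have /integrableP[_] := prod_integrable.
rewrite (eq_measure_integral (distribution P XY')); last first.
  by move=> A mA _; exact: joint.
by rewrite ge0_integral_pushforward //; exact: measurableT_comp.
Qed.

(** By independence the law of the pair (X, Y) is the product of the two laws; Fubini's theorem then
    separates the factors. *)
Lemma indep_RintegralM :
  \int[P]_w (X w * Y w) = (\int[P]_w X w) * (\int[P]_w Y w).
Proof.
have id_int Z (Z' : {RV P >-> R}) : Z' = Z :> (T -> R) -> P.-integrable setT (EFin \o Z) ->
    (\int[distribution P Z']_x x%:E = (\int[P]_w Z w)%:E)%E.
  move=> e iZ; rewrite integral_pushforward //=; last by rewrite e.
  by rewrite e /Rintegral fineK //; exact: integrable_fin_num.
have iid Z (Z' : {RV P >-> R}) : Z' = Z :> (T -> R) -> P.-integrable setT (EFin \o Z) ->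
    (distribution P Z').-integrable setT EFin.
  by move=> e iZ; apply: integrable_pushforward => //; rewrite /= e.
apply/EFin_inj; rewrite EFinM {1}/Rintegral fineK; last first.
  by apply: integrable_fin_num => //; exact: indep_integrableM.
transitivity (\int[distribution P XY']_z (z.1 * z.2)%:E)%E.
  by rewrite integral_pushforward //; exact: indep_integrableM.
rewrite (eq_measure_integral (distribution P X' \x distribution P Y')%E); last first.
  by move=> A mA _; apply/esym; exact: joint.
rewrite -integral12_prod_meas1 // /fubini_F.
under eq_integral => x _.
  under eq_integral => y _ do rewrite /= EFinM.
  rewrite integralZl //; last exact: iid iY.
  rewrite (id_int Y) //.
  over.
by rewrite /= integralZr ?(id_int X) //; exact: iid iX.
Qed.

End independent_product.

(** * Moments of the Wiener increments *)

Section normal_moments.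
Variable R : realType.
Notation mu := (@lebesgue_measure R).

(** Over [- (n + 1), n + 1] the fundamental theorem leaves boundary terms of size at most 2 c / (n +
    1), and dominated convergence passes to the whole line. *)
Lemma integral_derive_vanishing (f F : R -> R) (c : R) :
  continuous f -> (forall x : R, is_derive x 1 F (f x)) ->
  mu.-integrable setT (EFin \o f) -> (forall x, 1 <= `|x| -> `|F x| <= c / `|x|) ->
  (\int[mu]_x (f x)%:E = 0)%E.
Proof.
move=> cf dF fi Fc.
have cF : continuous F.
  move=> x; apply: differentiable_continuous; apply/derivable1_diffP.
  by have := dF x; case.
pose D n : set R := `[(- n.+1%:R), n.+1%:R]%classic.
pose gap n : R := F n.+1%:R - F (- n.+1%:R).
have ftc n : (\int[mu]_(x in D n) (f x)%:E = (gap n)%:E)%E.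
  rewrite /gap EFinB; apply: continuous_FTC2.
  - by rewrite gtrN // ltr0n.
  - exact: continuous_subspaceT.
  - split; first by move=> x _; have := dF x; case.
    + by apply: cvg_at_right_filter; exact: cF.
    + by apply: cvg_at_left_filter; exact: cF.
  - by move=> x _; rewrite derive1E; have [_ ->] := dF x.
have F0 : gap n @[n --> \oo] --> (0 : R).
  apply/norm_cvg0P.
  apply: (@squeeze_cvgr _ _ _ _ (fun=> 0) (fun n => (2 * c) * harmonic n)).
  - apply: nearW => n; rewrite normr_ge0 /= (le_trans (ler_normB _ _)) //.
    have h1 : `|F n.+1%:R| <= c / n.+1%:R.
      have := Fc n.+1%:R; rewrite ger0_norm ?ler0n //; apply.
      by rewrite ler1n.
    have h2 : `|F (- n.+1%:R)| <= c / n.+1%:R.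
      have := Fc (- n.+1%:R); rewrite normrN ger0_norm ?ler0n //; apply.
      by rewrite ler1n.
    by apply: le_trans (lerD h1 h2) _; rewrite /harmonic /= -mulrA -[2]/(1 + 1) mulrDl !mul1r.
  - exact: cvg_cst.
  - rewrite -[X in _ --> X](mulr0 (2 * c)); apply: cvgMr; exact: cvg_harmonic.
have mD n : measurable (D n) by exact: measurable_itv.
have mf : measurable_fun setT f by apply/measurable_EFinP; exact: measurable_int fi.
have [_ h] : mu.-integrable setT (EFin \o f) /\
    (\int[mu]_x (f \_ (D n)) x) @[n --> \oo] --> \int[mu]_x f x.
  apply: (@Rintegral_cvg _ _ R mu (fun n => f \_ (D n)) f (fun x => `|f x|)).
  - by move=> n; apply/(measurable_restrict _ (mD n) measurableT); exact: measurable_funS mf.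
  - move=> x; apply: cvg_near_cst.
    near=> n; rewrite patchE; case: ifPn => //; rewrite notin_setE /D /= in_itv /= => /negP[].
    rewrite -ler_norml ltW //; near: n.
    exists (Num.truncn `|x|).+1 => // k /= hk.
    apply: lt_le_trans (truncnS_gt _) _; rewrite ler_nat.
    exact: leq_trans hk (leqnSn _).
  - exact: integrable_norm.
  - by move=> n x; rewrite patchE; case: ifP => //; rewrite normr0.
have e : (fun n => \int[mu]_x (f \_ (D n)) x) = gap.
  by apply/funext => n; rewrite -Rintegral_mkcond /Rintegral ftc.
rewrite e in h.
have : \int[mu]_x f x = 0 by exact: (cvg_unique (@norm_hausdorff _ R^o) h F0).
by move=> h0; rewrite -[LHS]fineK ?integrable_fin_num // -[fine _]/(\int[mu]_x f x) h0.
Unshelve. all: by end_near. Qed.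

Variable s : R.
Hypothesis s0 : 0 < s.
Let g : R -> R := normal_pdf 0 s.

Let gE x : g x = normal_peak s * expR (- (x ^+ 2 / (s ^+ 2 *+ 2))).
Proof.
rewrite /g normal_pdfE ?gt_eqF //= /normal_fun subr0; congr (_ * expR _).
by rewrite mulNr.
Qed.

Let g_ge0 x : 0 <= g x. Proof. exact: normal_pdf_ge0. Qed.

Let s2 : 0 < s ^+ 2 *+ 2. Proof. by rewrite pmulrn_lgt0 // exprn_gt0. Qed.

Let is_derive_g (x : R) : is_derive x 1 g (- (x / s ^+ 2) * g x).
Proof.
have -> : g = (fun x => normal_peak s * expR (- (x ^+ 2 / (s ^+ 2 *+ 2)))).
  by apply/funext => y; rewrite gE.
apply: is_derive_eq.
rewrite /GRing.scale /=; field.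
by rewrite gt_eqF.
Qed.

Let peak0 : 0 <= normal_peak s. Proof. exact: normal_peak_ge0. Qed.

(** From y <= 1 + y <= exp y at y = x^2 / (2 s^2). This decay leaves boundary terms of order 1 / |x|
    even after a multiplication by x. *)
Let g_le x : x != 0 -> g x <= normal_peak s * (s ^+ 2 *+ 2) / x ^+ 2.
Proof.
move=> x0; rewrite gE -[X in _ <= X]mulrA ler_wpM2l //.
have y0 : 0 < x ^+ 2 / (s ^+ 2 *+ 2) by rewrite divr_gt0 // exprn_even_gt0.
rewrite expRN -[X in _ <= X]invf_div lef_pV2 ?posrE ?expR_gt0 //.
by apply: le_trans (expR_ge1Dx _); rewrite lerDr.
Qed.

Let int_x2 : mu.-integrable setT (EFin \o (fun x => x ^+ 2 * g x)).
Proof.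
(* With y = x^2 / (4 s^2), the bound y exp(- 2 y) <= exp(- y) dominates x^2 g by a multiple of the
   normal density of deviation sqrt 2 * s. *)
pose s' := Num.sqrt 2 * s.
have s'0 : s' != 0 by rewrite mulf_neq0 ?gt_eqF // sqrtr_gt0.
pose K := (normal_peak s * (s ^+ 2 *+ 4)) / normal_peak s'.
have s'2 : s' ^+ 2 *+ 2 = s ^+ 2 *+ 4.
  by rewrite /s' exprMn sqr_sqrtr // -[2]/(2%:R) mulr_natl -mulrnA.
have pk : 0 < normal_peak s' by exact: normal_peak_gt0.
apply: (@integrable_dominated _ _ R mu (fun x => x ^+ 2 * g x) (fun x => K * normal_pdf 0 s' x)).
- by apply: measurable_funM => //; exact: measurable_normal_pdf.
- have -> : EFin \o (fun x => K * normal_pdf 0 s' x) =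
      (fun x => K%:E * (normal_pdf 0 s' x)%:E)%E by apply/funext.
  apply: integrableZl => //; exact: integrable_normal_pdf.
move=> x; rewrite ger0_norm; last by rewrite mulr_ge0 ?sqr_ge0 ?g_ge0.
rewrite gE normal_pdfE //= /normal_fun subr0 s'2.
pose y := x ^+ 2 / (s ^+ 2 *+ 4).
have s4 : 0 < s ^+ 2 *+ 4 by rewrite pmulrn_lgt0 // exprn_gt0.
have -> : x ^+ 2 / (s ^+ 2 *+ 2) = y + y.
  by rewrite /y; field; rewrite gt_eqF.
have -> : x ^+ 2 = (s ^+ 2 *+ 4) * y by rewrite /y mulrC divfK // gt_eqF.
have -> : - ((s ^+ 2 *+ 4) * y) / (s ^+ 2 *+ 4) = - y.
  by rewrite mulNr mulrAC divff ?gt_eqF // mul1r.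
have -> : K * (normal_peak s' * expR (- y)) = normal_peak s * (s ^+ 2 *+ 4) * expR (- y).
  by rewrite /K mulrA divfK // gt_eqF.
rewrite opprD expRD.
have y1 : y * expR (- y) <= 1.
  rewrite expRN ler_pdivrMr ?expR_gt0 // mul1r.
  by apply: le_trans (expR_ge1Dx _); rewrite lerDr.
have -> : s ^+ 2 *+ 4 * y * (normal_peak s * (expR (- y) * expR (- y))) =
    normal_peak s * (s ^+ 2 *+ 4) * expR (- y) * (y * expR (- y)) by ring.
by rewrite ler_piMr // !mulr_ge0 ?expR_ge0 // ltW.
Qed.

Let int_g : mu.-integrable setT (EFin \o g).
Proof. exact: integrable_normal_pdf. Qed.

Let int_x : mu.-integrable setT (EFin \o (fun x => x * g x)).
Proof.
apply: (@integrable_dominated _ _ R mu (fun x => x * g x) (fun x => g x + x ^+ 2 * g x)).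
- by apply: measurable_funM => //; exact: measurable_normal_pdf.
- have := @integrableD _ _ _ mu setT measurableT _ _ int_g int_x2; exact.
move=> x; rewrite normrM (ger0_norm (g_ge0 x)) -[X in _ <= X + _]mul1r -mulrDl.
apply: ler_wpM2r => //; have := sqr_ge0 (`|x| - 1); rewrite -[x ^+ 2]real_normK ?num_real //.
have := normr_ge0 x; nra.
Qed.

Lemma integral_x_normal_pdf : (\int[mu]_x (x * normal_pdf 0 s x)%:E = 0)%E.
Proof.
apply: (@integral_derive_vanishing _ (fun x => - s ^+ 2 * g x) (s ^+ 2 * (normal_peak s * (s ^+ 2 *+ 2)))) => //.
- by move=> x; apply: cvgM; [exact: cvg_id|apply: continuous_normal_pdf; rewrite gt_eqF].
- move=> x; have := is_derive_g x => dg; apply: is_derive_eq.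
  by rewrite -?/(g x) /GRing.scale /=; field; rewrite gt_eqF.
- move=> x x1; have x0 : x != 0 by rewrite -normr_gt0; apply: lt_le_trans x1.
  rewrite normrM normrN (ger0_norm (g_ge0 x)) ger0_norm ?sqr_ge0 // -mulrA ler_wpM2l ?sqr_ge0 //.
  apply: le_trans (g_le x0) _; apply: ler_wpM2l; first by rewrite mulr_ge0 // ltW.
  rewrite -[x ^+ 2]real_normK ?num_real // lef_pV2 ?posrE ?exprn_gt0 ?normr_gt0 //.
  by rewrite expr2 ler_peMr.
Qed.

(** Integration by parts: x^2 g - s^2 g is the derivative of - s^2 x g, which vanishes at
    infinity. *)
Lemma integral_x2_normal_pdf : (\int[mu]_x (x ^+ 2 * normal_pdf 0 s x)%:E = (s ^+ 2)%:E)%E.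
Proof.
have h : (\int[mu]_x (x ^+ 2 * g x - s ^+ 2 * g x)%:E = 0)%E.
  apply: (@integral_derive_vanishing _ (fun x => x * (- s ^+ 2 * g x)) (s ^+ 2 * (normal_peak s * (s ^+ 2 *+ 2)))).
  - have cg : continuous g by apply: continuous_normal_pdf; rewrite gt_eqF.
    move=> x; apply: cvgB; apply: cvgM; try exact: cg; last exact: cvg_cst.
    exact: sqr_continuous.
  - move=> x; have := is_derive_g x => dg; apply: is_derive_eq.
    by rewrite -?/(g x) /GRing.scale /=; field; rewrite gt_eqF.
  - have := @integrableB _ _ _ mu setT measurableT _ _ int_x2
      (integrableZl measurableT (s ^+ 2) int_g); exact.
  - move=> x x1; have x0 : x != 0 by rewrite -normr_gt0; apply: lt_le_trans x1.
    have nx : 0 < `|x| by rewrite normr_gt0.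
    rewrite !normrM normrN (ger0_norm (g_ge0 x)) (ger0_norm (sqr_ge0 s)) mulrCA -mulrA ler_wpM2l ?sqr_ge0 //.
    rewrite ler_pdivlMr // mulrAC -expr2 mulrC -ler_pdivlMr ?exprn_gt0 //.
    by rewrite real_normK ?num_real //; exact: g_le.
have e1 := integralB measurableT int_x2 (integrableZl measurableT (s ^+ 2) int_g).
have e2 := integralZl measurableT int_g (s ^+ 2).
have h' : (0 = \int[mu]_x (x ^+ 2 * g x)%:E - (s ^+ 2)%:E)%E.
  rewrite -h; apply: etrans e1 _; congr (_ - _)%E; apply: etrans e2 _.
  by rewrite integral_normal_pdf mule1.
have fin := integrable_fin_num measurableT int_x2.
move: h' fin; rewrite -/g /=; case: (\int[mu]_x _)%E => // r /=.
by rewrite -EFinB => -[/esym/eqP]; rewrite subr_eq0 => /eqP ->.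
Qed.

Lemma integrable_x2_normal_pdf : mu.-integrable setT (EFin \o (fun x => x ^+ 2 * normal_pdf 0 s x)).
Proof. exact: int_x2. Qed.

Lemma integrable_x_normal_pdf : mu.-integrable setT (EFin \o (fun x => x * normal_pdf 0 s x)).
Proof. exact: int_x. Qed.

End normal_moments.

Section measurable_wrt_closure.
Context d (Omega : measurableType d) (R : realType).
Variable G : set_system Omega.
Hypotheses (sG : sigma_algebra setT G).
Implicit Types X Y : Omega -> R.

Lemma measurable_wrtP X :
  measurable_wrt G X <-> measurable_fun setT (X : g_sigma_algebraType G -> R).
Proof.
split=> [h _ B mB|h B mB].
  by rewrite setTI; apply: sub_sigma_algebra; exact: h.
by have := h measurableT B mB; rewrite setTI; apply: smallest_sub.
Qed.

Lemma measurable_wrt_cst (c : R) : measurable_wrt G (fun=> c).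
Proof. by apply/measurable_wrtP. Qed.

Lemma measurable_wrtM X Y : measurable_wrt G X -> measurable_wrt G Y ->
  measurable_wrt G (fun w => X w * Y w).
Proof.
by move=> /measurable_wrtP mX /measurable_wrtP mY; apply/measurable_wrtP; exact: measurable_funM.
Qed.

Lemma measurable_wrtB X Y : measurable_wrt G X -> measurable_wrt G Y ->
  measurable_wrt G (fun w => X w - Y w).
Proof.
by move=> /measurable_wrtP mX /measurable_wrtP mY; apply/measurable_wrtP; exact: measurable_funB.
Qed.

Lemma measurable_wrt_indic A : G A -> measurable_wrt G (\1_A : Omega -> R).
Proof.
move=> GA; apply/measurable_wrtP; apply: measurable_indic.
exact: sub_sigma_algebra.
Qed.

Lemma measurable_wrt_fun X : G `<=` measurable -> measurable_wrt G X ->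
  measurable_fun setT X.
Proof. by move=> Gm h _ B mB; rewrite setTI; exact/Gm/h. Qed.

End measurable_wrt_closure.

Section wiener_increments.
Context d (Omega : measurableType d) (R : realType) (P : probability Omega R).
Variables (F : R -> set_system Omega) (W : R -> Omega -> R).

(** The increments are independent of the whole of [F s], which also contains the other noises,
    whereas [wiener_process] speaks only of the past of W. *)
Definition wiener_wrt :=
  [/\ forall t, 0 <= t -> sigma_algebra setT (F t) /\ F t `<=` measurable,
      forall s t, 0 <= s <= t -> F s `<=` F t,
      forall t, 0 <= t -> measurable_wrt (F t) (W t),
      forall (s t : R) B, 0 <= s < t -> measurable B ->
        P [set w | B (W t w - W s w)] = normal_prob 0 (Num.sqrt (t - s)) B
    & forall (s t : R) A B, 0 <= s < t -> F s A -> measurable B ->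
        P (A `&` [set w | B (W t w - W s w)]) =
        (P A * P [set w | B (W t w - W s w)%R])%E].

Hypothesis hW : wiener_wrt.

Let incr s t w := W t w - W s w.

Lemma wiener_wrt_sigma t : 0 <= t -> sigma_algebra setT (F t).
Proof. by case: hW => h _ _ _ _ /h[]. Qed.

Lemma wiener_wrt_measurable t : 0 <= t -> F t `<=` measurable.
Proof. by case: hW => h _ _ _ _ /h[]. Qed.

Lemma wiener_wrt_mono s t (X : Omega -> R) : 0 <= s <= t ->
  measurable_wrt (F s) X -> measurable_wrt (F t) X.
Proof. by case: hW => _ h _ _ _ st mX B mB; apply: (h _ _ st); exact: mX. Qed.

Lemma incr_measurable_wrt s t : 0 <= s <= t -> measurable_wrt (F t) (incr s t).
Proof.
move=> st; have /andP[s0 lst] := st; have t0 := le_trans s0 lst.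
case: hW => _ _ mW _ _; apply: measurable_wrtB; first exact: wiener_wrt_sigma.
- exact: mW.
- by apply: (wiener_wrt_mono st); exact: mW.
Qed.

Lemma incr_measurable s t : 0 <= s <= t -> measurable_fun setT (incr s t).
Proof.
move=> st; have /andP[s0 lst] := st; have t0 := le_trans s0 lst.
apply: measurable_wrt_fun (incr_measurable_wrt st).
exact: wiener_wrt_measurable.
Qed.

Section positive_length.
Variables s t : R.
Hypothesis st : 0 <= s < t.

Let st' : 0 <= s <= t.
Proof. by have /andP[-> /ltW ->] := st. Qed.

Let sd : 0 < Num.sqrt (t - s).
Proof. by rewrite sqrtr_gt0 subr_gt0; case/andP: st. Qed.

Let D : {RV P >-> measurableTypeR R} :=
  HB.pack (incr s t : Omega -> measurableTypeR R)
    (isMeasurableFun.Build _ _ _ (measurableTypeR R) _ (incr_measurable st')).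

Let density (f : R -> R) : measurable_fun setT f ->
  (\int[distribution P D]_x (f x)%:E =
   \int[lebesgue_measure]_x (f x * normal_pdf 0 (Num.sqrt (t - s)) x)%:E)%E.
Proof.
apply: (@integral_density _ _ R lebesgue_measure (distribution P D)
  (normal_pdf 0 (Num.sqrt (t - s)))).
- by move=> x; exact: normal_pdf_ge0.
- exact: measurable_normal_pdf.
- by move=> A mA; case: hW => _ _ _ h _; have := h s t A st mA.
Qed.

Lemma integral_incr (f : R -> R) : measurable_fun setT f ->
  (\int[P]_w (`|f (incr s t w)|)%:E =
   \int[lebesgue_measure]_x (`|f x| * normal_pdf 0 (Num.sqrt (t - s)) x)%:E)%E.
Proof.
move=> mf.
have mnf : measurable_fun setT (fun x => `|f x|) by exact: measurableT_comp.
transitivity (\int[distribution P D]_x (`|f x|)%:E)%E.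
  by rewrite ge0_integral_pushforward //; exact/measurable_EFinP.
exact: density.
Qed.

Lemma integrable_incr (f : R -> R) : measurable_fun setT f ->
  lebesgue_measure.-integrable setT (EFin \o (fun x => f x * normal_pdf 0 (Num.sqrt (t - s)) x)) ->
  P.-integrable setT (EFin \o (fun w => f (incr s t w))) /\
  \int[P]_w f (incr s t w) =
    fine (\int[lebesgue_measure]_x (f x * normal_pdf 0 (Num.sqrt (t - s)) x)%:E)%E.
Proof.
move=> mf fi.
have iD : P.-integrable setT (EFin \o (fun w => f (incr s t w))).
  apply/integrableP; split.
    by apply/measurable_EFinP; apply: measurableT_comp => //; exact: incr_measurable.
  have /integrableP[_] := fi; congr (_ < +oo)%E.
  rewrite /= integral_incr //; apply: eq_integral => x _ /=.
  by rewrite normrM (ger0_norm (normal_pdf_ge0 _ _ _)).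
split=> //; rewrite /Rintegral; congr fine.
transitivity (\int[distribution P D]_x (f x)%:E)%E.
  by rewrite integral_pushforward //; exact/measurable_EFinP.
exact: density.
Qed.

Lemma incr_indep (X f : _) : measurable_wrt (F s) X -> measurable_fun setT f ->
  forall A B : set R, measurable A -> measurable B ->
  P (X @^-1` A `&` (fun w => f (incr s t w)) @^-1` B) =
  (P (X @^-1` A) * P ((fun w => f (incr s t w)) @^-1` B))%E.
Proof.
move=> mX mf A B mA mB; case: hW => _ _ _ _ h.
apply: (h s t (X @^-1` A) (f @^-1` B) st); first exact: mX.
by rewrite -[X in measurable X]setTI; exact: mf.
Qed.

End positive_length.

(** The mean of the product factors by independence and the normal law is centred. The case s = t is
    separate: the law of the increment is given for s < t only. *)
Lemma wiener_incr_mean s t (X : Omega -> R) : 0 <= s <= t ->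
  measurable_wrt (F s) X -> P.-integrable setT (EFin \o X) ->
  P.-integrable setT (EFin \o (fun w => X w * incr s t w)) /\
  \int[P]_w (X w * incr s t w) = 0.
Proof.
move=> st mX iX; have /andP[s0] := st; rewrite le_eqVlt => /predU1P[e|lst].
  have z w : X w * incr s t w = 0 by rewrite /incr e subrr mulr0.
  split; first by rewrite (_ : EFin \o _ = cst 0%E); [exact: integrable0|apply/funext => w /=; rewrite z].
  by rewrite -[RHS](@mul0r _ (fine (P setT))) -Rintegral_cst //; apply: eq_Rintegral => w _.
have st1 : 0 <= s < t by rewrite s0.
have sd : 0 < Num.sqrt (t - s) by rewrite sqrtr_gt0 subr_gt0.
have [iD eD] := integrable_incr st1 (@measurable_id _ _ setT) (integrable_x_normal_pdf sd).
have ind := incr_indep st1 mX (@measurable_id _ _ setT).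
have mX' := measurable_wrt_fun (wiener_wrt_measurable s0) mX.
have mD := incr_measurable st.
split; first exact: indep_integrableM mX' mD ind iX iD.
rewrite (indep_RintegralM mX' mD ind iX iD) [X in _ * X]eD.
by rewrite integral_x_normal_pdf // mulr0.
Qed.

Lemma wiener_incr_square s t (X : Omega -> R) : 0 <= s <= t ->
  measurable_wrt (F s) X -> P.-integrable setT (EFin \o X) ->
  P.-integrable setT (EFin \o (fun w => X w * incr s t w ^+ 2)) /\
  \int[P]_w (X w * incr s t w ^+ 2) = (\int[P]_w X w) * (t - s).
Proof.
move=> st mX iX; have /andP[s0] := st; rewrite le_eqVlt => /predU1P[e|lst].
  have z w : X w * incr s t w ^+ 2 = 0 by rewrite /incr e subrr expr0n mulr0.
  split; first by rewrite (_ : EFin \o _ = cst 0%E); [exact: integrable0|apply/funext => w /=; rewrite z].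
  transitivity (\int[P]_w (0 : R)); first by apply: eq_Rintegral => w _; exact: z.
  by rewrite Rintegral_cst // mul0r e subrr mulr0.
have st1 : 0 <= s < t by rewrite s0.
have sd : 0 < Num.sqrt (t - s) by rewrite sqrtr_gt0 subr_gt0.
have msq : measurable_fun setT (fun x : R => x ^+ 2) by exact: exprn_measurable.
have [iD eD] := integrable_incr st1 msq (integrable_x2_normal_pdf sd).
have ind := incr_indep st1 mX msq.
have mX' := measurable_wrt_fun (wiener_wrt_measurable s0) mX.
have mD : measurable_fun setT (fun w => incr s t w ^+ 2).
  by apply: measurable_funX; exact: incr_measurable.
split; first exact: indep_integrableM mX' mD ind iX iD.
rewrite (indep_RintegralM mX' mD ind iX iD) [X in _ * X]eD.
by rewrite integral_x2_normal_pdf // sqr_sqrtr //= subr_ge0 ltW.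
Qed.

End wiener_increments.

(** * Ito integrals are martingales *)

Section Rintegral_tools.
Context d (T : measurableType d) (R : realType) (mu : {measure set T -> \bar R}).

Lemma Rintegral_sum (D : set T) (I : Type) (r : seq I) (f : I -> T -> R) : measurable D ->
  (forall i, mu.-integrable D (EFin \o f i)) ->
  mu.-integrable D (EFin \o (fun x => \sum_(i <- r) f i x)) /\
  \int[mu]_(x in D) (\sum_(i <- r) f i x) = \sum_(i <- r) \int[mu]_(x in D) f i x.
Proof.
move=> mD fi; elim: r => [|i r [ih1 ih2]].
  have z : (fun x => \sum_(i <- [::]) f i x) = cst 0 by apply/funext => x; rewrite big_nil.
  rewrite z big_nil; split; first exact: integrable0.
  by rewrite /Rintegral integral0.
have e : (fun x => \sum_(j <- i :: r) f j x) = (fun x => f i x + \sum_(j <- r) f j x).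
  by apply/funext => x; rewrite big_cons.
rewrite e big_cons; split; last by rewrite RintegralD // ih2.
exact: (integrableD mD (fi i) ih1).
Qed.

Lemma integrable_bounded_mul (X Y : T -> R) : measurable_fun setT X ->
  (exists c, forall w, `|X w| <= c) -> mu.-integrable setT (EFin \o Y) ->
  mu.-integrable setT (EFin \o (fun w => X w * Y w)).
Proof.
move=> mX [c Xc] iY.
have mY : measurable_fun setT Y by apply/measurable_EFinP; exact: measurable_int iY.
apply: (@integrable_dominated _ _ _ _ _ (fun w => c * `|Y w|)).
- exact: measurable_funM.
- exact: (integrableZl measurableT c (integrable_norm iY)).
- by move=> w; rewrite normrM ler_wpM2r.
Qed.

(** Smallness in L2 becomes integrability and smallness in L1 through |x| <= eps / 2 + x^2 / (2
    eps), the total mass being finite. *)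
Lemma l2_small (X : nat -> T -> R) : (mu setT < +oo)%E -> (forall l, measurable_fun setT (X l)) ->
  (\int[mu]_w ((X l w) ^+ 2)%:E)%E @[l --> \oo] --> 0%E ->
  forall eps, 0 < eps -> \forall l \near \oo,
    mu.-integrable setT (EFin \o X l) /\
    \int[mu]_w `|X l w| <= eps * (1 + fine (mu setT)).
Proof.
move=> fT mX cX eps eps0.
have muT : mu setT \is a fin_num by rewrite ge0_fin_numE.
have ic c : mu.-integrable setT (EFin \o (fun=> c)).
  apply/integrableP; split; first exact/measurable_EFinP.
  by rewrite integral_cst //= -[mu setT]fineK // -EFinM ltry.
have : \forall l \near \oo, (\int[mu]_w ((X l w) ^+ 2)%:E < (eps ^+ 2)%:E)%E.
  have e0 : (0 < (eps ^+ 2)%:E :> \bar R)%E by rewrite lte_fin exprn_gt0.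
  exact: (cX _ (open_ereal_lt' e0)).
apply: filterS => l hl.
have i2 : mu.-integrable setT (EFin \o (fun w => X l w ^+ 2)).
  apply/integrableP; split; first by apply/measurable_EFinP; exact: measurable_funX.
  under eq_integral do rewrite /= ger0_norm ?sqr_ge0 //.
  by apply: lt_trans hl _; rewrite ltry.
have ig := integrableD measurableT (ic (eps / 2)) (integrableZl measurableT ((eps *+ 2)^-1) i2).
have bd w : `|X l w| <= eps / 2 + (eps *+ 2)^-1 * X l w ^+ 2.
  have e2 : 0 < eps *+ 2 by rewrite pmulrn_lgt0.
  rewrite -(ler_pM2l e2).
  have -> : eps *+ 2 * (eps / 2 + (eps *+ 2)^-1 * X l w ^+ 2) = eps ^+ 2 + X l w ^+ 2.
    by field; rewrite gt_eqF.
  have := sqr_ge0 (eps - `|X l w|); rewrite sqrrB real_normK ?num_real //.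
  rewrite mulrnAl; lra.
have iX : mu.-integrable setT (EFin \o X l) by exact: (integrable_dominated (mX l) ig bd).
split=> //.
apply: (@le_trans _ _ (\int[mu]_w (eps / 2 + (eps *+ 2)^-1 * X l w ^+ 2))).
  apply: le_Rintegral => //; exact: integrable_norm.
rewrite RintegralD //; last exact: (integrableZl measurableT ((eps *+ 2)^-1) i2).
rewrite Rintegral_cst // RintegralZl //.
have h2 : \int[mu]_w (X l w ^+ 2) <= eps ^+ 2.
  rewrite -lee_fin /Rintegral fineK; last exact: integrable_fin_num.
  exact: ltW.
have h3 : (eps *+ 2)^-1 * \int[mu]_w (X l w ^+ 2) <= eps.
  rewrite mulrC ler_pdivrMr ?pmulrn_lgt0 //; apply: le_trans h2 _.
  by rewrite expr2 ler_pM2l // mulr2n lerDl ltW.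
have m0 : 0 <= fine (mu setT) by rewrite fine_ge0.
rewrite mulrDr mulr1 addrC; apply: lerD => //; apply: ler_wpM2r => //.
by rewrite ler_pdivrMr // ler_pMr // ler1n.
Qed.

End Rintegral_tools.

(** * Simple processes: isometry and martingale property *)

Section ito_martingale.
Context d (Omega : measurableType d) (R : realType) (P : probability Omega R).
Variables (F : R -> set_system Omega) (W : R -> Omega -> R).
Hypothesis hW : wiener_wrt P F W.

Let sF t (t0 : 0 <= t) := wiener_wrt_sigma hW t0.
Let Fm t (t0 : 0 <= t) := wiener_wrt_measurable hW t0.

Definition bounded_wrt (s : R) (X : Omega -> R) :=
  measurable_wrt (F s) X /\ exists c, forall w, `|X w| <= c.

Lemma bounded_wrt_mono s t X : 0 <= s <= t -> bounded_wrt s X -> bounded_wrt t X.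
Proof. by move=> st [mX bX]; split=> //; exact (wiener_wrt_mono hW st mX). Qed.

Lemma bounded_wrtM s X Y : 0 <= s -> bounded_wrt s X -> bounded_wrt s Y ->
  bounded_wrt s (fun w => X w * Y w).
Proof.
move=> s0 [mX [c hc]] [mY [c' hc']]; split.
  by apply: measurable_wrtM => //; exact: sF.
by exists (c * c') => w; rewrite normrM ler_pM.
Qed.

Lemma bounded_wrt_indic s A : 0 <= s -> F s A -> bounded_wrt s (\1_A).
Proof.
move=> s0 FA; split; first by apply: measurable_wrt_indic => //; exact: sF.
by exists 1 => w; rewrite indicE; case: (_ \in _); rewrite ?normr1 ?normr0.
Qed.

Lemma bounded_wrt_fun s X : 0 <= s -> bounded_wrt s X -> measurable_fun setT X.
Proof. by move=> s0 [mX _]; apply: measurable_wrt_fun mX; exact: Fm. Qed.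

Lemma bounded_wrt_integrable s X : 0 <= s -> bounded_wrt s X ->
  P.-integrable setT (EFin \o X).
Proof.
by move=> s0 bX; have [_ [c hc]] := bX; apply: integrable_bounded hc; exact: bounded_wrt_fun bX.
Qed.

Let incr s t w := W t w - W s w.

Let incr_int s t : 0 <= s <= t -> P.-integrable setT (EFin \o incr s t).
Proof.
move=> st; have s0 : 0 <= s by case/andP: st.
have [h _] := wiener_incr_mean hW st (measurable_wrt_cst (sF s0) 1)
  (finite_measure_integrable_cst P 1 measurableT).
by apply: eq_integrable h => // w _; rewrite /= mul1r.
Qed.

Let mean0 s t X : 0 <= s <= t -> measurable_wrt (F s) X -> P.-integrable setT (EFin \o X) ->
  P.-integrable setT (EFin \o (fun w => X w * incr s t w)) /\
  \int[P]_w (X w * incr s t w) = 0.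
Proof. exact (@wiener_incr_mean _ _ _ _ _ _ hW s t X). Qed.

(** For a <= b and c <= e, the length of the intersection of ]a, b] and ]c, e]. *)
Definition overlap (a b c e : R) : R := Num.max 0 (Num.min b e - Num.max a c).

Lemma overlapC a b c e : overlap a b c e = overlap c e a b.
Proof. by rewrite /overlap (minC b) (maxC a). Qed.

(** The square of the increment over the common part of the intervals gives its length; every other
    product contains an increment that is independent of the factors known when it starts, and has
    mean 0. *)
Lemma ito_pair_le a b c e (xi eta : Omega -> R) : 0 <= a <= b -> 0 <= c <= e -> a <= c ->
  bounded_wrt a xi -> bounded_wrt c eta ->
  P.-integrable setT (EFin \o (fun w => (xi w * incr a b w) * (eta w * incr c e w))) /\
  \int[P]_w ((xi w * incr a b w) * (eta w * incr c e w)) =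
    (\int[P]_w (xi w * eta w)) * overlap a b c e.
Proof.
move=> ab ce ac bxi beta.
have /andP[a0 lab] := ab; have /andP[c0 lce] := ce.
have ac' : 0 <= a <= c by rewrite a0.
have bxi' := bounded_wrt_mono ac' bxi.
have bxe := bounded_wrtM c0 bxi' beta.
(* the increment of W before time c is known at time c *)
have past u : a <= u <= c ->
   P.-integrable setT (EFin \o (fun w => (xi w * eta w * incr a u w) * incr c e w)) /\
   \int[P]_w ((xi w * eta w * incr a u w) * incr c e w) = 0.
  move=> /andP[au uc]; apply: mean0 => //.
    apply: measurable_wrtM; [exact: sF|by case: bxe|].
    have u0 : 0 <= u <= c by rewrite uc (le_trans a0).
    apply: (wiener_wrt_mono hW u0); apply: (incr_measurable_wrt hW).
    by rewrite a0.
  apply: integrable_bounded_mul; [exact: bounded_wrt_fun bxe|by case: bxe|].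
  by apply: incr_int; rewrite a0.
have [bc|cb] := leP b c.
  have /past[h1 h2] : a <= b <= c by rewrite lab bc.
  have eqf w : xi w * eta w * incr a b w * incr c e w = (xi w * incr a b w) * (eta w * incr c e w).
    by ring.
  split; first by apply: eq_integrable h1 => // w _; rewrite /= eqf.
  transitivity (\int[P]_w (xi w * eta w * incr a b w * incr c e w)).
    by apply: eq_Rintegral => w _; rewrite eqf.
  rewrite h2 /overlap (max_idPr ac) max_l ?mulr0 // subr_le0.
  by rewrite ge_min bc.
(* Now the intervals overlap: ]c, m] is their common part and ]m, M] is what remains of the one that
   ends later. *)
pose m := Num.min b e; pose M := Num.max b e.
have cm : 0 <= c <= m by rewrite c0 /m le_min lce ltW.
have m0 : 0 <= m by case/andP: cm => ? ?; exact: le_trans c0 _.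
have mM : 0 <= m <= M by rewrite m0 /m /M ge_min !le_max lexx.
have /past[i1 e1] : a <= c <= c by rewrite ac lexx.
have [i2 e2] := wiener_incr_square hW cm bxe.1 (bounded_wrt_integrable c0 bxe).
have [i3 e3] : P.-integrable setT (EFin \o (fun w => (xi w * eta w * incr c m w) * incr m M w)) /\
   \int[P]_w ((xi w * eta w * incr c m w) * incr m M w) = 0.
  apply: mean0 => //.
    apply: measurable_wrtM; [exact: sF|by have [] := bounded_wrt_mono cm bxe|].
    exact: (incr_measurable_wrt hW).
  apply: integrable_bounded_mul; [exact: bounded_wrt_fun bxe|by case: bxe|].
  exact: incr_int.
have eqf w : (xi w * incr a b w) * (eta w * incr c e w) =
    (xi w * eta w * incr a c w) * incr c e w +
    ((xi w * eta w) * incr c m w ^+ 2 + (xi w * eta w * incr c m w) * incr m M w).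
  by rewrite /incr /m /M; case: (leP b e) => _; ring.
have i23 := integrableD measurableT i2 i3.
split; first by apply: eq_integrable (integrableD measurableT i1 i23) => // w _; rewrite /= eqf.
transitivity (\int[P]_w ((xi w * eta w * incr a c w) * incr c e w +
    ((xi w * eta w) * incr c m w ^+ 2 + (xi w * eta w * incr c m w) * incr m M w))).
  by apply: eq_Rintegral => w _; rewrite eqf.
rewrite RintegralD // RintegralD // e1 e2 e3 add0r addr0; congr (_ * _).
by rewrite /overlap (max_idPr ac) max_r // subr_ge0; case/andP: cm.
Qed.

Lemma ito_pair a b c e (xi eta : Omega -> R) : 0 <= a <= b -> 0 <= c <= e ->
  bounded_wrt a xi -> bounded_wrt c eta ->
  P.-integrable setT (EFin \o (fun w => (xi w * incr a b w) * (eta w * incr c e w))) /\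
  \int[P]_w ((xi w * incr a b w) * (eta w * incr c e w)) =
    (\int[P]_w (xi w * eta w)) * overlap a b c e.
Proof.
move=> ab ce bxi beta; case: (leP a c) => ac; first exact: ito_pair_le.
have [h1 h2] := ito_pair_le ce ab (ltW ac) beta bxi.
split; first by apply: eq_integrable h1 => // w _; rewrite /= mulrC.
transitivity (\int[P]_w (eta w * incr c e w * (xi w * incr a b w))).
  by apply: eq_Rintegral => w _; rewrite mulrC.
rewrite h2 overlapC; congr (_ * _).
by apply: eq_Rintegral => w _; rewrite mulrC.
Qed.

Section step_processes.
Variables (I : Type) (r : seq I) (xi : I -> Omega -> R) (a b : I -> R) (T : R).
Hypotheses (bxi : forall i, bounded_wrt (a i) (xi i)) (hab : forall i, 0 <= a i <= b i)
  (hT : forall i, b i <= T).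

(** The steps may overlap and their index type is arbitrary, so that the difference of two simple
    processes with unrelated subdivisions is of this form too. *)
Definition step_fun s w : R := \sum_(i <- r) xi i w * \1_`]a i, b i] s.
Definition step_integral w : R := \sum_(i <- r) xi i w * (W (b i) w - W (a i) w).

Let ov i j := overlap (a i) (b i) (a j) (b j).
Let D : set (measurableTypeR R) := `]0, T]%classic.
Notation lam := (@lebesgue_measure R).
Let step2 i j s : R := \1_`]a i, b i] s * \1_`]a j, b j] s.

Let step2E i j s : step2 i j s = \1_`]Num.max (a i) (a j), Num.min (b i) (b j)] s.
Proof.
rewrite /step2 !indicE !mem_setE !in_itv /= gt_max le_min.
by do 2 case: (_ < s); do 2 case: (s <= _); rewrite /= ?mulr1 ?mulr0 ?mul0r.
Qed.

Let integral_step2 i j : (\int[lam]_(s in D) (step2 i j s)%:E = (ov i j)%:E)%E.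
Proof.
have /andP[a0 _] := hab i; have bT := hT i.
transitivity (\int[lam]_(s in D)
    (\1_(`]Num.max (a i) (a j), Num.min (b i) (b j)] : set R) s)%:E)%E.
  by apply: eq_integral => s _; rewrite step2E.
have mD : measurable D by exact: measurable_itv.
rewrite integral_indic //.
rewrite setIidl; last first.
  move=> s; rewrite /D /= !in_itv /= gt_max le_min.
  move=> /andP[/andP[h1 _] /andP[h2 _]]; rewrite (le_lt_trans a0 h1) /=.
  exact: le_trans h2 bT.
rewrite [LHS]lebesgue_measure_itv /= lte_fin /ov /overlap.
case: ifPn => h; last by rewrite (@max_l _ _ 0) // subr_le0 leNgt.
by rewrite (@max_r _ _ 0) -?EFinB // subr_ge0 ltW.
Qed.

Let integrable_step2 i j : lam.-integrable D (EFin \o step2 i j).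
Proof.
apply/integrableP; split.
  apply/measurable_EFinP; rewrite (_ : step2 i j = \1_`]Num.max (a i) (a j), Num.min (b i) (b j)]).
    by apply: measurable_funTS; apply: measurable_indic; exact: measurable_itv.
  by apply/funext => s; exact: step2E.
suff -> : (\int[lam]_(s in D) `|(EFin \o step2 i j) s| = \int[lam]_(s in D) (step2 i j s)%:E)%E.
  by rewrite integral_step2 ltry.
by apply: eq_integral => s _; rewrite /= ger0_norm // mulr_ge0.
Qed.

Lemma step_energy w : (\int[lam]_(s in D) (step_fun s w ^+ 2)%:E =
   (\sum_(i <- r) \sum_(j <- r) xi i w * xi j w * ov i j)%:E)%E.
Proof.
have mD : measurable D by exact: measurable_itv.
have i1 i j : lam.-integrable D (EFin \o (fun s => xi i w * xi j w * step2 i j s)).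
  have := integrableZl mD (xi i w * xi j w) (integrable_step2 i j); exact.
have i2 i := (Rintegral_sum r mD (i1 i)).1.
have [i3 e3] := Rintegral_sum r mD i2.
transitivity (\int[lam]_(s in D) (\sum_(i <- r) \sum_(j <- r) xi i w * xi j w * step2 i j s)%:E)%E.
  apply: eq_integral => s _; congr EFin; rewrite expr2 /step_fun big_distrlr /=.
  by apply: eq_bigr => i _; apply: eq_bigr => j _; rewrite /step2; ring.
rewrite -[LHS]fineK; last exact: integrable_fin_num i3.
congr EFin; rewrite -[LHS]/(Rintegral _ _ _) e3; apply: eq_bigr => i _.
rewrite (Rintegral_sum r mD (i1 i)).2; apply: eq_bigr => j _.
rewrite RintegralZl //; congr (_ * _).
by rewrite /Rintegral integral_step2.
Qed.

(** Ito isometry: both sides expand into the same double sum over pairs of steps, weighted by the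
    overlaps of their intervals. *)
Lemma step_isometry : P.-integrable setT (EFin \o (fun w => step_integral w ^+ 2)) /\
  (\int[P]_w (step_integral w ^+ 2)%:E =
   \int[P]_w \int[lam]_(s in D) (step_fun s w ^+ 2)%:E)%E.
Proof.
pose f i j w := (xi i w * incr (a i) (b i) w) * (xi j w * incr (a j) (b j) w).
have fint i j := ito_pair (hab i) (hab j) (bxi i) (bxi j).
have i2 i := (Rintegral_sum r measurableT (fun j => (fint i j).1)).1.
have [i3 e3] := Rintegral_sum r measurableT i2.
have sq w : step_integral w ^+ 2 = \sum_(i <- r) \sum_(j <- r) f i j w.
  by rewrite expr2 /step_integral big_distrlr.
have isq : P.-integrable setT (EFin \o (fun w => step_integral w ^+ 2)).
  by apply: eq_integrable i3 => // w _; rewrite /= sq.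
split=> //.
have g1 i j : P.-integrable setT (EFin \o (fun w => xi i w * xi j w)).
  apply: integrable_bounded_mul.
  - by apply: bounded_wrt_fun (bxi i); case/andP: (hab i).
  - by case: (bxi i).
  - by apply: bounded_wrt_integrable (bxi j); case/andP: (hab j).
have g1' i j : P.-integrable setT (EFin \o (fun w => xi i w * xi j w * ov i j)).
  by apply: eq_integrable (integrableZl measurableT (ov i j) (g1 i j)) => // w _; rewrite /= -EFinM mulrC.
have g2 i := (Rintegral_sum r measurableT (g1' i)).1.
have [g3 h3] := Rintegral_sum r measurableT g2.
under [RHS]eq_integral => w _ do rewrite step_energy.
rewrite -[LHS]fineK ?integrable_fin_num // -[RHS]fineK; last exact: integrable_fin_num g3.
congr EFin; rewrite -[RHS]/(Rintegral _ _ _) -[LHS]/(Rintegral _ _ _) h3.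
transitivity (\int[P]_w (\sum_(i <- r) \sum_(j <- r) f i j w)).
  by apply: eq_Rintegral => w _; rewrite sq.
rewrite e3; apply: eq_bigr => i _.
rewrite (Rintegral_sum r measurableT (fun j => (fint i j).1)).2.
rewrite (Rintegral_sum r measurableT (g1' i)).2; apply: eq_bigr => j _.
by rewrite (fint i j).2 RintegralZr.
Qed.

End step_processes.

Definition stopped_step A (X : Omega -> R) a b u w : R :=
  \1_A w * (X w * (W (Num.min u b) w - W (Num.min u a) w)).

Lemma stopped_step_martingale s t a b X A : 0 <= s <= t -> F s A -> 0 <= a <= b ->
  bounded_wrt a X ->
  P.-integrable setT (EFin \o stopped_step A X a b t) /\
  P.-integrable setT (EFin \o stopped_step A X a b s) /\
  \int[P]_w stopped_step A X a b t w = \int[P]_w stopped_step A X a b s w.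
Proof.
move=> st FA hab bX; have /andP[s0 lst] := st; have /andP[a0 ab] := hab.
have t0 := le_trans s0 lst.
have zero u : u <= a -> stopped_step A X a b u = cst (0 : R).
  move=> ua; apply/funext => w; rewrite /stopped_step !min_l // ?(le_trans ua) //.
  by rewrite subrr !mulr0.
have z1 : P.-integrable setT (EFin \o cst (0 : R)) by exact: finite_measure_integrable_cst.
have z2 : \int[P]_w (0 : R) = 0 by rewrite Rintegral_cst // mul0r.
have [sa|as_] := leP s a.
  rewrite (zero s) //; suff [h1 h2] : P.-integrable setT (EFin \o stopped_step A X a b t) /\
      \int[P]_w stopped_step A X a b t w = 0 by rewrite h2 z2.
  have [ta|at_] := leP t a; first by rewrite (zero t).
  have sa' : 0 <= s <= a by rewrite s0.
  have bAX := bounded_wrtM a0 (bounded_wrt_mono sa' (bounded_wrt_indic s0 FA)) bX.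
  have aM : 0 <= a <= Num.min t b by rewrite a0 le_min ab ltW.
  have [h1 h2] := mean0 aM bAX.1 (bounded_wrt_integrable a0 bAX).
  have e w : stopped_step A X a b t w = \1_A w * X w * incr a (Num.min t b) w.
    by rewrite /stopped_step (min_r (ltW at_)) mulrA.
  split; first by apply: eq_integrable h1 => // w _; rewrite /= e.
  by rewrite -[RHS]h2; apply: eq_Rintegral => w _; rewrite e.
have as' : 0 <= a <= s by rewrite a0 ltW.
have bAX := bounded_wrtM s0 (bounded_wrt_indic s0 FA) (bounded_wrt_mono as' bX).
have at_ : a <= t by rewrite (le_trans (ltW as_)).
have ints u : s <= u -> P.-integrable setT (EFin \o stopped_step A X a b u).
  move=> su; have au : a <= u by rewrite (le_trans (ltW as_)).
  have : P.-integrable setT (EFin \o (fun w => \1_A w * X w * incr a (Num.min u b) w)).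
    apply: integrable_bounded_mul; [exact: bounded_wrt_fun bAX|by case: bAX|].
    by apply: incr_int; rewrite a0 le_min ab au.
  by apply: eq_integrable => // w _; rewrite /= /stopped_step (min_r au) mulrA.
have i1 := ints t lst; have i2 := ints s (lexx s).
split=> //; split=> //; apply/eqP; rewrite -subr_eq0 -RintegralB //; apply/eqP.
have [bs|sb] := leP b s.
  rewrite -[RHS]z2; apply: eq_Rintegral => w _; rewrite /stopped_step.
  by rewrite !(min_r bs) !(min_r (le_trans bs lst)) (min_r (ltW as_)) (min_r at_) subrr.
have sM : 0 <= s <= Num.min t b by rewrite s0 le_min lst ltW.
have [_ h] := mean0 sM bAX.1 (bounded_wrt_integrable s0 bAX).
rewrite -[RHS]h; apply: eq_Rintegral => w _.
by rewrite /stopped_step /incr (min_l (ltW sb)) (min_r (ltW as_)) (min_r at_); ring.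
Qed.

Section simple_integrals.
Variables (f : simple_process Omega R) (hf : sp_predictable F f).

Lemma sp_time_ge0 k : 0 <= sp_time f k.
Proof.
case: hf => h0 hm _; elim: k => // k ih; exact: le_trans ih (hm k).
Qed.

Lemma sp_time_le k : sp_time f k <= sp_time f k.+1. Proof. by case: hf. Qed.

Lemma sp_val_bounded k : bounded_wrt (sp_time f k) (sp_val f k).
Proof. by case: hf => _ _ /(_ k)[]. Qed.

Lemma sp_integral_martingale s t A : 0 <= s <= t -> F s A ->
  P.-integrable setT (EFin \o (fun w => \1_A w * sp_integral f W t w)) /\
  P.-integrable setT (EFin \o (fun w => \1_A w * sp_integral f W s w)) /\
  \int[P]_w (\1_A w * sp_integral f W t w) = \int[P]_w (\1_A w * sp_integral f W s w).
Proof.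
move=> st FA.
pose g u k := stopped_step A (sp_val f k) (sp_time f k) (sp_time f k.+1) u.
have key k : P.-integrable setT (EFin \o g t k) /\ P.-integrable setT (EFin \o g s k) /\
    \int[P]_w g t k w = \int[P]_w g s k w.
  apply: stopped_step_martingale => //; last exact: sp_val_bounded.
  by rewrite sp_time_ge0 sp_time_le.
have e u w : \1_A w * sp_integral f W u w = \sum_(k <- index_enum 'I_(sp_size f)) g u k w.
  by rewrite /sp_integral mulr_sumr.
have [j1 f1] := Rintegral_sum (index_enum 'I_(sp_size f)) measurableT (fun k => (key k).1).
have [j2 f2] := Rintegral_sum (index_enum 'I_(sp_size f)) measurableT (fun k => (key k).2.1).
split; first by apply: eq_integrable j1 => // w _; rewrite /= e.
split; first by apply: eq_integrable j2 => // w _; rewrite /= e.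
transitivity (\int[P]_w (\sum_(k <- index_enum 'I_(sp_size f)) g t k w)).
  by apply: eq_Rintegral => w _; rewrite e.
rewrite f1; transitivity (\int[P]_w (\sum_(k <- index_enum 'I_(sp_size f)) g s k w)).
  by rewrite f2; apply: eq_bigr => k _; have [_ [_ ->]] := key k.
by apply: eq_Rintegral => w _; rewrite e.
Qed.

Lemma sp_integral_measurable t : 0 <= t -> measurable_fun setT (sp_integral f W t).
Proof.
move=> t0; have tt : 0 <= t <= t by rewrite t0 lexx.
have FT : F t setT.
  by case: (sF t0) => h0 hC _; rewrite -(setD0 setT); exact: hC.
have [h _] := sp_integral_martingale tt FT.
have : measurable_fun setT (fun w => \1_setT w * sp_integral f W t w).
  by apply/measurable_EFinP; exact: measurable_int h.
by congr measurable_fun; apply/funext => w; rewrite indicT mul1r.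
Qed.

End simple_integrals.

(* The values after time t are replaced by 0, so that all the steps are
   bounded by t and keep their measurability. *)
Definition cut_val (f : simple_process Omega R) t k (w : Omega) : R :=
  if sp_time f k <= t then sp_val f k w else 0.

Lemma cut_val_bounded f t k : sp_predictable F f -> 0 <= t ->
  bounded_wrt (Num.min t (sp_time f k)) (cut_val f t k).
Proof.
move=> hf t0; rewrite /cut_val; case: leP => h; first exact: sp_val_bounded.
split; last by exists 0 => w; rewrite normr0.
by apply: measurable_wrt_cst; exact: sF.
Qed.

Lemma cut_fun f t s w : 0 < s <= t -> sp_predictable F f ->
  sp_fun f s w = step_fun (iota 0 (sp_size f)) (cut_val f t)
    (fun k => Num.min t (sp_time f k)) (fun k => Num.min t (sp_time f k.+1)) s w.
Proof.
move=> /andP[s0 st] hf; rewrite /sp_fun /step_fun -[X in iota 0 X]subn0 big_mkord.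
apply: eq_bigr => k _; rewrite /cut_val !indicE !mem_setE !in_itv /= gt_min le_min st (ltNge t s) st /=.
case: (leP (sp_time f k) t) => h //=; rewrite mul0r.
by rewrite ltNge (le_trans st (ltW h)) /= mulr0.
Qed.

Lemma cut_integral f t w : sp_predictable F f ->
  sp_integral f W t w = step_integral (iota 0 (sp_size f)) (cut_val f t)
    (fun k => Num.min t (sp_time f k)) (fun k => Num.min t (sp_time f k.+1)) w.
Proof.
move=> hf; rewrite /sp_integral /step_integral -[X in iota 0 X]subn0 big_mkord.
apply: eq_bigr => k _; rewrite /cut_val; case: ifPn => //; rewrite -ltNge => h.
rewrite (min_l (le_trans (ltW h) (sp_time_le hf k))) (min_l (ltW h)).
by rewrite subrr !mulr0.
Qed.

Lemma sp_isometry f f' t : sp_predictable F f -> sp_predictable F f' -> 0 <= t ->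
  (\int[P]_w ((sp_integral f W t w - sp_integral f' W t w) ^+ 2)%:E =
   \int[P]_w \int[lebesgue_measure]_(s in `]0%R, t]) ((sp_fun f s w - sp_fun f' s w) ^+ 2)%:E)%E.
Proof.
move=> hf hf' t0.
pose r : seq (nat + nat) := map inl (iota 0 (sp_size f)) ++ map inr (iota 0 (sp_size f')).
pose xi (i : nat + nat) w := match i with inl k => cut_val f t k w | inr k => - cut_val f' t k w end.
(* The steps of f and the negated steps of f' are put together; e = 0 and e = 1 give the left and
   right ends of a step. *)
pose tm (i : nat + nat) (e : nat) := match i with inl k => Num.min t (sp_time f (k + e))
  | inr k => Num.min t (sp_time f' (k + e)) end.
have [||| _ h] := @step_isometry _ r xi (tm^~ 0%N) (tm^~ 1%N) t.
- move=> [k|k]; rewrite /tm addn0; first exact: cut_val_bounded.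
  have [m [c hc]] := cut_val_bounded k hf' t0; split.
    have m0 : 0 <= Num.min t (sp_time f' k) by rewrite le_min t0 sp_time_ge0.
    have := measurable_wrtB (sF m0) (measurable_wrt_cst (sF m0) 0) m.
    by congr measurable_wrt; apply/funext => w; rewrite sub0r.
  by exists c => w; rewrite normrN.
- move=> [k|k]; rewrite /tm addn0 addn1 le_min t0 sp_time_ge0 //= le_min ge_min lexx /= ge_min sp_time_le ?orbT //.
- by move=> [k|k]; rewrite /tm ge_min lexx.
transitivity (\int[P]_w (step_integral r xi (tm^~ 0%N) (tm^~ 1%N) w ^+ 2)%:E)%E.
  apply: eq_integral => w _; rewrite (cut_integral t w hf) (cut_integral t w hf').
  congr ((_ ^+ 2)%:E); rewrite /step_integral /r big_cat !big_map /=; congr (_ + _).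
    by apply: eq_bigr => k _; rewrite addn0 addn1.
  by rewrite -sumrN; apply: eq_bigr => k _; rewrite addn0 addn1 mulNr.
rewrite h; apply: eq_integral => w _; apply: eq_integral => s.
rewrite inE /= in_itv /= => hs.
rewrite (cut_fun w hs hf) (cut_fun w hs hf').
congr ((_ ^+ 2)%:E); rewrite /step_fun /r big_cat !big_map /=; congr (_ + _).
  by apply: eq_bigr => k _; rewrite addn0 addn1.
by rewrite -sumrN; apply: eq_bigr => k _; rewrite addn0 addn1 mulNr.
Qed.

End ito_martingale.

Section sections.
Context d (Omega : measurableType d) (R : realType).
Notation lam := (@lebesgue_measure R).
Notation TR := (measurableTypeR R).

Lemma measurable_section (D : set TR) (h : R -> Omega -> R) w : measurable D ->
  measurable_fun ([set: Omega] `*` D) (fun z : Omega * TR => h z.2 z.1) ->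
  measurable_fun D (fun v : TR => h v w).
Proof.
move=> mD mh; apply: (measurable_comp (F := [set: Omega] `*` D) (f := fun z : Omega * TR => h z.2 z.1)
  (g := fun v : TR => (w, v))) => //.
- exact: measurableX.
- by move=> _ [v Dv <-].
- by apply: measurable_funTS; apply: measurable_fun_pair => //.
Qed.

Lemma measurable_inner_integral (D : set TR) (h : R -> Omega -> R) : measurable D ->
  measurable_fun ([set: Omega] `*` D) (fun z : Omega * TR => h z.2 z.1) ->
  (forall v w, 0 <= h v w) ->
  measurable_fun setT (fun w => \int[lam]_(v in D) (h v w)%:E)%E.
Proof.
move=> mD mh h0.
pose g := (EFin \o (fun z : Omega * TR => h z.2 z.1)) \_ ([set: Omega] `*` D).
have mg : measurable_fun setT g.
  apply/(measurable_restrict _ (measurableX measurableT mD) measurableT).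
  by rewrite setTI; exact/measurable_EFinP.
have g0 z : (0 <= g z)%E by rewrite /g patchE; case: ifP; rewrite ?lee_fin.
have := measurable_fun_fubini_tonelli_F (m2 := lam) _ mg g0.
congr measurable_fun; apply/funext => w; rewrite /fubini_F [RHS]integral_mkcond.
apply: eq_integral => v _; rewrite /g !patchE.
by rewrite in_setX in_setT.
Qed.

End sections.

(** * Passage from simple processes to Ito integrals *)

Section ito_main.
Context d (Omega : measurableType d) (R : realType) (P : probability Omega R).
Variables (F : R -> set_system Omega) (W : R -> Omega -> R).
Hypothesis hW : wiener_wrt P F W.
Notation lam := (@lebesgue_measure R).
Notation TR := (measurableTypeR R).

Lemma sp_fun_measurable f : sp_predictable F f ->
  measurable_fun setT (fun z : Omega * TR => sp_fun f z.2 z.1).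
Proof.
move=> hf; apply: measurable_sum => k; apply: measurable_funM.
  have mv := bounded_wrt_fun hW (sp_time_ge0 hf k) (sp_val_bounded hf k).
  exact: (measurableT_comp mv measurable_fst).
apply: (measurableT_comp (f := \1_`]sp_time f k, sp_time f k.+1] : TR -> R)) => //.
Qed.

Let energy (T : R) (f g : R -> Omega -> R) : \bar R :=
  (\int[P]_w \int[lam]_(v in (`]0%R, T]%classic : set TR)) ((f v w - g v w) ^+ 2)%:E)%E.

(** Integrated form of (x - y)^2 <= 2 (x - z)^2 + 2 (y - z)^2. The distance from f to Y is taken up
    to t, because f is an approximation chosen for the time t. *)
Let energy_le s t (f f' Y : R -> Omega -> R) : 0 <= s <= t ->
  measurable_fun setT (fun z : Omega * TR => f z.2 z.1) ->
  measurable_fun setT (fun z : Omega * TR => f' z.2 z.1) ->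
  measurable_fun ([set: Omega] `*` (`]0, t] : set TR)) (fun z => Y z.2 z.1) ->
  (energy s f f' <=
   2%:E * energy t f Y + 2%:E * energy s f' Y)%E.
Proof.
move=> /andP[s0 st] mf mf' mY.
pose D : set TR := `]0, t]%classic; pose D' : set TR := `]0, s]%classic.
have mD : measurable D by exact: measurable_itv.
have mD' : measurable D' by exact: measurable_itv.
have D'D : D' `<=` D.
  by move=> v; rewrite /D /D' /= !in_itv /= => /andP[-> /le_trans]; exact.
have mtD' : [set: Omega] `*` D' `<=` [set: Omega] `*` D by move=> z [_ /D'D].
have mXD : measurable ([set: Omega] `*` D) by exact: measurableX.
have mY' := measurable_funS mXD mtD' mY.
pose u v w := (f v w - Y v w) ^+ 2; pose u' v w := (f' v w - Y v w) ^+ 2.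
have mu_ : measurable_fun ([set: Omega] `*` D) (fun z : Omega * TR => u z.2 z.1).
  by apply: measurable_funX; apply: measurable_funB => //; exact: measurable_funTS.
have mu' : measurable_fun ([set: Omega] `*` D') (fun z : Omega * TR => u' z.2 z.1).
  by apply: measurable_funX; apply: measurable_funB => //; exact: measurable_funTS.
have muD' := measurable_funS mXD mtD' mu_.
pose q v w := (f v w - f' v w) ^+ 2.
have mff : measurable_fun ([set: Omega] `*` D') (fun z : Omega * TR => q z.2 z.1).
  by apply: measurable_funX; apply: measurable_funTS; exact: measurable_funB.
have u0 v w : 0 <= u v w by exact: sqr_ge0.
have u'0 v w : 0 <= u' v w by exact: sqr_ge0.
have two0 : (0 <= 2%:E :> \bar R)%E by rewrite lee_fin.
have inner w : (\int[lam]_(v in D') ((f v w - f' v w) ^+ 2)%:E <=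
    2%:E * \int[lam]_(v in D) (u v w)%:E + 2%:E * \int[lam]_(v in D') (u' v w)%:E)%E.
  have m1 := measurable_section (h := q) w mD' mff.
  have m2 := measurable_section (h := u) w mD' muD'.
  have m3 := measurable_section (h := u') w mD' mu'.
  apply: (@le_trans _ _ (\int[lam]_(v in D') (2%:E * (u v w)%:E + 2%:E * (u' v w)%:E))%E).
    apply: ge0_le_integral => //.
    - by move=> v _; rewrite lee_fin sqr_ge0.
    - exact/measurable_EFinP.
    - by apply: emeasurable_funD; apply: measurable_funeM; exact/measurable_EFinP.
    - move=> v _; rewrite -!EFinM -EFinD lee_fin /u /u'.
      have := sqr_ge0 ((f v w - Y v w) + (f' v w - Y v w)); nra.
  rewrite ge0_integralD //; last 4 first.
  - by move=> v _; rewrite -EFinM lee_fin mulr_ge0.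
  - by apply: measurable_funeM; exact/measurable_EFinP.
  - by move=> v _; rewrite -EFinM lee_fin mulr_ge0.
  - by apply: measurable_funeM; exact/measurable_EFinP.
  rewrite !ge0_integralZl_EFin //; try exact/measurable_EFinP; try (by move=> v _; rewrite lee_fin).
  apply: leeD => //; apply: lee_wpmul2l => //.
  apply: ge0_subset_integral => //; last by move=> v _; rewrite lee_fin.
  by apply/measurable_EFinP; exact: (measurable_section (h := u) w mD mu_).
have M1 := measurable_inner_integral (h := u) mD mu_ u0.
have M2 := measurable_inner_integral (h := u') mD' mu' u'0.
have M3 := measurable_inner_integral (h := q) mD' mff (fun v w => sqr_ge0 (f v w - f' v w)).
have i1 w : (0 <= \int[lam]_(v in D) (u v w)%:E)%E by apply: integral_ge0 => v _; rewrite lee_fin.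
have i2 w : (0 <= \int[lam]_(v in D') (u' v w)%:E)%E by apply: integral_ge0 => v _; rewrite lee_fin.
apply: (@le_trans _ _ (\int[P]_w (2%:E * \int[lam]_(v in D) (u v w)%:E +
    2%:E * \int[lam]_(v in D') (u' v w)%:E))%E).
  apply: ge0_le_integral => //.
  - by move=> w _; apply: integral_ge0 => v _; rewrite lee_fin sqr_ge0.
  - by apply: emeasurable_funD; apply: measurable_funeM.
rewrite ge0_integralD //; last 4 first.
- by move=> w _; rewrite mule_ge0.
- exact: measurable_funeM.
- by move=> w _; rewrite mule_ge0.
- exact: measurable_funeM.
by rewrite !ge0_integralZl_EFin.
Qed.

(** [ito_integral] allows unrelated approximations f at time t and f' at time s. Both converge to Y
    on ]0, s], so the isometry brings their integrals at time s together; this joins the martingale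
    property for f with the value [Is] obtained from f'. *)
Lemma ito_martingale s t A Y It Is : 0 <= s <= t -> F s A ->
  ito_integral P F W Y t It -> ito_integral P F W Y s Is ->
  P.-integrable setT (EFin \o It) /\ P.-integrable setT (EFin \o Is) /\
  \int[P]_w (\1_A w * It w) = \int[P]_w (\1_A w * Is w).
Proof.
move=> st FA [mY mIt [f [hf Yf If]]] [mY' mIs [f' [hf' Yf' If']]].
have /andP[s0 lst] := st; have t0 := le_trans s0 lst.
have PT : (P setT < +oo)%E by rewrite probability_setT ltry.
have mA : measurable A by exact: (wiener_wrt_measurable hW s0).
have m1 l := sp_integral_measurable hW (hf l) t0.
have m2 l := sp_integral_measurable hW (hf l) s0.
have m3 l := sp_integral_measurable hW (hf' l) s0.
have c1 := l2_small PT (fun l => measurable_funB (m1 l) mIt) If.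
have c2 := l2_small PT (fun l => measurable_funB (m3 l) mIs) If'.
have c3 := l2_small PT (fun l => measurable_funB (m2 l) (m3 l)).
have {}c3 := c3 _.
have e0 : (\int[P]_w (((sp_integral (f l) W s \- sp_integral (f' l) W s)%R w) ^+ 2)%:E)%E
    @[l --> \oo] --> 0%E.
  have lim0 : (2%:E * energy t (sp_fun (f l)) Y +
      2%:E * energy s (sp_fun (f' l)) Y)%E @[l --> \oo] --> 0%E.
    have -> : (0 = 2%:E * 0 + 2%:E * 0 :> \bar R)%E by rewrite !mule0 adde0.
    have two : 2%:E \is a @fin_num R by [].
    have e1 : (2%:E * energy t (sp_fun (f l)) Y)%E @[l --> \oo] --> (2%:E * 0)%E by exact (cvgeZl two Yf).
    have e2 : (2%:E * energy s (sp_fun (f' l)) Y)%E @[l --> \oo] --> (2%:E * 0)%E by exact (cvgeZl two Yf').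
    by apply: (cvgeD _ e1 e2); rewrite !mule0.
  apply: (squeeze_cvge _ (cvg_cst 0%E) lim0); apply: nearW => l; apply/andP; split.
    by apply: integral_ge0 => w _; rewrite lee_fin sqr_ge0.
  rewrite (sp_isometry hW (hf l) (hf' l) s0).
  apply: energy_le => //; exact: sp_fun_measurable.
have {}c3 := c3 e0.
have iA (X : Omega -> R) : P.-integrable setT (EFin \o X) ->
    P.-integrable setT (EFin \o (fun w => \1_A w * X w)).
  move=> iX; apply: integrable_bounded_mul => //; exists 1 => w.
  by rewrite indicE; case: (_ \in _); rewrite ?normr1 ?normr0.
have absA (X : Omega -> R) : P.-integrable setT (EFin \o X) ->
    `|\int[P]_w (\1_A w * X w)| <= \int[P]_w `|X w|.
  move=> iX; apply: le_trans (le_normr_Rintegral measurableT (iA _ iX)) _.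
  apply: le_Rintegral => //; [exact: integrable_norm (iA _ iX)|exact: integrable_norm|].
  move=> w _; rewrite normrM indicE; case: (_ \in _); first by rewrite normr1 mul1r.
  by rewrite normr0 mul0r.
have int_sp u (X : Omega -> R) g : 0 <= u -> sp_predictable F g ->
    P.-integrable setT (EFin \o (fun w => sp_integral g W u w - X w)) ->
    P.-integrable setT (EFin \o sp_integral g W u) /\ P.-integrable setT (EFin \o X).
  move=> u0 hg iX.
  have uu : 0 <= u <= u by rewrite u0 lexx.
  have FT : F u setT.
    by case: (wiener_wrt_sigma hW u0) => h0 hC _; rewrite -(setD0 setT); exact: hC.
  have [h _] := sp_integral_martingale hW hg uu FT.
  have i1 : P.-integrable setT (EFin \o sp_integral g W u).
    by apply: eq_integrable h => // w _; rewrite /= indicT mul1r.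
  split=> //; apply: eq_integrable (integrableB measurableT i1 iX) => // w _ /=.
  by rewrite -EFinB opprB addrC subrK.
have fT : 1 + fine (P setT) = 2 :> R by rewrite probability_setT.
have [l1 [h1 _]] := filter_ex (c1 1 ltr01).
have [l2 [h2 _]] := filter_ex (c2 1 ltr01).
have [_ i1] := int_sp _ _ _ t0 (hf l1) h1.
have [_ i2] := int_sp _ _ _ s0 (hf' l2) h2.
split=> //; split=> //; apply/eqP; rewrite -subr_eq0 -normr_le0; apply/ler_addgt0Pl => e e0'.
rewrite addr0.
(* Three differences are estimated, each by (e / 6) * (1 + P setT) = e / 3. *)
have e6 : 0 < e / 6 by rewrite divr_gt0.
have [l [[a1 b1] [[a2 b2] [a3 b3]]]] := filter_ex (filterI (c1 _ e6) (filterI (c2 _ e6) (c3 _ e6))).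
rewrite fT in b1 b2 b3.
have [s1 _] := int_sp _ _ _ t0 (hf l) a1.
have [s3 _] := int_sp _ _ _ s0 (hf' l) a2.
have [_ [_ mart]] := sp_integral_martingale hW (hf l) st FA.
have s2 : P.-integrable setT (EFin \o sp_integral (f l) W s).
  apply: eq_integrable (integrableD measurableT a3 s3) => // w _ /=.
  by rewrite -EFinD subrK.
have := absA _ a1; have := absA _ a2; have := absA _ a3.
have lin (X Y' : Omega -> R) : P.-integrable setT (EFin \o X) -> P.-integrable setT (EFin \o Y') ->
    \int[P]_w (\1_A w * (X w - Y' w)) = \int[P]_w (\1_A w * X w) - \int[P]_w (\1_A w * Y' w).
  move=> iX iY; rewrite -RintegralB //; [|exact: iA|exact: iA].
  by apply: eq_Rintegral => w _; rewrite mulrBr.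
rewrite /= !lin // mart.
move: (\int[P]_w (\1_A w * sp_integral (f l) W s w)) (\int[P]_w (\1_A w * sp_integral (f' l) W s w))
  (\int[P]_w (\1_A w * It w)) (\int[P]_w (\1_A w * Is w)) => x y z u q3 q2 q1.
have {}q1 := le_trans q1 b1; have {}q2 := le_trans q2 b2; have {}q3 := le_trans q3 b3.
move: q1 q2 q3; rewrite !ler_norml => /andP[q1 q1'] /andP[q2 q2'] /andP[q3 q3'].
by apply/andP; split; lra.
Qed.

End ito_main.

(** * Compensated Poisson integrals are martingales *)

Section transitions.
Import HBNNSimple.
Context d d' (X : measurableType d) (Y : measurableType d') (R : realType).
Variable nu : X -> {measure set Y -> \bar R}.
Hypotheses (mnu : forall U, measurable U -> measurable_fun setT (fun x => nu x U))
  (fnu : forall x, (nu x setT < +oo)%E).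

Lemma measurable_transition_xsection (A : set (X * Y)) : measurable A ->
  measurable_fun setT (fun x => nu x (xsection A x)).
Proof.
pose K : R.-ker X ~> Y := HB.pack nu (isKernel.Build _ _ _ _ _ nu mnu).
have bd x : exists M, forall Z, measurable Z -> (mrestr (K x) measurableT Z < M%:E)%E.
  exists (fine (nu x setT) + 1) => Z mZ; rewrite /mrestr setIT.
  apply: (@le_lt_trans _ _ (nu x setT)); first by apply: le_measure; rewrite ?inE.
  by rewrite -[nu x setT]fineK ?ge0_fin_numE // lte_fin ltrDl.
move=> /(measurable_prod_subset_xsection_kernel (k := K) bd) [_].
by congr measurable_fun; apply/funext => x; rewrite /mrestr setIT.
Qed.

Lemma measurable_transition_integral (h : X * Y -> \bar R) : (forall z, 0 <= h z)%E ->
  measurable_fun setT h -> measurable_fun setT (fun x => \int[nu x]_y h (x, y))%E.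
Proof.
move=> h0 mh; pose h_ := nnsfun_approx measurableT mh.
apply: (@measurable_fun_xsection_integral _ _ X Y R h nu h_).
- by move=> a b ab; exact/nd_nnsfun_approx.
- by move=> z; apply: cvg_nnsfun_approx.
- move=> n r; have mS : measurable (h_ n @^-1` [set r]) by exact: measurable_sfunP.
  exact: (measurable_transition_xsection mS).
Qed.

End transitions.

Section transition_uniqueness.
Context d d' (X : measurableType d) (Y : measurableType d') (R : realType).
Variables (P : {measure set X -> \bar R}) (nu1 nu2 : X -> {measure set Y -> \bar R}).
Hypotheses (mnu1 : forall U, measurable U -> measurable_fun setT (fun x => nu1 x U))
  (fnu1 : forall x, (nu1 x setT < +oo)%E)
  (mnu2 : forall U, measurable U -> measurable_fun setT (fun x => nu2 x U))
  (fnu2 : forall x, (nu2 x setT < +oo)%E).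
Hypothesis fin1 : (\int[P]_x nu1 x setT < +oo)%E.
Variable G : set_system (X * Y).
Hypotheses (Gm : G `<=` measurable) (GI : setI_closed G) (GT : G setT).
Hypothesis GE : forall A, G A ->
  (\int[P]_x nu1 x (xsection A x) = \int[P]_x nu2 x (xsection A x))%E.

Let mx1 A (mA : measurable A) := measurable_transition_xsection mnu1 fnu1 mA.
Let mx2 A (mA : measurable A) := measurable_transition_xsection mnu2 fnu2 mA.

(** A lambda-system argument for the two measures that send A to the mean of nu x (xsection A x).
    The finite total mass permits proper differences. *)
Lemma transition_unique_set A : <<s G >> A ->
  (\int[P]_x nu1 x (xsection A x) = \int[P]_x nu2 x (xsection A x))%E.
Proof.
pose H := [set A | measurable A /\
  (\int[P]_x nu1 x (xsection A x) = \int[P]_x nu2 x (xsection A x))%E].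
suff : <<s G >> `<=` H by move=> h /h[].
have fin_sub (nu : X -> {measure set Y -> \bar R}) (mnu : forall U, measurable U -> measurable_fun setT (fun x => nu x U))
    (fnu : forall x, (nu x setT < +oo)%E) B : measurable B ->
    (\int[P]_x nu x (setT : set Y) < +oo)%E ->
    (\int[P]_x nu x (xsection B x))%E \is a fin_num.
  move=> mB h; rewrite ge0_fin_numE; last by apply: integral_ge0.
  apply: le_lt_trans h; apply: ge0_le_integral => //.
  - exact: measurable_transition_xsection.
  - exact: mnu.
  - move=> x _; apply: le_measure; rewrite ?inE //; exact: measurable_xsection.
have xT x : xsection [set: X * Y] x = setT.
  by apply/seteqP; split=> y //= _; rewrite /xsection /= inE.
have fin2 : (\int[P]_x nu2 x setT < +oo)%E.
  have e (nu : X -> {measure set Y -> \bar R}) : (\int[P]_x nu x (xsection [set: X * Y] x) = \int[P]_x nu x (setT : set Y) :> \bar R)%E.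
    by apply: eq_integral => x _; rewrite xT.
  by have := GE GT; rewrite !e => <-.
apply: lambda_system_subset => //; last first.
  by move=> B GB; split; [exact: Gm|exact: GE].
split=> //.
- by split; [exact: measurableT|exact: GE].
- move=> A' B BA [mA hA] [mB hB]; split; first exact: measurableD.
  have massB (nu : X -> {measure set Y -> \bar R}) (mnu : forall U, measurable U -> measurable_fun setT (fun x => nu x U))
      (fnu : forall x, (nu x setT < +oo)%E) : (\int[P]_x nu x (setT : set Y) < +oo)%E ->
      (\int[P]_x nu x (xsection (A' `\` B) x) =
       \int[P]_x nu x (xsection A' x) - \int[P]_x nu x (xsection B x) :> \bar R)%E.
    move=> ft.
    have f1 := fin_sub nu mnu fnu B mB ft.
    have f2 := fin_sub nu mnu fnu A' mA ft.
    apply/esym/eqP; rewrite sube_eq //; last by rewrite fin_num_adde_defl.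
    rewrite -ge0_integralD //.
    - apply/eqP; apply: eq_integral => x _; rewrite xsectionD -measureU //.
      + by rewrite setDKU //; exact: le_xsection.
      + by apply: measurableD; exact: measurable_xsection.
      + exact: measurable_xsection.
      + by rewrite setIC setDIK.
    - by apply: measurable_transition_xsection => //; exact: measurableD.
    - exact: measurable_transition_xsection.
  by rewrite (massB nu1 mnu1 fnu1 fin1) (massB nu2 mnu2 fnu2 fin2) hA hB.
- move=> A_ ndA hA; have mA n : measurable (A_ n) by have [] := hA n.
  have mU : measurable (\bigcup_n A_ n) by exact: bigcupT_measurable.
  split=> //.
  have lim (nu : X -> {measure set Y -> \bar R}) (mnu : forall U, measurable U -> measurable_fun setT (fun x => nu x U))
      (fnu : forall x, (nu x setT < +oo)%E) :
      (\int[P]_x nu x (xsection (A_ n) x))%E @[n --> \oo] --> (\int[P]_x nu x (xsection (\bigcup_n A_ n) x))%E.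
    have cx x : nu x (xsection (A_ n) x) @[n --> \oo] --> nu x (xsection (\bigcup_n A_ n) x).
      rewrite xsection_bigcup; apply: nondecreasing_cvg_mu.
      - by move=> n; exact: measurable_xsection.
      - by apply: bigcupT_measurable => n; exact: measurable_xsection.
      - by move=> a b ab; apply/subsetPset; apply: le_xsection; exact/subsetPset/ndA.
    have -> : (\int[P]_x nu x (xsection (\bigcup_n A_ n) x) =
        \int[P]_x limn (fun n => nu x (xsection (A_ n) x)))%E.
      by apply: eq_integral => x _; apply/esym/cvg_lim => //; exact: cx.
    apply: cvg_monotone_convergence => //.
    - by move=> n; exact: measurable_transition_xsection.
    - move=> x _ a b ab; apply: le_measure; rewrite ?inE; try exact: measurable_xsection.
      by apply: le_xsection; exact/subsetPset/ndA.
  have l1 := lim nu1 mnu1 fnu1; have l2 := lim nu2 mnu2 fnu2.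
  have e : (fun n => \int[P]_x nu1 x (xsection (A_ n) x))%E =
      (fun n => \int[P]_x nu2 x (xsection (A_ n) x))%E.
    by apply/funext => n; have [] := hA n.
  by rewrite e in l1; exact: cvg_unique l1 l2.
Qed.

Let PT := g_sigma_algebraType G.

Let PT_measurable (h : X * Y -> \bar R) :
  measurable_fun [set: PT] (h : PT -> \bar R) -> measurable_fun setT h.
Proof.
move=> mh _ B mB; rewrite setTI; have := mh measurableT B mB; rewrite setTI.
exact: g_sigma_sub.
Qed.

Lemma transition_unique_fun (h : X * Y -> \bar R) : (forall z, 0 <= h z)%E ->
  measurable_fun [set: PT] (h : PT -> \bar R) ->
  (\int[P]_x \int[nu1 x]_y h (x, y) = \int[P]_x \int[nu2 x]_y h (x, y))%E.
Proof.
have mi (nu : X -> {measure set Y -> \bar R}) (mnu : forall U, measurable U -> measurable_fun setT (fun x => nu x U))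
      (fnu : forall x, (nu x setT < +oo)%E) (f : X * Y -> \bar R) : (forall z, 0 <= f z)%E ->
    measurable_fun [set: PT] (f : PT -> \bar R) ->
    measurable_fun setT (fun x => \int[nu x]_y f (x, y))%E.
  by move=> f0 mf; apply: measurable_transition_integral => //; exact: PT_measurable.
have msec (f : X * Y -> \bar R) x : measurable_fun [set: PT] (f : PT -> \bar R) ->
    measurable_fun setT (fun y => f (x, y)).
  by move=> /PT_measurable mf; exact: measurableT_comp.
(* The induction takes place in the sigma-algebra generated by G, the only one on which the set
   version is known. *)
move: h; apply: (@ge0_measurable_ind _ PT R (fun h =>
  \int[P]_x \int[nu1 x]_y h (x, y) = \int[P]_x \int[nu2 x]_y h (x, y))%E).
- move=> A mA; have mA' : measurable (A : set (X * Y)) by exact: g_sigma_sub Gm A mA.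
  have e (nu : X -> {measure set Y -> \bar R}) : (\int[P]_x \int[nu x]_y ((EFin \o \1_A) (x, y)) =
      \int[P]_x nu x (xsection A x) :> \bar R)%E.
    apply: eq_integral => x _.
    have -> : (fun y => (EFin \o \1_A) (x, y)) = (fun y : Y => (\1_(xsection A x) y)%:E) :> (Y -> \bar R).
      by apply/funext => y /=; rewrite !indicE mem_xsection.
    by rewrite integral_indic ?setIT //; exact: measurable_xsection.
  by rewrite !e; exact: transition_unique_set.
- move=> r f r0 f0 mf ih.
  have e (nu : X -> {measure set Y -> \bar R}) (mnu : forall U, measurable U -> measurable_fun setT (fun x => nu x U))
      (fnu : forall x, (nu x setT < +oo)%E) :
      (\int[P]_x \int[nu x]_y (r%:E * f (x, y)) = r%:E * \int[P]_x \int[nu x]_y f (x, y) :> \bar R)%E.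
    rewrite -ge0_integralZl_EFin //; last 2 first.
    - by move=> x _; exact: integral_ge0.
    - exact: mi.
    apply: eq_integral => x _; rewrite ge0_integralZl_EFin //; exact: msec.
  by rewrite !e // ih.
- move=> f g f0 mf g0 mg ihf ihg.
  have e (nu : X -> {measure set Y -> \bar R}) (mnu : forall U, measurable U -> measurable_fun setT (fun x => nu x U))
      (fnu : forall x, (nu x setT < +oo)%E) :
      (\int[P]_x \int[nu x]_y (f (x, y) + g (x, y)) =
       \int[P]_x \int[nu x]_y f (x, y) + \int[P]_x \int[nu x]_y g (x, y) :> \bar R)%E.
    rewrite -ge0_integralD //; last 4 first.
    - by move=> x _; exact: integral_ge0.
    - exact: mi.
    - by move=> x _; exact: integral_ge0.
    - exact: mi.
    by apply: eq_integral => x _; rewrite ge0_integralD //; exact: msec.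
  by rewrite !e // ihf ihg.
- move=> f_ f f0 mf ndf fl ih.
  have pf z : (0 <= f z)%E.
    rewrite -(cvg_lim _ (fl z)) //; apply: lime_ge; first by apply/cvg_ex; exists (f z); exact: fl.
    by apply: nearW => n; exact: f0.
  have lim (nu : X -> {measure set Y -> \bar R}) (mnu : forall U, measurable U -> measurable_fun setT (fun x => nu x U))
      (fnu : forall x, (nu x setT < +oo)%E) :
      (\int[P]_x \int[nu x]_y f_ n (x, y))%E @[n --> \oo] --> (\int[P]_x \int[nu x]_y f (x, y))%E.
    have cx x : (\int[nu x]_y f_ n (x, y))%E @[n --> \oo] --> (\int[nu x]_y f (x, y))%E.
      have -> : (\int[nu x]_y f (x, y) = \int[nu x]_y limn (fun n => f_ n (x, y)))%E.
        by apply: eq_integral => y _; apply/esym/cvg_lim => //; exact: fl.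
      by apply: cvg_monotone_convergence => // n; exact: msec.
    have -> : (\int[P]_x \int[nu x]_y f (x, y) = \int[P]_x limn (fun n => \int[nu x]_y f_ n (x, y)))%E.
      by apply: eq_integral => x _; apply/esym/cvg_lim => //; exact: cx.
    apply: cvg_monotone_convergence => //.
    - by move=> n; exact: mi.
    - by move=> n x _; exact: integral_ge0.
    - move=> x _ a b ab; apply: ge0_le_integral => //; try exact: msec.
      by move=> y _; exact: (ndf (x, y) _ _ ab).
  have l1 := lim nu1 mnu1 fnu1; have l2 := lim nu2 mnu2 fnu2.
  have e : (fun n => \int[P]_x \int[nu1 x]_y f_ n (x, y))%E =
      (fun n => \int[P]_x \int[nu2 x]_y f_ n (x, y))%E.
    by apply/funext => n; exact: ih.
  by rewrite e in l1; exact: cvg_unique l1 l2.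
Qed.

End transition_uniqueness.

Section poisson_mean.
Variable R : realType.

(** Cancelling k against k! shifts the exponential series by one term. The factor c will be the
    probability of an independent event. *)
Lemma poisson_mean (c r : R) : 0 <= c -> 0 <= r ->
  (\sum_(k <oo) (c * (k%:R * (expR (- r) * r ^+ k / k`!%:R)))%:E = (c * r)%:E)%E.
Proof.
move=> c0 r0; pose u k := c * (k%:R * (expR (- r) * r ^+ k / k`!%:R)).
have part n : series u n.+1 = c * r * expR (- r) * series (exp_coeff r) n.
  rewrite /series /= big_nat_recl // {1}/u mul0r mulr0 add0r mulr_sumr.
  apply: eq_bigr => k _; rewrite /u /exp_coeff /= factS natrM exprS.
  by field; rewrite addrC natr1 !pnatr_eq0 -lt0n fact_gt0.
have cu : series u n @[n --> \oo] --> c * r.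
  rewrite -(cvg_shiftS (series u)).
  have -> : [sequence series u n.+1]_n = (fun n => c * r * expR (- r) * series (exp_coeff r) n).
    by apply/funext => n; exact: part.
  have e : c * r * expR (- r) * expR r = c * r by rewrite -mulrA -expRD addNr expR0 mulr1.
  rewrite -{2}e.
  by apply: cvgM; [exact: cvg_cst|rewrite /expR; exact: (@is_cvg_series_exp_coeff R r)].
apply/cvg_lim => //.
have -> : (fun n => \sum_(0 <= k < n) (c * (k%:R * (expR (- r) * r ^+ k / k`!%:R)))%:E)%E =
    (fun n => (series u n)%:E).
  by apply/funext => n; rewrite /series /= sumEFin.
by apply: cvg_EFin; [exact: nearW|].
Qed.

End poisson_mean.

(** * Predictable sets and the compensation formula *)

Section predictable.
Context d (Omega : measurableType d) (R : realType).
Notation RR := (measurableTypeR R * measurableTypeR R)%type.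
Variable F : R -> set_system Omega.
Hypotheses (sF : forall t, 0 <= t -> sigma_algebra setT (F t))
  (Fm : forall t, 0 <= t -> F t `<=` measurable)
  (Fmono : forall s t, 0 <= s <= t -> F s `<=` F t).

(** Left-open time intervals make the points of a rectangle later than the event A known at a. The
    rectangles miss the times u <= 0, so the full set is added for the uniqueness argument, which
    asks for it in the pi-system. *)
Definition pred_sets : set_system (Omega * RR) :=
  [set S | S = setT \/ exists a b A X,
    [/\ 0 <= a, F a A, @measurable _ (measurableTypeR R) X & S = A `*` (X `*` `]a, b]%classic)]].

Lemma pred_sets_measurable : pred_sets `<=` measurable.
Proof.
move=> S [->|[a [b [A [X [a0 FA mX ->]]]]]]; first exact: measurableT.
apply: measurableX; first exact: Fm a0 _ FA.
by apply: measurableX => //; exact: measurable_itv.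
Qed.

Lemma pred_setsI : setI_closed pred_sets.
Proof.
move=> S S' [->|[a [b [A [X [a0 FA mX ->]]]]]]; first by rewrite setTI.
move=> [->|[a' [b' [A' [X' [a0' FA' mX' ->]]]]]].
  by rewrite setIT; right; exists a, b, A, X.
right; exists (Num.max a a'), (Num.min b b'), (A `&` A'), (X `&` X').
have m0 : 0 <= Num.max a a' by rewrite le_max a0.
split=> //.
- have FI : setI_closed (F (Num.max a a')).
    move=> B B' hB hB'; have := sF m0 => /sigma_algebra_id <-; apply: g_sigma_setI;
    exact: sub_sigma_algebra.
  apply: FI; [apply: Fmono FA|apply: Fmono FA'].
    by rewrite a0 le_max lexx.
  by rewrite a0' le_max lexx orbT.
- exact: measurableI.
- rewrite -!setXI; congr (_ `*` (_ `*` _)).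
  apply/seteqP; split=> u /=; rewrite !in_itv /= gt_max le_min.
    by move=> [/andP[-> ->] /andP[-> ->]].
  by move=> /andP[/andP[-> ->] /andP[-> ->]].
Qed.

Section poisson.
Variables (P : probability Omega R) (N : Omega -> {measure set RR -> \bar R}).
Hypotheses (hN : poisson_point_process P N).
Hypothesis indN : forall a V D, 0 <= a -> measurable V -> V `<=` strip `]a, +oo[ ->
  preimage_set_system setT (fun w => N w V) measurable D ->
  forall A, F a A -> P (A `&` D) = (P A * P D)%E.
Variable r : R.
Hypothesis r0 : 0 <= r.

Let lam := @plane_measure R.

(** Both the point process and its intensity are finite on a box, while the intensity of a nonempty
    strip of positive length is infinite. *)
Definition rbox : set RR := `[- r, r]%classic `*` `]0, r]%classic.

Lemma measurable_rbox : measurable rbox.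
Proof. by apply: measurableX; exact: measurable_itv. Qed.

Let box_strip : rbox `<=` strip `]0, +oo[.
Proof.
move=> [x u] [_ /=]; rewrite in_itv /= => /andP[u0 _]; split=> //=.
by rewrite in_itv /= andbT.
Qed.

Let strip0 (a : R) : 0 <= a -> (strip `]a, +oo[ : set RR) `<=` strip `[0, +oo[.
Proof.
move=> a0 [x u] [_ /=]; rewrite in_itv /= andbT => au; split=> //=.
by rewrite in_itv /= andbT (le_trans a0 (ltW au)).
Qed.

Let box_strip0 : rbox `<=` strip `[0, +oo[.
Proof. exact: subset_trans box_strip (strip0 (lexx 0)). Qed.

Let N_nat w V : measurable V -> V `<=` rbox -> exists k : nat, N w V = k%:R%:E.
Proof.
move=> mV Vb; case: hN => _ h _ _; apply: (h w r V mV).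
apply: subset_trans Vb _ => -[x u] [/= hx]; rewrite in_itv /= => /andP[u0 ur]; split=> //=.
by rewrite in_itv /= ur ltW.
Qed.

Let mN V : measurable V -> V `<=` rbox -> measurable_fun setT (fun w => N w V).
Proof. by move=> mV Vb; case: hN => h _ _ _; apply: h => //; exact: subset_trans Vb box_strip0. Qed.

Lemma plane_box_fin V : measurable V -> V `<=` rbox -> lam V \is a fin_num.
Proof.
move=> mV Vb; rewrite ge0_fin_numE //.
apply: (@le_lt_trans _ _ (lam rbox)).
  by apply: le_measure; rewrite ?inE //; exact: measurable_rbox.
pose I1 : set (measurableTypeR R) := `[- r, r]%classic.
pose I2 : set (measurableTypeR R) := `]0, r]%classic.
have -> : lam rbox = (@lebesgue_measure R I1 * @lebesgue_measure R I2)%E.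
  by apply: product_measure1E; exact: measurable_itv.
by rewrite /I1 /I2 !lebesgue_measure_itv /=; do 2 case: ifP => _; rewrite -?EFinB -?EFinM ?mule0 ?mul0e ltry.
Qed.

(** A is split according to the number of points in V, which is independent of A; what remains is
    the mean of a Poisson variable. *)
Lemma poisson_box_mean a A V : 0 <= a -> F a A -> measurable V -> V `<=` rbox ->
  V `<=` strip `]a, +oo[ -> (\int[P]_(w in A) N w V = P A * lam V)%E.
Proof.
move=> a0 FA mV Vb Va; have mA := Fm a0 FA.
pose D k := [set w | N w V = k%:R%:E].
have mD k : measurable (D k).
  by rewrite -[D k]setTI; exact: (mN mV Vb measurableT (emeasurable_set1 k%:R%:E)).
pose E k := A `&` D k.
have AE : A = \bigcup_k E k.
  rewrite -setI_bigcupr; apply/esym/setIidl => w _.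
  by have [k hk] := N_nat w mV Vb; exists k.
have tE : trivIset setT E.
  apply/trivIsetP => i j _ _ ij; apply/seteqP; split=> // w [[_ hi] [_ hj]].
  move: ij; rewrite -(eqr_nat R) => /eqP; apply; apply: EFin_inj.
  by rewrite -hi -hj.
have fV := plane_box_fin mV Vb; have fA := fin_num_measure P _ mA.
rewrite {1}AE ge0_integral_bigcup //; last 2 first.
- by move=> k; exact: measurableI.
- by rewrite -AE; apply: measurable_funTS; exact: mN.
have e k : (\int[P]_(w in E k) N w V =
   (fine (P A) * (k%:R * (expR (- fine (lam V)) * fine (lam V) ^+ k / k`!%:R)))%:E)%E.
  transitivity (\int[P]_(w in E k) (k%:R)%:E)%E.
    by apply: eq_integral => w; rewrite inE => -[].
  transitivity ((k%:R)%:E * P (E k))%E; first by apply: integral_cst; exact: measurableI.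
  have -> : P (E k) = (P A * P (D k))%E.
    apply: (indN a0 mV Va _ FA); exists [set k%:R%:E]; first exact: emeasurable_set1.
    by rewrite setTI.
  have -> : P (D k) = (expR (- fine (lam V)) * fine (lam V) ^+ k / k`!%:R)%:E.
    case: hN => _ _ h _; apply: h => //; last by rewrite fineK.
    exact: subset_trans Vb box_strip0.
  by rewrite -[X in (_ * (X * _))%E]fineK // -!EFinM mulrCA.
under eq_eseriesr do rewrite e.
rewrite poisson_mean ?fine_ge0 //.
by rewrite EFinM !fineK.
Qed.

Let nu1 w : {measure set RR -> \bar R} := mrestr (N w) measurable_rbox.
Let nu2 (w : Omega) : {measure set RR -> \bar R} := mrestr lam measurable_rbox.

Let mnu1 U : measurable U -> measurable_fun setT (fun w => nu1 w U).
Proof.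
move=> mU; apply: mN; last exact: subIsetr.
by apply: measurableI => //; exact: measurable_rbox.
Qed.

Let mnu2 U : measurable U -> measurable_fun setT (fun w => nu2 w U).
Proof. by []. Qed.

Let fnu1 w : (nu1 w setT < +oo)%E.
Proof.
rewrite /nu1 /= /mrestr setTI.
by have [k ->] := N_nat w measurable_rbox (fun _ h => h); rewrite ltry.
Qed.

Let fnu2 w : (nu2 w setT < +oo)%E.
Proof.
rewrite /nu2 /= /mrestr setTI.
by have := plane_box_fin measurable_rbox (fun _ h => h); rewrite ge0_fin_numE.
Qed.

Let PT := g_sigma_algebraType pred_sets.

Lemma poisson_compensation (h : Omega * RR -> \bar R) : (forall z, 0 <= h z)%E ->
  measurable_fun [set: PT] (h : PT -> \bar R) ->
  (\int[P]_w \int[mrestr (N w) measurable_rbox]_z h (w, z) =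
   \int[P]_w \int[mrestr lam measurable_rbox]_z h (w, z))%E.
Proof.
have FT a : 0 <= a -> F a setT.
  by move=> a0; case: (sF a0) => h0 hC _; rewrite -(setD0 setT); exact: hC.
have gen a A V : 0 <= a -> F a A -> measurable V -> V `<=` strip `]a, +oo[ ->
    (\int[P]_w nu1 w (xsection (A `*` V) w) = \int[P]_w nu2 w (xsection (A `*` V) w))%E.
  move=> a0 FA mV Va; have mA := Fm a0 FA.
  have mVb : measurable (V `&` rbox) by apply: measurableI => //; exact: measurable_rbox.
  have e (nu : Omega -> {measure set RR -> \bar R}) :
      (\int[P]_w nu w (xsection (A `*` V) w) = \int[P]_(w in A) nu w V :> \bar R)%E.
    rewrite [RHS]integral_mkcond; apply: eq_integral => w _; rewrite patchE.
    by case: ifPn => hw; [rewrite in_xsectionX|rewrite notin_xsectionX ?measure0].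
  rewrite !e; transitivity (P A * lam (V `&` rbox))%E.
    apply: poisson_box_mean a0 FA mVb (@subIsetr _ _ _) _.
    by move=> z [/Va].
  by rewrite integral_cst // muleC.
(* The full set is not a rectangle, but under the restricted measures it counts as Omega times the
   box, all of whose times are positive. *)
have genT : (\int[P]_w nu1 w (xsection [set: Omega * RR] w) =
    \int[P]_w nu2 w (xsection [set: Omega * RR] w))%E.
  have e (mu : {measure set RR -> \bar R}) w :
      mrestr mu measurable_rbox (xsection [set: Omega * RR] w) =
      mrestr mu measurable_rbox (xsection ([set: Omega] `*` rbox) w).
    rewrite /mrestr (_ : xsection [set: Omega * RR] w = setT); last first.
      by apply/seteqP; split=> z // _; rewrite /xsection /= inE.
    by rewrite in_xsectionX ?inE // setTI setIid.
  transitivity (\int[P]_w nu1 w (xsection ([set: Omega] `*` rbox) w))%E.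
    by apply: eq_integral => w _; exact: e.
  rewrite (gen 0 setT rbox (lexx 0) (FT 0 (lexx 0)) measurable_rbox box_strip).
  by apply: eq_integral => w _; apply/esym; exact: e.
apply: (@transition_unique_fun _ _ _ _ _ P nu1 nu2 mnu1 fnu1 mnu2 fnu2 _ pred_sets).
- have -> : (\int[P]_w nu1 w setT = P setT * lam rbox)%E.
    rewrite -(poisson_box_mean (lexx 0) (FT 0 (lexx 0)) measurable_rbox (fun _ h => h) box_strip).
    by apply: eq_integral => w _; exact: (congr1 (N w) (setTI _)).
  have := plane_box_fin measurable_rbox (fun _ h => h).
  by rewrite ge0_fin_numE // probability_setT mul1e.
- exact: pred_sets_measurable.
- exact: pred_setsI.
- by left.
- move=> S [->|[a [b [A [X [a0 FA mX ->]]]]]]; first exact: genT.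
  apply: gen a0 FA _ _; first by apply: measurableX => //; exact: measurable_itv.
  move=> [x u] [_ /=]; rewrite in_itv /= => /andP[au _]; split=> //=.
  by rewrite in_itv /= andbT.
Qed.

End poisson.
End predictable.

Section compensated_martingale.
Context d (Omega : measurableType d) (R : realType).
Notation RR := (measurableTypeR R * measurableTypeR R)%type.
Variable F : R -> set_system Omega.
Hypotheses (sF : forall t, 0 <= t -> sigma_algebra setT (F t))
  (Fm : forall t, 0 <= t -> F t `<=` measurable)
  (Fmono : forall s t, 0 <= s <= t -> F s `<=` F t).
Variables (P : probability Omega R) (N : Omega -> {measure set RR -> \bar R}).
Hypotheses (hN : poisson_point_process P N).
Hypothesis indN : forall a V D, 0 <= a -> measurable V -> V `<=` strip `]a, +oo[ ->
  preimage_set_system setT (fun w => N w V) measurable D ->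
  forall A, F a A -> P (A `&` D) = (P A * P D)%E.

Let PT := g_sigma_algebraType (pred_sets F).
Let lam := @plane_measure R.

Lemma pred_measurable_fun d' (T' : measurableType d') (h : Omega * RR -> T') :
  measurable_fun [set: PT] (h : PT -> T') -> measurable_fun setT h.
Proof.
move=> mh _ B mB; rewrite setTI; have := mh measurableT B mB; rewrite setTI.
apply: g_sigma_sub; exact: pred_sets_measurable.
Qed.

Lemma pred_indic a b A (X : set (measurableTypeR R)) : 0 <= a -> F a A -> measurable X ->
  measurable_fun [set: PT] (\1_(A `*` (X `*` `]a, b]%classic)) : PT -> R).
Proof.
move=> a0 FA mX; apply: measurable_indic; apply: sub_sigma_algebra.
by right; exists a, b, A, X.
Qed.

Let FT a : 0 <= a -> F a setT.
Proof. by move=> a0; case: (sF a0) => h0 hC _; rewrite -(setD0 setT); exact: hC. Qed.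

Section fixed_box.
Variable r : R.
Let box := @rbox R r.
Let mbox := @measurable_rbox R r.
Let nu1 w : {measure set RR -> \bar R} := mrestr (N w) mbox.
Let nu2 : {measure set RR -> \bar R} := mrestr lam mbox.

Lemma mrestr_poisson_fin w : (nu1 w setT < +oo)%E.
Proof.
have -> : nu1 w setT = N w box by exact: (congr1 (N w) (setTI _)).
case: hN => _ h _ _; have [|k ->] := h w r box mbox; last by rewrite ltry.
move=> [x u] [/= hx]; rewrite in_itv /= => /andP[u0 ur]; split=> //=.
by rewrite in_itv /= ur ltW.
Qed.

Lemma mrestr_plane_fin : (nu2 setT < +oo)%E.
Proof.
have -> : nu2 setT = lam box by exact: (congr1 lam (setTI _)).
by have := plane_box_fin mbox (fun _ h => h); rewrite ge0_fin_numE.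
Qed.

Let mnu1 U : measurable U -> measurable_fun setT (fun w => nu1 w U).
Proof.
move=> mU; case: hN => h _ _ _; apply: h; first exact: measurableI.
move=> [x u] [_ [_ /=]]; rewrite in_itv /= => /andP[u0 _]; split=> //=.
by rewrite in_itv /= andbT ltW.
Qed.

Lemma integrable_section (mu : {measure set RR -> \bar R}) (h : Omega * RR -> R) K w :
  (mu setT < +oo)%E -> measurable_fun [set: PT] (h : PT -> R) -> (forall z, `|h z| <= K) ->
  mu.-integrable setT (EFin \o (fun z => h (w, z))).
Proof.
move=> mf /pred_measurable_fun mh hK.
apply: (@integrable_dominated _ _ R mu (fun z => h (w, z)) (fun=> K)) => //.
  exact: measurableT_comp.
apply/integrableP; split; first exact/measurable_EFinP.
rewrite integral_cst //= -[mu setT]fineK ?ge0_fin_numE //.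
by rewrite -EFinM ltry.
Qed.

Let comp_ge0 (h : Omega * RR -> R) K : measurable_fun [set: PT] (h : PT -> R) ->
  (forall z, 0 <= h z <= K) ->
  [/\ P.-integrable setT (EFin \o (fun w => \int[nu1 w]_z h (w, z))),
      P.-integrable setT (EFin \o (fun w => \int[nu2]_z h (w, z)))
    & \int[P]_w (\int[nu1 w]_z h (w, z)) = \int[P]_w (\int[nu2]_z h (w, z))].
Proof.
move=> mh hK; have hK' z : `|h z| <= K by have /andP[h0 h1] := hK z; rewrite ger0_norm.
have h0 z : 0 <= h z by case/andP: (hK z).
have hE0 z : (0 <= (h z)%:E)%E by rewrite lee_fin.
have mhE : measurable_fun [set: PT] (EFin \o h : PT -> \bar R) by exact/measurable_EFinP.
have mhF := pred_measurable_fun mhE.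
have e1 w : (\int[nu1 w]_z h (w, z))%:E = (\int[nu1 w]_z (h (w, z))%:E)%E.
  by rewrite /Rintegral fineK // (integrable_fin_num measurableT (integrable_section w (mrestr_poisson_fin w) mh hK')).
have e2 w : (\int[nu2]_z h (w, z))%:E = (\int[nu2]_z (h (w, z))%:E)%E.
  by rewrite /Rintegral fineK // (integrable_fin_num measurableT (integrable_section w mrestr_plane_fin mh hK')).
have E12 : (\int[P]_w (\int[nu1 w]_z h (w, z))%:E = \int[P]_w (\int[nu2]_z h (w, z))%:E)%E.
  under eq_integral do rewrite e1; under [RHS]eq_integral do rewrite e2.
  exact: (poisson_compensation sF Fm Fmono hN indN r hE0 mhE).
have i2 : P.-integrable setT (EFin \o (fun w => \int[nu2]_z h (w, z))).
  apply: (@integrable_bounded _ _ R P _ (K * fine (nu2 setT))).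
    apply/measurable_EFinP.
    have -> : (EFin \o (fun w => \int[nu2]_z h (w, z))) = (fun w => \int[nu2]_z (h (w, z))%:E)%E.
      by apply/funext => w /=; rewrite e2.
    exact: (@measurable_transition_integral _ _ _ _ R (fun=> nu2) (fun _ _ => measurable_cst _) (fun=> mrestr_plane_fin) _ hE0 mhF).
  move=> w; have iw := integrable_section w mrestr_plane_fin mh hK'.
  apply: le_trans (le_normr_Rintegral measurableT iw) _.
  rewrite -Rintegral_cst //; apply: le_Rintegral => //.
  - exact: integrable_norm.
  - exact: (integrable_section w mrestr_plane_fin (h := fun=> K) (K := `|K|)).
have m1 : measurable_fun setT (fun w => \int[nu1 w]_z h (w, z)).
  apply/measurable_EFinP.
  have -> : (EFin \o (fun w => \int[nu1 w]_z h (w, z))) = (fun w => \int[nu1 w]_z (h (w, z))%:E)%E.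
    by apply/funext => w /=; rewrite e1.
  exact: (@measurable_transition_integral _ _ _ _ R nu1 mnu1 mrestr_poisson_fin _ hE0 mhF).
split=> //; last by rewrite /Rintegral; congr fine; exact: E12.
apply/integrableP; split; first exact/measurable_EFinP.
have -> : (\int[P]_w `|(EFin \o (fun w => (\int[nu1 w]_z h (w, z))%R)) w| =
    \int[P]_w ((\int[nu1 w]_z h (w, z))%R)%:E)%E.
  by apply: eq_integral => w _ /=; rewrite ger0_norm // Rintegral_ge0.
rewrite E12; have /fin_numPlt/andP[_] := integrable_fin_num measurableT i2; exact.
Qed.

Lemma compensation_bounded (h : Omega * RR -> R) K : measurable_fun [set: PT] (h : PT -> R) ->
  (forall z, `|h z| <= K) ->
  [/\ P.-integrable setT (EFin \o (fun w => \int[nu1 w]_z h (w, z))),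
      P.-integrable setT (EFin \o (fun w => \int[nu2]_z h (w, z)))
    & \int[P]_w (\int[nu1 w]_z h (w, z)) = \int[P]_w (\int[nu2]_z h (w, z))].
Proof.
move=> mh hK; have K0 : 0 <= K by exact: le_trans (hK (point, point)).
pose hp z := Num.max (h z) 0; pose hn z := Num.max (- h z) 0.
have mp : measurable_fun [set: PT] (hp : PT -> R) by exact: measurable_maxr.
have mn : measurable_fun [set: PT] (hn : PT -> R).
  by apply: measurable_maxr => //; exact: measurableT_comp.
have bp z : 0 <= hp z <= K.
  by rewrite /hp le_max lexx orbT ge_max K0 andbT /= (le_trans (ler_norm _)).
have bn z : 0 <= hn z <= K.
  by rewrite /hn le_max lexx orbT ge_max K0 andbT /= (le_trans (ler_norm _)) // normrN.
have abs (f : Omega * RR -> R) : (forall z, 0 <= f z <= K) -> forall z, `|f z| <= K.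
  by move=> hf z; have /andP[f0 f1] := hf z; rewrite ger0_norm.
have [p1 p2 p3] := comp_ge0 mp bp; have [n1 n2 n3] := comp_ge0 mn bn.
have hE z : h z = hp z - hn z.
  by rewrite /hp /hn; case: (leP (h z) 0) => hz; [rewrite max_l ?oppr_ge0 //|rewrite max_r ?oppr_le0 ?(ltW hz) //]; rewrite ?sub0r ?opprK ?subr0.
have e (mu : {measure set RR -> \bar R}) w : (mu setT < +oo)%E ->
    \int[mu]_z h (w, z) = \int[mu]_z hp (w, z) - \int[mu]_z hn (w, z).
  move=> muf; rewrite -RintegralB //; last 2 first.
  - exact: (integrable_section w muf mp (abs _ bp)).
  - exact: (integrable_section w muf mn (abs _ bn)).
  by apply: eq_Rintegral => z _.
have q1 : (fun w => \int[nu1 w]_z h (w, z)) = (fun w => \int[nu1 w]_z hp (w, z) - \int[nu1 w]_z hn (w, z)).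
  by apply/funext => w; apply: e; exact: mrestr_poisson_fin.
have q2 : (fun w => \int[nu2]_z h (w, z)) = (fun w => \int[nu2]_z hp (w, z) - \int[nu2]_z hn (w, z)).
  by apply/funext => w; apply: e; exact: mrestr_plane_fin.
rewrite q1 q2; split.
- exact: (integrableB measurableT p1 n1).
- exact: (integrableB measurableT p2 n2).
- by rewrite !RintegralB // p3 n3.
Qed.

(** Replaces the strip, possibly of infinite mass, by the box that supports f there, so that bounded
    integrands become integrable. *)
Lemma strip_integral_box (mu : {measure set RR -> \bar R}) (f : RR -> R) u :
  measurable_fun setT f -> (forall z, strip `]0, u] z -> f z != 0 -> box z) ->
  \int[mu]_(z in strip `]0, u]) f z = \int[mrestr mu mbox]_z (f z * \1_(strip `]0, u]) z).
Proof.
move=> mf fb; rewrite /Rintegral; congr fine.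
have ms : measurable (strip `]0, u] : set RR) by apply: measurableX => //; exact: measurable_itv.
have m1 : measurable_fun setT (\1_box : RR -> R) by exact: measurable_indic.
rewrite (@integral_density _ _ R mu (mrestr mu mbox) \1_box) //.
- rewrite integral_mkcond; apply: eq_integral => z _; rewrite patchE indicE indicE.
  case: ifPn => [/set_mem sz|_] /=; last by rewrite mulr0 mul0r.
  rewrite mulr1; have [->|fz] := eqVneq (f z) 0; first by rewrite mul0r.
  by rewrite mem_set ?mulr1 //; exact: fb.
- move=> A mA; rewrite /= /mrestr [RHS]integral_indic // setIC //.
- by apply: measurable_funM => //; exact: measurable_indic.
Qed.

End fixed_box.

Variables (g : Omega * RR -> R) (K c : R).
Hypotheses (mg : measurable_fun [set: PT] (g : PT -> R)) (gK : forall z, `|g z| <= K)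
  (c0 : 0 <= c) (gc : forall w x u, 0 < u -> g (w, (x, u)) != 0 -> 0 < x < c).

Definition compensated (u : R) (w : Omega) : R :=
  \int[N w]_(z in strip `]0, u]) g (w, z) - \int[lam]_(z in strip `]0, u]) g (w, z).

(** On A, the change between s and t is the compensated integral of g restricted to A and ]s, t], a
    predictable integrand; its mean is 0 by [compensation_bounded]. *)
Lemma compensated_martingale s t A : 0 <= s <= t -> F s A ->
  P.-integrable setT (EFin \o compensated t) /\ P.-integrable setT (EFin \o compensated s) /\
  \int[P]_w (\1_A w * compensated t w) = \int[P]_w (\1_A w * compensated s w).
Proof.
move=> /andP[s0 st] FA; have t0 := le_trans s0 st.
(* Marks below c and times up to t both fit in the box of size r. *)
pose r := Num.max c t.
have r0 : 0 <= r by rewrite /r le_max c0.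
pose mbox := @measurable_rbox R r.
pose h u (z : Omega * RR) := g z * \1_(strip `]0, u] : set RR) z.2.
have mh u : measurable_fun [set: PT] (h u : PT -> R).
  apply: measurable_funM => //.
  have := @pred_indic 0 u setT setT (lexx 0) (FT (lexx 0)) measurableT.
  congr measurable_fun; apply/funext => z; rewrite !indicE; congr ((nat_of_bool _)%:R).
  by apply/idP/idP; rewrite !inE /=; [move=> [_ []]|move=> []].
have hK u z : `|h u z| <= K.
  rewrite /h normrM indicE; case: (_ \in _); first by rewrite normr1 mulr1.
  by rewrite normr0 mulr0 (le_trans (normr_ge0 _) (gK z)).
have sec u w : u <= r -> forall z, strip `]0, u] z -> g (w, z) != 0 -> rbox r z.
  move=> ur [x v] [_ /=]; rewrite in_itv /= => /andP[v0 vu] gz.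
  have /andP[x0 xc] := gc v0 gz; split=> /=; rewrite in_itv /=.
    by rewrite (le_trans _ (ltW x0)) ?oppr_le0 // (le_trans (ltW xc)) // /r le_max lexx.
  by rewrite v0 (le_trans vu).
have mgs w : measurable_fun setT (fun z : RR => g (w, z)).
  by apply: measurableT_comp; [exact: pred_measurable_fun|].
have cE u w : u <= r -> compensated u w =
    \int[mrestr (N w) mbox]_z h u (w, z) - \int[mrestr lam mbox]_z h u (w, z).
  move=> ur; rewrite /compensated.
  by rewrite !(strip_integral_box _ (mgs w) (sec u w ur)).
have sr : s <= r by rewrite /r le_max st orbT.
have tr : t <= r by rewrite /r le_max lexx orbT.
have ci u : u <= r -> P.-integrable setT (EFin \o compensated u).
  move=> ur; have [i1 i2 _] := compensation_bounded r (mh u) (hK u).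
  have i12 := integrableB measurableT i1 i2.
  have -> : compensated u = (fun w => \int[mrestr (N w) mbox]_z h u (w, z) -
      \int[mrestr lam mbox]_z h u (w, z)) by apply/funext => w; exact: cE.
  exact i12.
split; first exact: ci.
split; first exact: ci.
have mA : measurable A by exact: Fm FA.
have iA u : u <= r -> P.-integrable setT (EFin \o (fun w => \1_A w * compensated u w)).
  move=> ur; apply: integrable_bounded_mul; [exact: measurable_indic| |exact: ci].
  by exists 1 => w; rewrite indicE; case: (_ \in _); rewrite ?normr1 ?normr0.
apply/eqP; rewrite -subr_eq0 -RintegralB //; [|exact: iA|exact: iA].
(* The indicator is that of a predictable rectangle precisely because A belongs to [F s]. *)
pose hh (z : Omega * RR) := g z * \1_(A `*` (setT `*` `]s, t]%classic)) z.
have mhh : measurable_fun [set: PT] (hh : PT -> R).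
  by apply: measurable_funM => //; exact: pred_indic.
have hhK z : `|hh z| <= K.
  rewrite /hh normrM indicE; case: (_ \in _); first by rewrite normr1 mulr1.
  by rewrite normr0 mulr0 (le_trans (normr_ge0 _) (gK z)).
have [j1 j2 j3] := compensation_bounded r mhh hhK.
have hhE w z : hh (w, z) = \1_A w * (h t (w, z) - h s (w, z)).
  rewrite /hh /h -mulrBr mulrCA; congr (_ * _).
  case: z => x v; rewrite /strip !indicE !in_setX /= !in_setT /= !mem_setE /= !in_itv /=.
  case: (w \in A); rewrite /= ?mul0r ?mul1r //.
  case: (ltP 0 v) => v0 /=; last first.
    by rewrite (_ : (s < v) = false) /= ?subrr //; apply/negbTE; rewrite -leNgt (le_trans v0).
  case: (ltP s v) => sv /=; first by rewrite subr0.
  by rewrite (le_trans sv st) subrr.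
suff -> : (fun w => \1_A w * compensated t w - \1_A w * compensated s w) =
    (fun w => \int[mrestr (N w) mbox]_z hh (w, z) - \int[mrestr lam mbox]_z hh (w, z)).
  by rewrite RintegralB // j3 subrr.
apply/funext => w; rewrite !cE //.
have e (mu : {measure set RR -> \bar R}) : (mu setT < +oo)%E ->
    \int[mu]_z hh (w, z) = \1_A w * (\int[mu]_z h t (w, z) - \int[mu]_z h s (w, z)).
  move=> muf.
  have it := integrable_section w muf (mh t) (hK t).
  have is_ := integrable_section w muf (mh s) (hK s).
  rewrite -RintegralB // -RintegralZl //; last exact: (integrableB measurableT it is_).
  by apply: eq_Rintegral => z _; exact: hhE.
rewrite (e _ (mrestr_poisson_fin r w)) (e _ (mrestr_plane_fin r)); ring.
Qed.

End compensated_martingale.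

(** * Predictability of the left limits *)

Section left_limits_predictable.
Context d (Omega : measurableType d) (R : realType).
Notation RR := (measurableTypeR R * measurableTypeR R)%type.
Variable F : R -> set_system Omega.
Hypotheses (sF : forall t, 0 <= t -> sigma_algebra setT (F t)).

Let PT := g_sigma_algebraType (pred_sets F).

Let FT a : 0 <= a -> F a setT.
Proof. by move=> a0; case: (sF a0) => h0 hC _; rewrite -(setD0 setT); exact: hC. Qed.

Lemma pred_rectangle a b A (X : set (measurableTypeR R)) : 0 <= a -> F a A -> measurable X ->
  measurable (A `*` (X `*` `]a, b]%classic) : set PT).
Proof. by move=> a0 FA mX; apply: sub_sigma_algebra; right; exists a, b, A, X. Qed.

Lemma pred_step a b (Z : Omega -> R) : 0 <= a -> measurable_wrt (F a) Z ->
  measurable_fun [set: PT] ((fun z => Z z.1 * \1_`]a, b] z.2.2) : PT -> R).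
Proof.
move=> a0 mZ _ B mB; rewrite setTI.
have m1 (B' : set R) : measurable B' ->
    measurable ((Z @^-1` B') `*` (setT `*` `]a, b]%classic) : set PT).
  by move=> mB'; apply: pred_rectangle => //; exact: mZ.
(* The function is 0 outside the step, so the preimage of B is a rectangle when 0 is not in B and
   the complement of one when it is. *)
have [B0|B0] := pselect (B 0).
  have -> : (fun z : PT => Z z.1 * \1_`]a, b] z.2.2) @^-1` B =
      ~` ((Z @^-1` (~` B)) `*` (setT `*` `]a, b]%classic)).
    apply/seteqP; split=> -[w [x u]] /=; rewrite indicE mem_setE.
      by move=> h [h1 [_ h2]]; rewrite h2 mulr1 in h.
    case: (boolP (u \in _)) => hu h; rewrite ?mulr0 // mulr1.
    by apply: contrapT => h'; exact: h.
  by apply: measurableC; apply: m1; exact: measurableC.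
have -> : (fun z : PT => Z z.1 * \1_`]a, b] z.2.2) @^-1` B =
    ((Z @^-1` B) `*` (setT `*` `]a, b]%classic)).
  apply/seteqP; split=> -[w [x u]] /=; rewrite indicE mem_setE.
    by case: (boolP (u \in _)) => hu; rewrite ?mulr0 // mulr1.
  by move=> [h1 [_ ->]]; rewrite mulr1.
exact: m1.
Qed.

(** Predictable sets do not separate points at times u <= 0, hence the constant default there. *)
Lemma pred_mark : measurable_fun [set: PT]
  ((fun z => if 0 < z.2.2 then z.2.1 else 0) : PT -> R).
Proof.
pose h (l : nat) (z : PT) : R := z.2.1 * \1_`]0, l%:R] z.2.2.
apply: (@measurable_fun_cvg _ _ R setT h).
  move=> l _ B mB; rewrite setTI.
  have m1 (B' : set R) : measurable B' ->
      measurable (setT `*` (B' `*` `]0, l%:R]%classic) : set PT).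
    by move=> mB'; apply: pred_rectangle => //; exact: FT.
  have [B0|B0] := pselect (B 0).
    have -> : h l @^-1` B = ~` (setT `*` ((~` B) `*` `]0, l%:R]%classic)).
      apply/seteqP; split=> -[w [x u]] /=; rewrite /h indicE mem_setE /=.
        by move=> hB [_ [h1 h2]]; rewrite h2 mulr1 in hB.
      case: (boolP (u \in _)) => hu hB; rewrite ?mulr0 // mulr1.
      by apply: contrapT => h'; exact: hB.
    by apply: measurableC; apply: m1; exact: measurableC.
  have -> : h l @^-1` B = (setT `*` (B `*` `]0, l%:R]%classic)).
    apply/seteqP; split=> -[w [x u]] /=; rewrite /h indicE mem_setE /=.
      by case: (boolP (u \in _)) => hu; rewrite ?mulr0 // mulr1.
    by move=> [_ [h1 ->]]; rewrite mulr1.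
  exact: m1.
move=> [w [x u]] _ /=; apply: cvg_near_cst; near=> l.
rewrite /h indicE mem_setE in_itv /=; case: ltP => u0 /=; last by rewrite mulr0.
suff -> : u <= l%:R by rewrite mulr1.
by apply/ltW; near: l; exact: nbhs_infty_gtr.
Unshelve. all: by end_near. Qed.

Variable Z : R -> Omega -> R.
Hypotheses (mZ : forall t, 0 <= t -> measurable_wrt (F t) (Z t))
  (lZ : forall w u, 0 < u -> cvg (Z s w @[s --> u^'-])).

(** The step processes h l hold on ](k / (l + 1)), (k + 1) / (l + 1)] the value of Z at the left
    end. At u they show Z at the last grid point strictly before u, which tends to the left
    limit. *)
Lemma pred_left_limit : measurable_fun [set: PT]
  ((fun z => if 0 < z.2.2 then lim (Z s z.1 @[s --> z.2.2^'-]) else 0) : PT -> R).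
Proof.
pose g (l k : nat) : R := k%:R / l.+1%:R.
have l0 l : 0 < l.+1%:R :> R by rewrite ltr0n.
pose h (l : nat) (z : PT) : R :=
  \sum_(k < l.+1 * l.+1) (Z (g l k) z.1 * \1_`]g l k, g l k.+1] z.2.2).
apply: (@measurable_fun_cvg _ _ R setT h).
  move=> l; apply: measurable_sum => k.
  have gk : 0 <= g l k by rewrite divr_ge0.
  by apply: pred_step => //; exact: mZ.
move=> [w [x u]] _ /=; case: (ltP 0 u) => u0; last first.
  apply: cvg_near_cst; apply: nearW => l; rewrite /h big1 // => k _.
  rewrite indicE mem_setE in_itv /= (_ : g l k < u = false) ?mulr0 //.
  by apply/negbTE; rewrite -leNgt (le_trans u0) // divr_ge0.
(* The index of the last grid point strictly before u: ceiling minus one rather than floor, which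
   could return u itself. *)
pose q (l : nat) : nat := `|Num.ceil (u * l.+1%:R) - 1|%N.
have qE l : (q l)%:R < u * l.+1%:R <= (q l).+1%:R.
  have := ceil_itv (u * l.+1%:R).
  have : 0 < Num.ceil (u * l.+1%:R) by rewrite ceil_gt0 // mulr_gt0.
  rewrite /q; case: (Num.ceil _) => [[|k]|k] //= _.
  by rewrite intS addrAC subrr add0r -intS subn1 /= -!pmulrn.
have gq l : g l (q l) < u <= g l (q l).+1.
  by rewrite /g ltr_pdivrMr // ler_pdivlMr //.
have /cvg_at_leftP/(_ (fun l => g l (q l))) hl := @lZ w u u0.
have {hl} : Z (g l (q l)) w @[l --> \oo] --> lim (Z s w @[s --> u^'-]).
  apply: hl; split=> [l|]; first by have /andP[] := gq l.
  apply: (@squeeze_cvgr _ _ _ _ (fun l => u - l.+1%:R^-1) (fun=> u)).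
  - apply: nearW => l; have /andP[h1 h2] := gq l; rewrite (ltW h1) andbT.
    by move: h2; rewrite /g -natr1 mulrDl mul1r lerBlDr.
  - rewrite -[X in _ --> X]subr0; apply: cvgB; first exact: cvg_cst.
    exact: cvg_harmonic.
  - exact: cvg_cst.
apply: cvg_trans; apply: near_eq_cvg; near=> l.
have ul : u <= l%:R by apply/ltW; near: l; exact: nbhs_infty_gtr.
have ql : (q l < l.+1 * l.+1)%N.
  rewrite -(ltr_nat R) natrM; have /andP[h1 _] := qE l; apply: (lt_le_trans h1).
  by rewrite ler_pM2r // (le_trans ul) // ler_nat.
rewrite /h (bigD1 (Ordinal ql)) //= big1 ?addr0 => [|k kq].
  by rewrite indicE mem_setE in_itv /= gq mulr1.
have gmono a b : (a <= b)%N -> g l a <= g l b by move=> ab; rewrite ler_pM2r ?invr_gt0 // ler_nat.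
have /andP[q1 q2] := gq l.
have {}kq : (k : nat) != q l by apply: contraNneq kq => e; apply/eqP/val_inj.
rewrite indicE mem_setE in_itv /= (_ : _ && _ = false) ?mulr0 //.
apply/negbTE; rewrite negb_and -leNgt -ltNge; apply/orP.
move: kq; rewrite neq_ltn => /orP[kl|lk]; [right|left].
  exact: le_lt_trans (gmono _ _ kl) q1.
exact: le_trans q2 (gmono _ _ lk).
Unshelve. all: by end_near. Qed.

End left_limits_predictable.

(** * Dual description of states, limits and jumps *)

Section state_limits.
Variables (R : realType) (m : nat).
Implicit Types (A rho : 'M[R[i]]_m) (phi : 'M[R[i]]_m -> R).

Lemma rlin_opp phi : rlin phi -> rlin (fun A => - phi A).
Proof. by move=> h; split=> [A B|a A]; rewrite ?h.1 ?h.2 ?opprD ?mulrN. Qed.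

Lemma rlin_sform (u v : 'cV[R[i]]_m) :
  rlin (fun A => re (sform A u v)) /\ rlin (fun A => im (sform A u v)).
Proof.
have D A B : sform (A + B) u v = sform A u v + sform B u v.
  by rewrite /sform mulmxDr mulmxDl mxE.
have Z a A : sform (a%:C *: A) u v = a%:C * sform A u v.
  by rewrite /sform -scalemxAr -scalemxAl mxE.
split; split=> [A B|a A]; rewrite ?D ?Z ?reD ?imD ?reM ?imM //= mul0r.
  by rewrite subr0.
by rewrite addr0.
Qed.

Lemma rlin_trace : rlin (fun A => re (\tr A)) /\ rlin (fun A => im (\tr A)).
Proof.
split; split=> [A B|a A]; rewrite ?linearD ?linearZ ?reD ?imD ?reM ?imM //= mul0r.
  by rewrite subr0.
by rewrite addr0.
Qed.

(* The states are the closed convex set cut out by their nonnegative functionals. *)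
Lemma states_dual A :
  (forall phi, rlin phi -> (forall rho, states rho -> 0 <= phi rho) -> 0 <= phi A) ->
  re (\tr A) = 1 -> states A.
Proof.
move=> h tr1; have eq0 phi : rlin phi -> (forall rho, states rho -> phi rho = 0) -> phi A = 0.
  move=> hp p0; apply/eqP; rewrite eq_le -oppr_ge0; apply/andP; split.
    by apply: (h (fun A => - phi A)) => [|rho /p0 ->]; [exact: rlin_opp|rewrite oppr0].
  by apply: h => // rho /p0 ->.
split; last first.
  apply: complex_eqP => //=; apply: (eq0 (fun A => im (\tr A))); first exact: rlin_trace.2.
  by move=> rho [_ ->].
move=> v; apply/ge0_re_im; rewrite -/(sform _ _ _); split.
  apply: (h (fun A => re (sform A v v))); first exact: (rlin_sform v v).1.
  by move=> rho [/(_ v)/ge0_re_im[]].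
apply: (eq0 (fun A => im (sform A v v))); first exact: (rlin_sform v v).2.
by move=> rho [/(_ v)/ge0_re_im[]].
Qed.

Lemma states_closed (T : Type) (G : set_system T) (x : T -> 'M[R[i]]_m) A :
  ProperFilter G -> (forall phi, rlin phi -> phi (x s) @[s --> G] --> phi A) ->
  (\forall s \near G, states (x s)) -> states A.
Proof.
move=> PG hc hs; apply: states_dual.
  move=> phi hp p0; apply: (cvgr_to_ge (hc phi hp)).
  by apply: filterS hs => s /p0.
apply: (cvg_unique (@norm_hausdorff _ R^o) (hc _ rlin_trace.1)).
by apply: cvg_near_cst; apply: filterS hs => s [_ ->].
Qed.

Lemma cvg_rlin (T : Type) (G : set_system T) (x : T -> 'M[R[i]]_m) A : Filter G ->
  (forall j k, re (x s j k) @[s --> G] --> re (A j k) /\ im (x s j k) @[s --> G] --> im (A j k)) ->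
  forall phi, rlin phi -> phi (x s) @[s --> G] --> phi A.
Proof.
move=> FG h phi /rlin_coord[a [b e]]; rewrite e.
have -> : (fun s => phi (x s)) =
    (fun s => \sum_j \sum_k (a j k * re (x s j k) + b j k * im (x s j k))).
  by apply/funext => s; rewrite e.
have cvgs (J : finType) (f : T -> J -> R) (l : J -> R) :
    (forall j, f s j @[s --> G] --> l j) -> \sum_j f s j @[s --> G] --> \sum_j l j.
  move=> hf; elim: (index_enum J) => [|j r IH].
    by rewrite big_nil; under eq_fun do rewrite big_nil; exact: cvg_cst.
  by rewrite big_cons; under eq_fun do rewrite big_cons; exact: cvgD.
apply: (@cvgs) => j; apply: (@cvgs) => k; have [h1 h2] := h j k.
by apply: cvgD; apply: cvgM => //; exact: cvg_cst.
Qed.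

Lemma cvg_left_limit (x : R -> 'M[R[i]]_m) t phi : mx_all (@cadlag R) x -> 0 < t ->
  rlin phi -> phi (x s) @[s --> t^'-] --> phi (left_limit x t).
Proof.
move=> hx t0; apply: cvg_rlin => j k; rewrite !mxE /=.
by have [[_ h1] [_ h2]] := hx j k; split; [exact: h1|exact: h2].
Qed.

Lemma cvg_right (x : R -> 'M[R[i]]_m) t phi : mx_all (@cadlag R) x -> 0 <= t ->
  rlin phi -> phi (x s) @[s --> t^'+] --> phi (x t).
Proof.
move=> hx t0; apply: cvg_rlin => j k.
by have [[h1 _] [h2 _]] := hx j k; split; [exact: h1|exact: h2].
Qed.

Lemma states_left_limit (x : R -> 'M[R[i]]_m) t : mx_all (@cadlag R) x -> 0 < t ->
  (forall s, 0 <= s -> states (x s)) -> states (left_limit x t).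
Proof.
move=> hx t0 hs; apply: (@states_closed _ (t^'-) x).
  by move=> phi hp; exact: cvg_left_limit.
by near=> s; apply/hs/ltW; near: s; exact: nbhs_left_gt.
Unshelve. all: by end_near. Qed.

Lemma jump_is_linear (C : 'M[R[i]]_m) : linear (jump C).
Proof. by move=> c A B; rewrite /jump mulmxDr mulmxDl -scalemxAr -scalemxAl. Qed.

HB.instance Definition _ (C : 'M[R[i]]_m) :=
  GRing.isLinear.Build R[i] 'M[R[i]]_m 'M[R[i]]_m *:%R (jump C) (jump_is_linear C).

Definition jump_rate (C : 'M[R[i]]_m) rho : R := re (\tr (jump C rho)).

Lemma rlin_jump_rate C : rlin (jump_rate C).
Proof. exact: (rlin_comp (jump C) rlin_trace.1). Qed.

Lemma jump_integrandE C rho x phi : rlin phi -> psd rho ->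
  phi (jump_integrand C rho x) =
  if 0 < x < jump_rate C rho then (jump_rate C rho)^-1 * phi (jump C rho) - phi rho else 0.
Proof.
move=> hp ps; rewrite /jump_integrand /jump_rate; case: ifP => _; last exact: rlin0.
have [_ im0] := psd_tr (psd_mul C ps : psd (jump C rho)).
rewrite rlinB // -hp.2; congr (phi (_ *: _) - _).
rewrite {1}(_ : \tr (jump C rho) = (re (\tr (jump C rho)))%:C); last exact: complex_eqP.
by rewrite fmorphV.
Qed.

(** The entries of [jump C rho] are bounded by its trace, so the quotient stays bounded however
    small the rate is. *)
Lemma jump_integrand_bound C phi : rlin phi -> exists K, 0 <= K /\
  forall rho x, states rho -> `|phi (jump_integrand C rho x)| <= K.
Proof.
move=> hp; have [K [K0 hK]] := rlin_entry_bound hp; exists (K + K); split; first exact: addr_ge0.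
move=> rho x st; have ps := st.1; rewrite jump_integrandE //.
case: ifP => [/andP[x0 xv]|_]; last by rewrite normr0 addr_ge0.
have v0 := lt_trans x0 xv; apply: le_trans (ler_normB _ _) _; apply: lerD.
  rewrite normrM gtr0_norm ?invr_gt0 // ler_pdivrMl // mulrC; apply: hK => j k.
  exact: psd_entry_le_tr (psd_mul C ps).
by rewrite -[K]mulr1; apply: hK => j k; exact: state_entry.
Qed.

End state_limits.

Section state_process_predictable.
Context d (Omega : measurableType d) (R : realType) (m : nat).
Notation RR := (measurableTypeR R * measurableTypeR R)%type.
Variable F : R -> set_system Omega.
Hypotheses (sF : forall t, 0 <= t -> sigma_algebra setT (F t)).
Variable rho : R -> Omega -> 'M[R[i]]_m.
Hypotheses (st : forall t w, 0 <= t -> states (rho t w))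
  (cad : forall w, mx_all (@cadlag R) (rho ^~ w))
  (ad : forall t, 0 <= t -> mx_all (measurable_wrt (F t)) (rho t)).

Let PT := g_sigma_algebraType (pred_sets F).

(** Agrees with the left limit at positive times. The constant default elsewhere makes the process
    predictable, and functionals vanish on it. *)
Definition left_state (w : Omega) (u : R) : 'M[R[i]]_m :=
  if 0 < u then left_limit (rho ^~ w) u else 0.

Lemma left_state_states w u : 0 < u -> states (left_state w u).
Proof. by move=> u0; rewrite /left_state u0; apply: states_left_limit => // s s0; exact: st. Qed.

Lemma cvg_left_state w u phi : 0 < u -> rlin phi ->
  phi (rho s w) @[s --> u^'-] --> phi (left_state w u).
Proof. by move=> u0 hp; rewrite /left_state u0; exact: (cvg_left_limit (cad w)). Qed.

Lemma rlin_measurable d' (T : measurableType d') (X : T -> 'M[R[i]]_m) phi :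
  (forall j k, measurable_fun setT (fun z => re (X z j k)) /\
               measurable_fun setT (fun z => im (X z j k))) ->
  rlin phi -> measurable_fun setT (phi \o X).
Proof.
move=> h /rlin_coord[a [b e]].
have -> : phi \o X = (fun z => \sum_j \sum_k (a j k * re (X z j k) + b j k * im (X z j k))).
  by apply/funext => z /=; rewrite e.
apply: measurable_sum => j; apply: measurable_sum => k; have [h1 h2] := h j k.
by apply: measurable_funD; apply: measurable_funM.
Qed.

Lemma rlin_adapted t phi : 0 <= t -> rlin phi ->
  measurable_wrt (F t) (fun w => phi (rho t w)).
Proof.
move=> t0 hp; apply/(measurable_wrtP (sF t0)).
apply: (@rlin_measurable _ (g_sigma_algebraType (F t)) (rho t)) => // j k.
by have [h1 h2] := ad t0 j k; split; exact/(measurable_wrtP (sF t0)).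
Qed.

Lemma pred_left_state phi : rlin phi ->
  measurable_fun [set: PT] ((fun z => phi (left_state z.1 z.2.2)) : PT -> R).
Proof.
move=> hp.
apply: (@rlin_measurable _ PT (fun z => left_state z.1 z.2.2)) => // j k.
split.
- have := @pred_left_limit _ Omega R F (fun t w => re (rho t w j k))
    (fun t t0 => (ad t0 j k).1) (fun w u u0 => (cad w j k).1.2 u u0).
  congr (measurable_fun setT _); apply/funext => z; rewrite /left_state.
  by case: ifP => _; rewrite !mxE.
- have := @pred_left_limit _ Omega R F (fun t w => im (rho t w j k))
    (fun t t0 => (ad t0 j k).2) (fun w u u0 => (cad w j k).2.2 u u0).
  congr (measurable_fun setT _); apply/funext => z; rewrite /left_state.
  by case: ifP => _; rewrite !mxE.
Qed.

Lemma pred_jump_integrand C phi : rlin phi ->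
  measurable_fun [set: PT]
    ((fun z => phi (jump_integrand C (left_state z.1 z.2.2) z.2.1)) : PT -> R).
Proof.
move=> hp; pose x (z : PT) : R := if 0 < z.2.2 then z.2.1 else 0.
pose v (z : PT) : R := jump_rate C (left_state z.1 z.2.2).
have mx : measurable_fun [set: PT] x by exact: pred_mark.
have mv : measurable_fun [set: PT] v by apply: pred_left_state; exact: rlin_jump_rate.
have mj := pred_left_state (rlin_comp (jump C) hp).
(* The mark is replaced by its predictable version and the inverse rate by a power, so that each
   ingredient is visibly measurable. *)
have -> : (fun z : PT => phi (jump_integrand C (left_state z.1 z.2.2) z.2.1)) =
    (fun z => if (0 < x z) && (x z < v z) then powR (v z) (-1) * phi (jump C (left_state z.1 z.2.2))
       - phi (left_state z.1 z.2.2) else 0).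
  apply/funext => -[w [y u]]; rewrite /x /v /=; case: (ltP 0 u) => u0; last first.
    rewrite ltxx /= /left_state ltNge u0 /= /jump_integrand.
    by rewrite /jump mulmx0 mul0mx mxtrace0 /= lt_asym rlin0.
  have [ps _] := left_state_states w u0.
  rewrite jump_integrandE // powR_inv1 // /jump_rate.
  by have [] := psd_tr (psd_mul C ps : psd (jump C _)).
apply: measurable_fun_ifT => //.
  by apply: measurable_and; exact: measurable_fun_ltr.
apply: measurable_funB; last exact: pred_left_state.
by apply: measurable_funM => //; exact: measurableT_comp (measurable_powR (-1)) mv.
Qed.

(** Jump rates are bounded on states, so only marks in a bounded interval matter; this c is the one
    required by [compensated_martingale]. *)
Lemma jump_integrand_support C : exists c, 0 <= c /\ forall phi w x u, rlin phi -> 0 < u ->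
  phi (jump_integrand C (left_state w u) x) != 0 -> 0 < x < c.
Proof.
have [c [c0 hc]] := rlin_state_bound (rlin_jump_rate C); exists c; split=> //.
move=> phi w x u hp u0; have lst := left_state_states w u0; have [ps _] := lst.
rewrite jump_integrandE //; case: ifP => [/andP[-> xv] _|]; last by rewrite eqxx.
exact: lt_le_trans xv (le_trans (ler_norm _) (hc _ lst)).
Qed.

End state_process_predictable.

(** * Mean evolution of the master equation *)

Lemma Rintegral_cst_prob d (Omega : measurableType d) (R : realType) (P : probability Omega R)
  (c : R) : \int[P]_w c = c.
Proof.
have := Rintegral_cst P measurableT c.
have -> : fine (P setT) = 1 by exact: (congr1 fine (probability_setT P)).
by rewrite mulr1; exact.
Qed.

Section bounded_fubini.
Context d (Omega : measurableType d) (R : realType) (P : probability Omega R).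
Notation lam := (@lebesgue_measure R).
Notation TR := (measurableTypeR R).
Variables (D : set TR) (mD : measurable D) (Dfin : (lam D < +oo)%E).

Lemma integrable_scaled_indic (K : R) : lam.-integrable setT (EFin \o (fun u => K * \1_D u)).
Proof.
apply/integrableP; split.
  by apply/measurable_EFinP; apply: measurable_funM => //; exact: measurable_indic.
have -> : (\int[lam]_u `|(EFin \o (fun u => (K * \1_D u)%R)) u| =
    \int[lam]_u (Num.norm K * \1_D u)%:E)%E.
  apply: eq_integral => u _ /=; rewrite normrM indicE.
  by case: (u \in D); rewrite ?normr1 ?normr0.
under eq_integral do rewrite EFinM.
rewrite ge0_integralZl_EFin //; last by apply/measurable_EFinP; exact: measurable_indic.
by rewrite integral_indic // setIT lte_mul_pinfty.
Qed.

Lemma Rintegral_scaled_indic (K : R) : \int[lam]_u (K * \1_D u) = K * fine (lam D).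
Proof.
rewrite RintegralZl //; last first.
  have := integrable_scaled_indic 1; congr (integrable _ _ _).
  by apply/funext => u /=; rewrite mul1r.
by congr (_ * _); rewrite /Rintegral integral_indic // setIT.
Qed.

Variables (f : Omega * TR -> R) (K : R).
Hypotheses (mf : measurable_fun setT f) (fK : forall z, `|f z| <= K * \1_D z.2).

Let sec_int w : lam.-integrable setT (EFin \o (fun u => f (w, u))).
Proof.
apply: (@integrable_dominated _ _ R lam _ (fun u => K * \1_D u)).
- exact: measurableT_comp.
- exact: integrable_scaled_indic.
- by move=> u; exact: fK.
Qed.

Let sec_int2 u : P.-integrable setT (EFin \o (fun w => f (w, u))).
Proof.
by apply: (@integrable_bounded _ _ R P _ (K * \1_D u)) => [|w]; [exact: measurableT_comp|exact: fK].
Qed.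

Let prod_int : (P \x lam)%E.-integrable setT (EFin \o f).
Proof.
apply/integrable12ltyP; first exact/measurable_EFinP.
apply: (@le_lt_trans _ _ (\int[P]_w (\int[lam]_u `|(K * \1_D u)%:E|))%E).
  apply: ge0_le_integral => //.
  - by move=> w _; exact: integral_ge0.
  - apply: (@measurable_fun_fubini_tonelli_F _ _ _ _ _ lam (fun z => `|(f z)%:E|)%E) => //.
    by apply: measurableT_comp => //; exact/measurable_EFinP.
  - move=> w _; apply: ge0_le_integral => //.
    + by apply: measurableT_comp => //; apply/measurable_EFinP; exact: measurableT_comp.
    + by case/integrableP: (integrable_scaled_indic K) => mm _; exact: measurableT_comp.
    + by move=> u _; rewrite lee_fin (le_trans (fK (w, u))) // ler_norm.
rewrite integral_cst // [X in (_ * X)%E](_ : _ = 1%E) ?mule1; last exact: probability_setT.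
by case/integrableP: (integrable_scaled_indic K).
Qed.

Lemma bounded_fubini :
  [/\ P.-integrable setT (EFin \o (fun w => \int[lam]_u f (w, u))),
      lam.-integrable setT (EFin \o (fun u => \int[P]_w f (w, u)))
    & \int[P]_w (\int[lam]_u f (w, u)) = \int[lam]_u (\int[P]_w f (w, u))].
Proof.
have e1 : EFin \o (fun w => \int[lam]_u f (w, u)) = fubini_F lam (EFin \o f).
  apply/funext => w /=; rewrite /fubini_F /Rintegral fineK //.
  exact: (integrable_fin_num measurableT (sec_int w)).
have e2 : EFin \o (fun u => \int[P]_w f (w, u)) = fubini_G P (EFin \o f).
  apply/funext => u /=; rewrite /fubini_G /Rintegral fineK //.
  exact: (integrable_fin_num measurableT (sec_int2 u)).
rewrite e1 e2; split.
- exact: (integrable_fubini_F prod_int).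
- rewrite -e2; apply: (@integrable_dominated _ _ R lam _ (fun u => K * \1_D u)).
  + by apply/measurable_EFinP; rewrite e2; exact: (measurable_fubini_G prod_int).
  + exact: integrable_scaled_indic.
  + move=> u; apply: le_trans (le_normr_Rintegral measurableT (sec_int2 u)) _.
    rewrite -[leRHS](Rintegral_cst_prob P); apply: le_Rintegral => //.
    * exact: integrable_norm.
    * exact: (finite_measure_integrable_cst P _ measurableT).
- rewrite /Rintegral; congr fine.
  transitivity (\int[P]_w fubini_F lam (EFin \o f) w)%E.
    by apply: eq_integral => w _; rewrite -e1.
  transitivity (\int[lam]_u fubini_G P (EFin \o f) u)%E; first exact: Fubini.
  by apply: eq_integral => w _; rewrite -e2.
Qed.

End bounded_fubini.

Section time_average.
Context d (Omega : measurableType d) (R : realType) (P : probability Omega R).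
Notation lam := (@lebesgue_measure R).
Notation TR := (measurableTypeR R).
Variables (h : R -> Omega -> R) (K : R).
Hypotheses (mh : measurable_fun setT (fun z : Omega * TR => h z.2 z.1))
  (hK : forall u w, `|h u w| <= K).

(** Fubini's theorem moves the mean inside the time integral. Used with c = 0 for the Lipschitz
    estimate and with c the mean drift at time s for the Euler estimate. *)
Lemma time_average_estimate A s t c K2 : measurable A -> s <= t ->
  (forall u, s < u <= t -> `|\int[P]_w (\1_A w * h u w) - c| <= K2) ->
  P.-integrable setT (EFin \o (fun w => \int[lam]_(u in `]s, t]) h u w)) /\
  `|\int[P]_w (\1_A w * \int[lam]_(u in `]s, t]) h u w) - (t - s) * c| <= K2 * (t - s).
Proof.
move=> mA st hc; have K0 : 0 <= K by exact: le_trans (hK 0 point).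
pose D : set TR := `]s, t]%classic.
have mD : measurable D by exact: measurable_itv.
have lD : lam D = (t - s)%:E by rewrite /D lebesgue_measure_itv /= lte_fin; case: ltgtP st => // ->; rewrite subrr.
have Dfin : (lam D < +oo)%E by rewrite lD ltry.
have normI (T : Type) (B : set T) x : `|\1_B x : R| <= 1.
  by rewrite indicE; case: (_ \in _); rewrite ?normr1 ?normr0.
have fub (B : set Omega) : measurable B ->
    let f := fun z : Omega * TR => \1_B z.1 * h z.2 z.1 * \1_D z.2 in
    measurable_fun setT f /\ forall z, `|f z| <= K * \1_D z.2.
  move=> mB /=; split.
    apply: measurable_funM; last by apply: measurableT_comp => //; exact: measurable_indic.
    by apply: measurable_funM => //; apply: measurableT_comp => //; exact: measurable_indic.
  move=> z; rewrite !normrM (ger0_norm (x := \1_D _)) ?indicE // ler_wpM2r // -[K]mul1r.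
  by apply: ler_pM => //; rewrite -indicE; exact: normI.
have inner (B : set Omega) w : \1_B w * \int[lam]_(u in D) h u w =
    \int[lam]_u (\1_B w * h u w * \1_D u).
  rewrite Rintegral_mkcond -RintegralZl //; last first.
    apply: (@integrable_dominated _ _ R lam _ (fun u => K * \1_D u)).
    - have -> : (fun u => h u w) \_ D = (fun u => h u w * \1_D u).
        by apply/funext => u; rewrite patchE indicE; case: ifP => _; rewrite ?mulr1 ?mulr0.
      apply: measurable_funM; last exact: measurable_indic.
      by have := @measurable_section _ Omega R setT h w measurableT; rewrite setXTT; exact.
    - exact: integrable_scaled_indic.
    - move=> u; rewrite patchE indicE; case: ifP => _; rewrite ?mulr1 ?mulr0 //.
      by rewrite normr0.
  apply: eq_Rintegral => u _; rewrite -mulrA patchE [\1_D u]indicE.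
  by case: ifP => _; rewrite ?mulr1 ?mulr0.
have [mf1 fK1] := fub setT measurableT; have [i1 _ _] := bounded_fubini P mD Dfin mf1 fK1.
have [mf2 fK2] := fub A mA; have [j1 j2 j3] := bounded_fubini P mD Dfin mf2 fK2.
split.
  move: i1; congr (integrable _ _ _); apply/funext => w /=.
  by rewrite -inner indicT mul1r.
have -> : \int[P]_w (\1_A w * \int[lam]_(u in D) h u w) =
    \int[P]_w (\int[lam]_u (\1_A w * h u w * \1_D u)).
  by apply: eq_Rintegral => w _; exact: inner.
rewrite [X in `|X - _|]j3.
have -> : (t - s) * c = \int[lam]_u (c * \1_D u).
  by rewrite Rintegral_scaled_indic // lD mulrC.
have -> : K2 * (t - s) = \int[lam]_u (K2 * \1_D u) by rewrite Rintegral_scaled_indic // lD.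
have ic := integrable_scaled_indic mD Dfin c.
rewrite -RintegralB //.
have id := integrableB measurableT j2 ic.
apply: le_trans (le_normr_Rintegral measurableT id) _.
apply: le_Rintegral => //.
- exact: (integrable_norm id).
- exact: integrable_scaled_indic.
move=> u _ /=; rewrite RintegralZr //; last first.
  apply: (@integrable_bounded _ _ R P _ K).
    apply: measurable_funM; first exact: measurable_indic.
    exact: (measurableT_comp mh (measurable_fun_pair (@measurable_id _ _ setT) (@measurable_cst _ _ _ _ setT u))).
  by move=> w; rewrite normrM -[K]mul1r ler_pM.
rewrite -mulrBl normrM indicE mem_setE in_itv /=.
case: (boolP (s < u <= t)) => us /=; last by rewrite normr0 !mulr0.
by rewrite normr1 !mulr1 hc.
Qed.

End time_average.

(** * Martingales tested on past events *)

Section martingales.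
Context d (Omega : measurableType d) (R : realType) (P : probability Omega R).
Variable F : R -> set_system Omega.
Hypotheses (Fm : forall t, 0 <= t -> F t `<=` measurable).

(** Conditional expectation is expressed through the means over the events of [F s]; adaptedness is
    kept separate. *)
Definition martingale (X : R -> Omega -> R) :=
  forall s t A, 0 <= s <= t -> F s A ->
  P.-integrable setT (EFin \o X t) /\ P.-integrable setT (EFin \o X s) /\
  \int[P]_w (\1_A w * X t w) = \int[P]_w (\1_A w * X s w).

Lemma integrable_indicM (A : set Omega) (Y : Omega -> R) : measurable A ->
  P.-integrable setT (EFin \o Y) -> P.-integrable setT (EFin \o (fun w => \1_A w * Y w)).
Proof.
move=> mA iY; apply: integrable_bounded_mul => //.
by exists 1 => w; rewrite indicE; case: (_ \in _); rewrite ?normr1 ?normr0.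
Qed.

Lemma Rintegral_indicD (A : set Omega) (X Y : Omega -> R) : measurable A ->
  P.-integrable setT (EFin \o X) -> P.-integrable setT (EFin \o Y) ->
  \int[P]_w (\1_A w * (X w + Y w)) = \int[P]_w (\1_A w * X w) + \int[P]_w (\1_A w * Y w).
Proof.
move=> mA iX iY; rewrite -RintegralD //; [|exact: integrable_indicM..].
by apply: eq_Rintegral => w _; rewrite mulrDr.
Qed.

Lemma martingale_cst (c : R) : martingale (fun _ _ => c).
Proof.
move=> s t A _ FA; have ic := finite_measure_integrable_cst P c measurableT.
by split; [|split].
Qed.

Lemma martingale_add X Y : martingale X -> martingale Y ->
  martingale (fun t w => X t w + Y t w).
Proof.
move=> hX hY s t A st FA; have [x1 [x2 x3]] := hX _ _ _ st FA.
have [y1 [y2 y3]] := hY _ _ _ st FA.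
have mA : measurable A by apply: Fm FA; case/andP: st.
split; first exact: (integrableD measurableT x1 y1).
split; first exact: (integrableD measurableT x2 y2).
by rewrite !Rintegral_indicD // x3 y3.
Qed.

Lemma martingale_sum (I : Type) (r : seq I) (Q : pred I) (X : I -> R -> Omega -> R) :
  (forall i, Q i -> martingale (X i)) ->
  martingale (fun t w => \sum_(i <- r | Q i) X i t w).
Proof.
move=> hX; elim: r => [|i r IH].
  have -> : (fun t w => \sum_(i <- [::] | Q i) X i t w) = (fun _ _ => 0).
    by apply/funext => t; apply/funext => w; rewrite big_nil.
  exact: martingale_cst.
case: (boolP (Q i)) => Qi.
  have -> : (fun t w => \sum_(i <- i :: r | Q i) X i t w) =
      (fun t w => X i t w + \sum_(i <- r | Q i) X i t w).
    by apply/funext => t; apply/funext => w; rewrite big_cons Qi.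
  by apply: martingale_add => //; exact: hX.
have -> // : (fun t w => \sum_(i <- i :: r | Q i) X i t w) =
      (fun t w => \sum_(i <- r | Q i) X i t w).
by apply/funext => t; apply/funext => w; rewrite big_cons (negbTE Qi).
Qed.

Lemma martingale_scale c X : martingale X -> martingale (fun t w => c * X t w).
Proof.
move=> hX s t A st FA; have [x1 [x2 x3]] := hX _ _ _ st FA.
have mA : measurable A by apply: Fm FA; case/andP: st.
split; first exact: (integrableZl measurableT c x1).
split; first exact: (integrableZl measurableT c x2).
have e Y : P.-integrable setT (EFin \o Y) ->
    \int[P]_w (\1_A w * (c * Y w)) = c * \int[P]_w (\1_A w * Y w).
  move=> iY; rewrite -RintegralZl //; last exact: integrable_indicM.
  by apply: eq_Rintegral => w _; rewrite mulrCA.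
by rewrite !e // x3.
Qed.

Lemma martingale_rlin m (X : R -> Omega -> 'M[R[i]]_m) phi : rlin phi ->
  (forall j k, martingale (fun t w => re (X t w j k)) /\ martingale (fun t w => im (X t w j k))) ->
  martingale (fun t w => phi (X t w)).
Proof.
move=> /rlin_coord[a [b e]] hX.
have -> : (fun t w => phi (X t w)) = (fun t w => \sum_j \sum_k
    (a j k * re (X t w j k) + b j k * im (X t w j k))).
  by apply/funext => t; apply/funext => w; rewrite e.
apply: martingale_sum => j _; apply: martingale_sum => k _; have [h1 h2] := hX j k.
by apply: martingale_add; exact: martingale_scale.
Qed.

Lemma ae_eq_Rintegral_indic (A : set Omega) (X Y : Omega -> R) : measurable A ->
  measurable_fun setT X -> measurable_fun setT Y -> {ae P, forall w, X w = Y w} ->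
  \int[P]_w (\1_A w * X w) = \int[P]_w (\1_A w * Y w).
Proof.
move=> mA mX mY XY; rewrite /Rintegral; congr fine; apply: ae_eq_integral => //.
- by apply/measurable_EFinP; apply: measurable_funM => //; exact: measurable_indic.
- by apply/measurable_EFinP; apply: measurable_funM => //; exact: measurable_indic.
- by apply: filterS XY => w /= -> _.
Qed.

(** The decomposition holds almost surely at each fixed time, with an exceptional set that may
    depend on the time; this is enough for means. *)
Lemma semimartingale_increment (Z D X : R -> Omega -> R) : martingale X ->
  (forall t, 0 <= t -> measurable_fun setT (Z t)) ->
  (forall t, 0 <= t -> P.-integrable setT (EFin \o D t)) ->
  (forall t, 0 <= t -> {ae P, forall w, Z t w = X t w + D t w}) ->
  forall s t A, 0 <= s <= t -> F s A ->
  \int[P]_w (\1_A w * Z t w) - \int[P]_w (\1_A w * Z s w) =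
  \int[P]_w (\1_A w * (D t w - D s w)).
Proof.
move=> hX mZ iD hZ s t A st FA; have [x1 [x2 x3]] := hX _ _ _ st FA.
have /andP[s0 st'] := st; have t0 := le_trans s0 st'.
have mA : measurable A by exact: Fm FA.
have e u : 0 <= u -> P.-integrable setT (EFin \o X u) ->
    \int[P]_w (\1_A w * Z u w) = \int[P]_w (\1_A w * X u w) + \int[P]_w (\1_A w * D u w).
  move=> u0 iX; rewrite -Rintegral_indicD //; last exact: iD.
  apply: ae_eq_Rintegral_indic => //; [exact: mZ| |exact: hZ].
  by apply: measurable_funD; apply/measurable_EFinP;
     [case/integrableP: iX|case/integrableP: (iD u u0)].
rewrite !e // x3.
have iN : P.-integrable setT (EFin \o (fun w => - D s w)).
  exact: (integrableN (iD s s0)).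
rewrite Rintegral_indicD //; last exact: iD.
have -> : \int[P]_w (\1_A w * - D s w) = - \int[P]_w (\1_A w * D s w).
  transitivity (\int[P]_w (-1 * (\1_A w * D s w))).
    by apply: eq_Rintegral => w _; rewrite mulrN mulN1r.
  by rewrite RintegralZl ?mulN1r //; apply: integrable_indicM => //; exact: iD.
ring.
Qed.

End martingales.

Lemma Rintegral_prob_bound d (Omega : measurableType d) (R : realType) (P : probability Omega R)
  (f : Omega -> R) K : measurable_fun setT f -> (forall w, `|f w| <= K) ->
  `|\int[P]_w f w| <= K.
Proof.
move=> mf fK; have if_ := @integrable_bounded _ _ _ P _ _ mf fK.
apply: le_trans (le_normr_Rintegral measurableT if_) _.
rewrite -[leRHS](Rintegral_cst_prob P); apply: le_Rintegral => //.
- exact: integrable_norm.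
- exact: (finite_measure_integrable_cst P _ measurableT).
Qed.

Lemma rlin_Rintegral d (T : measurableType d) (R : realType) (mu : {measure set T -> \bar R})
  (D : set T) m (X : T -> 'M[R[i]]_m) phi : measurable D -> rlin phi ->
  (forall j k, mu.-integrable D (EFin \o (fun z => re (X z j k))) /\
               mu.-integrable D (EFin \o (fun z => im (X z j k)))) ->
  phi (mx_lift (fun g => \int[mu]_(z in D) g z) X) = \int[mu]_(z in D) phi (X z).
Proof.
move=> mD /rlin_coord[a [b e]] hX.
pose f j k z := a j k * re (X z j k) + b j k * im (X z j k).
have i1 j k : mu.-integrable D (EFin \o (fun z => a j k * re (X z j k))).
  exact: (integrableZl mD (a j k) (hX j k).1).
have i2 j k : mu.-integrable D (EFin \o (fun z => b j k * im (X z j k))).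
  exact: (integrableZl mD (b j k) (hX j k).2).
have i3 j k : mu.-integrable D (EFin \o f j k) by exact: (integrableD mD (i1 j k) (i2 j k)).
have s1 j := Rintegral_sum (index_enum 'I_m) mD (i3 j).
have s2 := Rintegral_sum (index_enum 'I_m) mD (fun j => (s1 j).1).
transitivity (\int[mu]_(z in D) \sum_j \sum_k f j k z); last by apply: eq_Rintegral => z _; rewrite e.
rewrite [RHS]s2.2 e; apply: eq_bigr => j _; rewrite [RHS](s1 j).2; apply: eq_bigr => k _.
rewrite !mxE /= /f RintegralD //.
have [h1 h2] := hX j k; congr (_ + _); exact/esym/RintegralZl.
Qed.

Lemma integrable_itv_bounded (R : realType) (f : measurableTypeR R -> R) (a b K : R) :
  measurable_fun setT f -> (forall u, `|f u| <= K) ->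
  (@lebesgue_measure R).-integrable `]a, b] (EFin \o f).
Proof.
move=> mf fK; apply: measurable_bounded_integrable.
- exact: measurable_itv.
- have h : (lebesgue_measure (`]a, b] : set R) < +oo)%E.
    by rewrite lebesgue_measure_itv /=; case: ifP => _; rewrite -?EFinB ltry.
  exact: h.
- exact: measurable_funTS.
- exists K; split; first exact: num_real.
  by move=> x Kx u _; exact: le_trans (fK u) (ltW Kx).
Qed.

Section master_equation.
Context d (Omega : measurableType d) (R : realType) (P : probability Omega R).
Variables (m n p : nat) (H : 'M[R[i]]_m) (C : 'I_n.+1 -> 'M[R[i]]_m).
Notation RR := (measurableTypeR R * measurableTypeR R)%type.
Notation lam := (@lebesgue_measure R).
Notation TR := (measurableTypeR R).
Variables (F : R -> set_system Omega) (W : 'I_n.+1 -> R -> Omega -> R)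
  (N : 'I_n.+1 -> Omega -> {measure set RR -> \bar R}).
Hypotheses (hnoise : driving_noises P p W N) (hF : usual_conditions P F)
  (hFnat : forall t : R, 0 <= t -> F t = natural_filtration P p W N t).

Lemma filtration_sigma t : 0 <= t -> sigma_algebra setT (F t).
Proof. by move=> t0; case: hF => _ /(_ t t0)[]. Qed.

Lemma filtration_measurable t : 0 <= t -> F t `<=` measurable.
Proof. by move=> t0; case: hF => _ /(_ t t0)[]. Qed.

Lemma filtration_mono s t : 0 <= s <= t -> F s `<=` F t.
Proof. by case: hF => _ _ h _ _; exact: h. Qed.

Let cP : measure_is_complete P. Proof. by case: hF. Qed.

Lemma noise_wiener_wrt (i : 'I_n.+1) : (i <= p)%N -> wiener_wrt P F (W i).
Proof.
move=> ip; case: (hnoise) => /(_ i ip) hW _ _; split.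
- by move=> t t0; split; [exact: filtration_sigma|exact: filtration_measurable].
- exact: filtration_mono.
- move=> t t0 B mB; rewrite hFnat //; apply: sub_sigma_algebra; left; exists i => //.
  by rewrite /noise_events ip; exists t, B; split=> //=; rewrite in_itv /= t0 lexx.
- by case: hW => _ _ _ h _; exact: h.
- move=> s t A B st FA mB; apply: (wiener_indep_past cP hnoise ip st mB).
  by rewrite -hFnat //; case/andP: st.
Qed.

Lemma noise_poisson_indep (i : 'I_n.+1) : (p < i)%N ->
  forall a V D, 0 <= a -> measurable V -> V `<=` strip `]a, +oo[ ->
  preimage_set_system setT (fun w => N i w V) measurable D ->
  forall A, F a A -> P (A `&` D) = (P A * P D)%E.
Proof.
move=> ip a V D a0 mV sV hD A FA.
by apply: (poisson_indep_past_all cP hnoise ip a0 mV sV hD); rewrite -hFnat.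
Qed.

Variables (rho0 : 'M[R[i]]_m) (rho : R -> Omega -> 'M[R[i]]_m).
Hypothesis sol : sme_solution P p H C W N F rho0 rho.

Let st t w : 0 <= t -> states (rho t w). Proof. by case: sol => h _ _ _; exact: h. Qed.
Let cad w : mx_all (@cadlag R) (rho ^~ w). Proof. by case: sol. Qed.
Let ad t : 0 <= t -> mx_all (measurable_wrt (F t)) (rho t).
Proof. by case: sol => _ _ h _; exact: h. Qed.
Let sF := filtration_sigma.
Let Fm := filtration_measurable.

Lemma measurable_drift phi : rlin phi ->
  measurable_fun setT (fun z : Omega * TR => phi (left_state rho z.1 z.2)).
Proof.
move=> hp; have /(pred_measurable_fun Fm) mg := pred_left_state cad ad hp.
have mz : measurable_fun setT (fun z : Omega * TR => (z.1, (0 : TR, z.2)) : Omega * RR).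
  by apply: measurable_fun_pair => //; apply: measurable_fun_pair.
exact: (measurableT_comp mg mz).
Qed.

Lemma drift_bound phi : rlin phi -> exists K, 0 <= K /\
  forall u w, `|phi (left_state rho w u)| <= K.
Proof.
move=> hp; have [K [K0 hK]] := rlin_state_bound hp; exists K; split=> // u w.
case: (ltP 0 u) => u0; first by apply/hK/left_state_states.
by rewrite /left_state ltNge u0 /= rlin0 // normr0.
Qed.

Lemma adapted_measurable phi t : 0 <= t -> rlin phi -> measurable_fun setT (fun w => phi (rho t w)).
Proof.
move=> t0 hp; apply: (measurable_wrt_fun (Fm t0)).
exact (rlin_adapted sF ad t0 hp).
Qed.

Lemma jump_martingale (i : 'I_n.+1) phi : (p < i)%N -> rlin phi ->
  martingale P F (compensated (N i)
    (fun z => phi (jump_integrand (C i) (left_state rho z.1 z.2.2) z.2.1))).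
Proof.
move=> ip hp; have [K [K0 hK]] := jump_integrand_bound (C i) hp.
have [c [c0 hc]] := jump_integrand_support st cad (C i).
have hN : poisson_point_process P (N i) by case: hnoise => _ /(_ i ip).
move=> s t A sta FA.
apply: (@compensated_martingale _ _ _ F sF Fm filtration_mono P (N i) hN
  (noise_poisson_indep ip) _ K c) => //.
- exact (pred_jump_integrand sF st cad ad (C i) hp).
- move=> [w [x u]] /=; case: (ltP 0 u) => u0; first by apply/hK/left_state_states.
  rewrite /left_state ltNge u0 /= /jump_integrand /jump mulmx0 mul0mx mxtrace0 /=.
  by rewrite lt_asym rlin0 // normr0.
- by move=> w x u u0 /= h; apply: hc h.
Qed.

Lemma jump_martingale_mx (i : 'I_n.+1) phi : (p < i)%N -> rlin phi ->
  martingale P F (fun t w => phi (compensated_integral N i t w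
    (fun z => jump_integrand (C i) (left_limit (rho ^~ w) z.2) z.1))).
Proof.
move=> ip hp; apply: (martingale_rlin Fm hp) => j k; split.
- have := jump_martingale ip (@rlin_re R m j k); congr (martingale _ _ _).
  apply/funext => t; apply/funext => w; rewrite /compensated_integral !mxE reD reN /=.
  by apply: (congr2 (fun a b : R => a - b)); apply: eq_Rintegral => -[x u]; rewrite inE => -[_ /=];
    rewrite in_itv /= => /andP[u0 _]; rewrite /left_state u0.
- have := jump_martingale ip (@rlin_im R m j k); congr (martingale _ _ _).
  apply/funext => t; apply/funext => w; rewrite /compensated_integral !mxE imD imN /=.
  by apply: (congr2 (fun a b : R => a - b)); apply: eq_Rintegral => -[x u]; rewrite inE => -[_ /=];
    rewrite in_itv /= => /andP[u0 _]; rewrite /left_state u0.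
Qed.

Lemma drift_section phi w : rlin phi ->
  measurable_fun setT (fun u : TR => phi (left_state rho w u)).
Proof.
move=> hp; have mh := measurable_drift hp.
by have := @measurable_section _ Omega R setT (fun u w => phi (left_state rho w u)) w measurableT;
  rewrite setXTT; exact.
Qed.

Lemma drift_integrable phi w s t : rlin phi ->
  lam.-integrable `]s, t] (EFin \o (fun u => phi (left_state rho w u))).
Proof.
move=> hp; have [K [K0 hK]] := drift_bound hp.
by apply: (@integrable_itv_bounded _ _ _ _ K) => //; exact: drift_section.
Qed.

(** Dynkin's formula for linear observables. By linearity phi passes through all the integrals; the
    Wiener and jump parts, with the constant phi(rho0), form a martingale, and the drift alone
    remains. *)
Lemma sme_increment phi s t A : rlin phi -> 0 <= s <= t -> F s A ->
  \int[P]_w (\1_A w * phi (rho t w)) - \int[P]_w (\1_A w * phi (rho s w)) =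
  \int[P]_w (\1_A w * \int[lam]_(u in `]s, t]) phi (lindblad H C (left_state rho w u))).
Proof.
move=> hp sta FA; have /andP[s0 st'] := sta.
case: (sol) => _ _ _ [M [hM hE]].
have hpL : rlin (phi \o lindblad H C) := rlin_comp (lindblad H C) hp.
pose D t w := \int[lam]_(u in `]0, t]) phi (lindblad H C (left_state rho w u)).
have DE u w : phi (mx_lift (fun g => \int[lam]_(s in `]0, u]) g s)
    (fun s => lindblad H C (left_limit (rho ^~ w) s))) = D u w.
  transitivity (phi (mx_lift (fun g : TR -> R => \int[lam]_(s in `]0, u]) g s)
      (fun v => lindblad H C (left_state rho w v)))).
    apply: (congr1 phi); apply/matrixP => j k. rewrite [LHS]mxE [RHS]mxE.
    apply: complex_eqP => /=.
    by apply: eq_Rintegral => v; rewrite inE /= in_itv /= => /andP[v0 _]; rewrite /left_state v0.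
    by apply: eq_Rintegral => v; rewrite inE /= in_itv /= => /andP[v0 _]; rewrite /left_state v0.
  rewrite (@rlin_Rintegral _ TR R lam `]0, u]%classic m (fun v => lindblad H C (left_state rho w v))) //.
  move=> j k; split.
    exact (drift_integrable w 0 u (rlin_comp (lindblad H C) (@rlin_re R m j k))).
  exact (drift_integrable w 0 u (rlin_comp (lindblad H C) (@rlin_im R m j k))).
have DD w : D t w - D s w = \int[lam]_(u in `]s, t]) phi (lindblad H C (left_state rho w u)).
  rewrite /D (@itv_bndbnd_setU _ _ _ (BRight s)) ?bnd_simp //.
  rewrite Rintegral_setU //; first by rewrite addrC addKr.
  - by rewrite -itv_bndbnd_setU ?bnd_simp //; exact (drift_integrable w 0 t hpL).
  - apply/disj_setPS => v [/=]; rewrite !in_itv /= => /andP[_ vs] /andP[sv _].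
    by have := lt_le_trans sv vs; rewrite ltxx.
pose X t w := phi rho0 + (\sum_(i < n.+1 | (i <= p)%N) phi (M i t w) +
  \sum_(i < n.+1 | (p < i)%N) phi (compensated_integral N i t w
                (fun z => jump_integrand (C i) (left_limit (rho ^~ w) z.2) z.1))).
have hX : martingale P F X.
  have h1 (i : 'I_n.+1) : (i <= p)%N -> martingale P F (fun t w => phi (M i t w)).
    move=> ip; apply: (@martingale_rlin _ _ _ P F Fm m (M i)) => // j k; split=> a b B sb FB.
      have /andP[a0 ab] := sb; have b0 := le_trans a0 ab.
      exact (ito_martingale (noise_wiener_wrt ip) sb FB (hM i b j k ip b0).1 (hM i a j k ip a0).1).
    have /andP[a0 ab] := sb; have b0 := le_trans a0 ab.
    exact (ito_martingale (noise_wiener_wrt ip) sb FB (hM i b j k ip b0).2 (hM i a j k ip a0).2).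
  have h2 (i : 'I_n.+1) (ip : (p < i)%N) := jump_martingale_mx ip hp.
  have k1 := martingale_sum Fm (index_enum _) h1.
  have k2 := martingale_sum Fm (index_enum _) h2.
  exact (martingale_add Fm (@martingale_cst _ _ _ P F (phi rho0)) (martingale_add Fm k1 k2)).
rewrite (semimartingale_increment Fm hX (Z := fun t w => phi (rho t w)) (D := D)) //.
- by apply: eq_Rintegral => w _; rewrite DD.
- by move=> u u0; exact: adapted_measurable.
- move=> u u0; have [K [K0 hK]] := drift_bound hpL.
  have [|iD _] := @time_average_estimate _ _ _ P (fun u w => phi (lindblad H C (left_state rho w u)))
    K (measurable_drift hpL) hK setT 0 u 0 K measurableT u0; last exact: iD.
  move=> v _; rewrite subr0; under eq_Rintegral do rewrite indicT mul1r.
  apply: Rintegral_prob_bound => [|w]; last exact: hK.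
  exact (measurableT_comp (measurable_drift hpL) (pair2_measurable v)).
- move=> u u0; apply: filterS (hE u u0) => w ->.
  rewrite hp.1 hp.1 hp.1 DE !rlin_sum // /X; ring.
Qed.

End master_equation.

Section euler.
Context d (Omega : measurableType d) (R : realType) (P : probability Omega R).
Variables (m n p : nat) (H : 'M[R[i]]_m) (C : 'I_n.+1 -> 'M[R[i]]_m).
Notation RR := (measurableTypeR R * measurableTypeR R)%type.
Notation lam := (@lebesgue_measure R).
Notation TR := (measurableTypeR R).
Variables (F : R -> set_system Omega) (W : 'I_n.+1 -> R -> Omega -> R)
  (N : 'I_n.+1 -> Omega -> {measure set RR -> \bar R}).
Hypotheses (hnoise : driving_noises P p W N) (hF : usual_conditions P F)
  (hFnat : forall t : R, 0 <= t -> F t = natural_filtration P p W N t).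
Variables (rho0 : 'M[R[i]]_m) (rho : R -> Omega -> 'M[R[i]]_m).
Hypothesis sol : sme_solution P p H C W N F rho0 rho.

Let st t w : 0 <= t -> states (rho t w). Proof. by case: sol => h _ _ _; exact: h. Qed.
Let cad w : mx_all (@cadlag R) (rho ^~ w). Proof. by case: sol. Qed.
Let L : {linear 'M[R[i]]_m -> 'M[R[i]]_m} := lindblad H C.
Let mr := adapted_measurable hF sol.

Let indic_le (A : set Omega) w : `|\1_A w : R| <= 1.
Proof. by rewrite indicE; case: (_ \in _); rewrite ?normr1 ?normr0. Qed.

Let bound_left phi K u w : rlin phi -> 0 <= K -> (forall r, states r -> `|phi r| <= K) ->
  `|phi (left_state rho w u)| <= K.
Proof.
move=> hp K0 hK; case: (ltP 0 u) => u0; first by apply/hK/left_state_states.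
by rewrite /left_state ltNge u0 /= rlin0 // normr0.
Qed.

Lemma sme_lipschitz phi K s t A : rlin phi -> 0 <= K ->
  (forall r, states r -> `|phi (lindblad H C r)| <= K) -> 0 <= s <= t -> F s A ->
  `|\int[P]_w (\1_A w * phi (rho t w)) - \int[P]_w (\1_A w * phi (rho s w))| <= K * (t - s).
Proof.
move=> hp K0 hK sta FA; have /andP[s0 st'] := sta.
have hpL : rlin (phi \o L) := rlin_comp L hp.
have mA : measurable A by exact: (filtration_measurable hF s0).
have mL := measurable_drift hF sol hpL.
rewrite (sme_increment hnoise hF hFnat sol hp sta FA).
have hb u w : `|phi (lindblad H C (left_state rho w u))| <= K by exact: (bound_left u w hpL K0 hK).
have [|_] := @time_average_estimate _ _ _ P (fun u w => phi (lindblad H C (left_state rho w u)))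
    K mL hb A s t 0 K mA st'; last by rewrite mulr0 subr0.
move=> u _; rewrite subr0; apply: Rintegral_prob_bound => [|w].
  apply: measurable_funM; first exact: measurable_indic.
  exact (measurableT_comp mL (pair2_measurable u)).
by rewrite normrM -[K]mul1r ler_pM.
Qed.

(** At a time u in ]s, t], the mean drift differs from that at s by at most K (t - s), by
    [sme_lipschitz] applied to phi o L; integrating over ]s, t] adds the second factor t - s. *)
Lemma sme_euler phi K1 K s t A : rlin phi -> 0 <= K1 -> 0 <= K ->
  (forall r, states r -> `|phi (lindblad H C r)| <= K1) ->
  (forall r, states r -> `|phi (lindblad H C (lindblad H C r))| <= K) -> 0 <= s <= t -> F s A ->
  `|\int[P]_w (\1_A w * phi (rho t w)) - \int[P]_w (\1_A w * phi (rho s w))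
    - (t - s) * \int[P]_w (\1_A w * phi (lindblad H C (rho s w)))| <= K * (t - s) ^+ 2.
Proof.
move=> hp K10 K0 hK1 hK sta FA; have /andP[s0 st'] := sta.
have hpL : rlin (phi \o L) := rlin_comp L hp.
have mA : measurable A by exact: (filtration_measurable hF s0).
have mL := measurable_drift hF sol hpL.
rewrite (sme_increment hnoise hF hFnat sol hp sta FA).
have hb u w : `|phi (lindblad H C (left_state rho w u))| <= K1.
  exact: (bound_left u w hpL K10 hK1).
pose c := \int[P]_w (\1_A w * phi (lindblad H C (rho s w))).
have [|_] := @time_average_estimate _ _ _ P (fun u w => phi (lindblad H C (left_state rho w u)))
    K1 mL hb A s t c (K * (t - s)) mA st'; last by rewrite -mulrA -expr2.
move=> u /andP[su ut].
(* The drift is evaluated at left limits, while the Lipschitz estimate concerns values. Times v l in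
   [s, u[ that tend to u carry it over by dominated convergence. *)
pose v (l : nat) := u - (u - s) * l.+1%:R^-1.
have vu l : v l < u by rewrite /v gtrBl mulr_gt0 ?invr_gt0 ?subr_gt0.
have sv l : s <= v l.
  by rewrite /v lerBrDl -lerBrDr ler_piMr ?subr_ge0 ?(ltW su) // invf_le1 ?ltr0n // ler1n.
have cv : v l @[l --> \oo] --> u.
  rewrite -[X in _ --> X]subr0 -[X in _ - X](mulr0 (u - s)).
  by apply: cvgB; [exact: cvg_cst|apply: cvgM; [exact: cvg_cst|exact: cvg_harmonic]].
have u0 := le_lt_trans s0 su.
have v0 l := le_trans s0 (sv l).
have normI w x : `|x| <= K1 -> `|\1_A w * x| <= K1.
  by move=> hx; rewrite normrM -[K1]mul1r ler_pM.
have [|w|||_ hlim] := @Rintegral_cvg _ _ R P (fun l w => \1_A w * phi (lindblad H C (rho (v l) w)))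
  (fun w => \1_A w * phi (lindblad H C (left_state rho w u))) (fun=> K1).
- move=> l; apply: measurable_funM; first exact: measurable_indic.
  exact: (mr (v0 l) hpL).
- apply: cvgM; first exact: cvg_cst.
  have /cvg_at_leftP := cvg_left_state cad (w := w) u0 hpL.
  by move=> /(_ v); apply.
- exact: (finite_measure_integrable_cst P _ measurableT).
- by move=> l w; apply: normI; apply: hK1; exact: st.
have cc : c @[_ --> \oo] --> c by exact: cvg_cst.
have hc := cvg_norm (cvgB hlim cc).
apply: (cvgr_to_le (hc _ _)).
apply: nearW => l; have sv' : 0 <= s <= v l by rewrite s0 sv.
apply: le_trans (sme_lipschitz hpL K0 hK sv' FA) _.
by rewrite ler_wpM2l // lerD2r (le_trans (ltW (vu l))).
Qed.

End euler.

(** * Convergence of nonnegative supermartingales *)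

Section maximal_inequality.
Context d (Omega : measurableType d) (R : realType) (P : probability Omega R).

Section discrete.
Variables (G : nat -> set_system Omega) (Y : nat -> Omega -> R) (M : R).
Hypotheses (sG : forall k, sigma_algebra setT (G k)) (Gm : forall k, G k `<=` measurable)
  (Gmono : forall k, G k `<=` G k.+1) (aY : forall k, measurable_wrt (G k) (Y k))
  (Y0 : forall k w, 0 <= Y k w) (YM : forall k w, Y k w <= M)
  (super : forall k B, G k B ->
    \int[P]_w (\1_B w * Y k.+1 w) <= \int[P]_w (\1_B w * Y k w)).
Variable e : R.

Definition stay_below (k : nat) : set Omega := [set w | forall j, (j <= k)%N -> Y j w < e].

Let stayS k : stay_below k.+1 = stay_below k `&` (Y k.+1 @^-1` `]-oo, e[%classic).
Proof.
apply/seteqP; split=> w /=.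
  by move=> h; split=> [j jk|]; [apply: h; exact: leqW|rewrite in_itv /=; exact: h].
move=> [h]; rewrite in_itv /= => h' j; rewrite leq_eqVlt => /orP[/eqP -> //|jk].
exact: h.
Qed.

Lemma stay_below_mem k : G k (stay_below k).
Proof.
elim: k => [|k IH].
  have -> : stay_below 0 = Y 0 @^-1` `]-oo, e[%classic.
    apply/seteqP; split=> w /=; rewrite in_itv /= => h; first exact: h.
    by move=> j; rewrite leqn0 => /eqP ->.
  by apply: aY; exact: measurable_itv.
rewrite stayS -(sigma_algebra_id (sG k.+1)).
apply: g_sigma_setI; rewrite (sigma_algebra_id (sG k.+1)); first exact: Gmono.
by apply: aY; exact: measurable_itv.
Qed.

Let mY k : measurable_fun setT (Y k).
Proof. exact: (measurable_wrt_fun (@Gm k) (aY k)). Qed.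

Let iY k B : measurable B -> P.-integrable setT (EFin \o (fun w => \1_B w * Y k w)).
Proof.
move=> mB; apply: integrable_indicM => //.
by apply: (@integrable_bounded _ _ R P _ M) => // w; rewrite ger0_norm.
Qed.

Let ic B : measurable B -> P.-integrable setT (EFin \o (fun w => e * (1 - \1_B w))).
Proof.
move=> mB; apply: (@integrable_bounded _ _ R P _ `|e|).
  apply: measurable_funM => //; apply: measurable_funB => //; exact: measurable_indic.
move=> w; rewrite normrM indicE; case: (w \in B) => /=.
  by rewrite subrr normr0 mulr0.
by rewrite subr0 normr1 mulr1.
Qed.

(* The means [V j] of [Y] stopped at its first passage above [e] decrease. *)
Lemma discrete_maximal k :
  \int[P]_w (e * (1 - \1_(stay_below k) w)) <= \int[P]_w Y 0 w.
Proof.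
pose V j := \int[P]_w (e * (1 - \1_(stay_below j) w) + \1_(stay_below j) w * Y j w).
have mS j : measurable (stay_below j) by apply/Gm/stay_below_mem.
have V0 : V 0 <= \int[P]_w Y 0 w.
  apply: le_Rintegral => //.
  - exact: (integrableD measurableT (ic (mS 0)) (iY 0 (mS 0))).
  - have := iY 0 measurableT; congr (integrable _ _ _); apply/funext => w /=.
    by rewrite indicT mul1r.
  - move=> w _; rewrite indicE; case: (boolP (w \in _)) => [_|].
      by rewrite subrr mulr0 add0r mul1r.
    rewrite notin_setE => /existsNP[j /not_implyP[]]; rewrite leqn0 => /eqP -> /negP.
    by rewrite -leNgt subr0 mulr1 mul0r addr0.
have VS j : V j.+1 <= V j.
  apply: (@le_trans _ _ (\int[P]_w (e * (1 - \1_(stay_below j) w) + \1_(stay_below j) w * Y j.+1 w))).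
    apply: le_Rintegral => //.
    - exact: (integrableD measurableT (ic (mS j.+1)) (iY j.+1 (mS j.+1))).
    - exact: (integrableD measurableT (ic (mS j)) (iY j.+1 (mS j))).
    - move=> w _; rewrite stayS !indicE in_setI.
      case: (boolP (w \in stay_below j)) => //= _.
      case: (boolP (w \in _)) => /= [|]; first by rewrite !lexx.
      rewrite notin_setE /= in_itv /= => /negP; rewrite -leNgt => h.
      by rewrite subr0 mulr1 mul0r addr0 subrr mulr0 add0r mul1r.
  rewrite /V RintegralD //; [|exact: ic|exact: iY].
  rewrite RintegralD //; [|exact: ic|exact: iY].
  by rewrite lerD2l; apply: super; exact: stay_below_mem.
have Vk : V k <= V 0 by elim: k => // k; apply: le_trans; exact: VS.
apply: le_trans (le_trans Vk V0); apply: le_Rintegral => //.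
- exact: ic.
- exact: (integrableD measurableT (ic (mS k)) (iY k (mS k))).
- by move=> w _; rewrite lerDl mulr_ge0.
Qed.

Lemma discrete_maximal_prob k : 0 < e ->
  (P (~` stay_below k) <= (e^-1 * \int[P]_w Y 0 w)%:E)%E.
Proof.
move=> e0; have := discrete_maximal k.
have mS : measurable (stay_below k) by apply/Gm/stay_below_mem.
have -> : \int[P]_w (e * (1 - \1_(stay_below k) w)) = e * fine (P (~` stay_below k)).
  transitivity (\int[P]_w (e * \1_(~` stay_below k) w)).
    apply: eq_Rintegral => w _; congr (_ * _); rewrite !indicE in_setC.
    by case: (_ \in _); rewrite ?subrr ?subr0.
  rewrite RintegralZl //; last first.
    have := integrable_indicM (measurableC mS) (finite_measure_integrable_cst P 1 measurableT).
    by congr (integrable _ _ _); apply/funext => w /=; rewrite mulr1.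
  congr (_ * _); rewrite /Rintegral integral_indic //; last exact: measurableC.
  by rewrite setIT.
rewrite -ler_pdivlMl // => h.
rewrite -[P _]fineK ?lee_fin //; apply: fin_num_measure; exact: measurableC.
Qed.

End discrete.

Variable F : R -> set_system Omega.
Hypotheses (sF : forall t, 0 <= t -> sigma_algebra setT (F t))
  (Fm : forall t, 0 <= t -> F t `<=` measurable)
  (Fmono : forall s t, 0 <= s <= t -> F s `<=` F t).
Variables (Y : R -> Omega -> R) (M : R).
Hypotheses (aY : forall t, 0 <= t -> measurable_wrt (F t) (Y t))
  (Y0 : forall t w, 0 <= t -> 0 <= Y t w) (YM : forall t w, 0 <= t -> Y t w <= M)
  (super : forall s t B, 0 <= s <= t -> F s B ->
    \int[P]_w (\1_B w * Y t w) <= \int[P]_w (\1_B w * Y s w))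
  (rY : forall t w, 0 <= t -> Y s w @[s --> t^'+] --> Y t w).

Let grid (T : R) (l j : nat) := T + j%:R / 2 ^+ l.

(* The dyadic grids are nested and their range grows with [l], so these events increase. *)
Definition above (e T : R) (l : nat) : set Omega :=
  [set w | exists j, (j <= l * 2 ^ l)%N /\ e <= Y (grid T l j) w].

Let grid_ge0 T l j : 0 <= T -> 0 <= grid T l j.
Proof. by move=> T0; rewrite addr_ge0 // divr_ge0 // exprn_ge0. Qed.

Let aboveE e T l : above e T l = ~` stay_below (fun j => Y (grid T l j)) e (l * 2 ^ l).
Proof.
apply/seteqP; split=> w /=.
  by move=> [j [jl ej]] /(_ j jl); rewrite ltNge ej.
by move=> /existsNP[j /not_implyP[jl /negP]]; rewrite -leNgt => ej; exists j.
Qed.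

Lemma above_measurable_prob e T l : 0 < e -> 0 <= T ->
  measurable (above e T l) /\ (P (above e T l) <= (e^-1 * \int[P]_w Y T w)%:E)%E.
Proof.
move=> e0 T0; have g0 j := grid_ge0 l j T0; rewrite aboveE.
have gmono j : 0 <= grid T l j <= grid T l j.+1.
  by rewrite g0 lerD2l ler_pM2r ?invr_gt0 ?exprn_gt0 // ler_nat leqnSn.
have GS j : F (grid T l j) `<=` F (grid T l j.+1) by exact: Fmono.
have aG j : measurable_wrt (F (grid T l j)) (Y (grid T l j)) by exact: aY.
split.
  apply/measurableC/(Fm (g0 (l * 2 ^ l)%N)).
  by apply: (stay_below_mem (G := fun j => F (grid T l j))) => // j; exact: sF.
have -> : \int[P]_w Y T w = \int[P]_w Y (grid T l 0) w.
  by rewrite /grid mul0r addr0.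
apply: (@discrete_maximal_prob (fun j => F (grid T l j)) (fun j => Y (grid T l j)) M) => //.
- by move=> j; exact: sF.
- by move=> j; exact: Fm.
- by move=> j w; exact: Y0.
- by move=> j w; exact: YM.
- by move=> j B FB; exact: super.
Qed.

Lemma above_bigcup_prob e T : 0 < e -> 0 <= T ->
  measurable (\bigcup_l above e T l) /\
  (P (\bigcup_l above e T l) <= (e^-1 * \int[P]_w Y T w)%:E)%E.
Proof.
move=> e0 T0; have mA l := (above_measurable_prob l e0 T0).1.
have mU : measurable (\bigcup_l above e T l) by exact: bigcup_measurable.
split=> //.
have cvgP := @nondecreasing_cvg_mu _ _ R P (above e T) mA mU.
have ndA : nondecreasing_seq (above e T).
  apply/nondecreasing_seqP => l; apply/subsetPset => w [j [jl ej]].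
  (* Point j of grid l is point 2 j of grid l + 1, and still within its range. *)
  exists (2 * j)%N; split.
    by rewrite expnS mulnCA leq_mul2l /= (leq_trans jl) // leq_mul2r leqnSn orbT.
  move: ej; rewrite /grid natrM exprS invfM mulrACA divff ?mul1r //.
apply: (cvge_to_le (cvgP ndA)).
by apply: nearW => l; exact: (above_measurable_prob l e0 T0).2.
Qed.

(** By right continuity Y still exceeds e at dyadic points shortly after t, so countably many times
    detect every passage above e. *)
Lemma above_cover e T t w : 0 <= T -> T < t -> e < Y t w -> (\bigcup_l above e T l) w.
Proof.
move=> T0 Tt eY; have t0 : 0 <= t by rewrite (le_trans T0) // ltW.
(* The first point of the grid strictly after t. *)
pose j (l : nat) := (Num.truncn ((t - T) * 2 ^+ l)).+1.
have p0 l : 0 < 2 ^+ l :> R by rewrite exprn_gt0.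
have jE l : (j l)%:R - 1 <= (t - T) * 2 ^+ l < (j l)%:R.
  have /truncn_itv : 0 <= (t - T) * 2 ^+ l by rewrite mulr_ge0 ?subr_ge0 ?ltW.
  by rewrite /j => /andP[h1 h2]; rewrite h2 andbT -natr1 addrK.
have gt_ l : t < grid T l (j l).
  have /andP[_ h] := jE l.
  by rewrite /grid -ltrBlDl ltr_pdivlMr.
have gle l : grid T l (j l) <= t + (2 ^+ l)^-1.
  have /andP[h _] := jE l.
  rewrite /grid -lerBrDl ler_pdivrMr //.
  have -> : (t + (2 ^+ l)^-1 - T) * 2 ^+ l = (t - T) * 2 ^+ l + 1.
    by rewrite addrAC mulrDl mulVf // gt_eqF.
  by rewrite -lerBlDr.
have ct : grid T l (j l) @[l --> \oo] --> t.
  apply: (@squeeze_cvgr _ _ _ _ (fun=> t) (fun l => t + (2 ^+ l)^-1)).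
  - by apply: nearW => l; rewrite gle (ltW (gt_ l)).
  - exact: cvg_cst.
  - rewrite -[X in _ --> X]addr0; apply: cvgD; first exact: cvg_cst.
    have -> : (fun l => (2 ^+ l)^-1) = GRing.exp (2^-1 : R).
      by apply/funext => l; rewrite exprVn.
    by apply: cvg_expr; rewrite ger0_norm ?invr_ge0 // invf_lt1 // ltr1n.
have cY : Y (grid T l (j l)) w @[l --> \oo] --> Y t w.
  by move/cvg_at_rightP: (@rY t w t0) => /(_ (fun l => grid T l (j l))); apply.
have n1 := cvgr_gt _ cY _ eY.
(* For such l the index j l <= (t - T) 2^l + 1 is at most l 2^l, inside the range of the grid. *)
have n2 : \forall l \near \oo, t - T + 1 <= l%:R by exact: nbhs_infty_ger.
have [l [l1 l2]] := filter_ex (filterI (n1 _) n2).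
exists l => //; exists (j l); split; last exact: ltW.
rewrite -(ler_nat R) natrM natrX; have /andP[h _] := jE l.
rewrite -[leLHS](subrK 1) (le_trans (lerD h (_ : 1 <= 2 ^+ l))) ?exprn_ege1 ?ler1n //.
by rewrite -[X in _ + X]mul1r -mulrDl ler_pM2r.
Qed.

Hypothesis Ylim : \int[P]_w Y t w @[t --> +oo] --> 0.

(** The probability of exceeding e at some time after T is at most E[Y T] / e, which tends to 0 as T
    grows. Exceeding e at arbitrarily late times is therefore negligible, and countably many e
    suffice. *)
Lemma supermartingale_cvg0 : {ae P, forall w, Y t w @[t --> +oo] --> 0}.
Proof.
have small e : 0 < e -> {ae P, forall w, exists T : nat, ~ (\bigcup_l above e T%:R l) w}.
  move=> e0; exists (\bigcap_T \bigcup_l above e T%:R l); split.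
  - apply: bigcapT_measurable => T; exact: (above_bigcup_prob e0 (ler0n _ T)).1.
  - apply/eqP; rewrite eq_le measure_ge0 andbT.
    have hc : e^-1 * \int[P]_w Y T%:R w @[T --> \oo] --> e^-1 * 0.
      apply: cvgM; first exact: cvg_cst.
      by move/cvg_pinftyP: Ylim; apply; exact: cvgr_idn.
    rewrite mulr0 in hc.
    have hcE : (e^-1 * \int[P]_w Y T%:R w)%:E @[T --> \oo] --> 0%E.
      by apply/fine_cvgP; split; [exact: nearW|exact: hc].
    apply: (cvge_to_ge hcE); apply: nearW => T.
    have [mU PU] := above_bigcup_prob e0 (ler0n R T).
    apply: le_trans PU; apply: le_measure; rewrite ?inE //.
      by apply: bigcapT_measurable => T'; exact: (above_bigcup_prob e0 (ler0n _ T')).1.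
    by move=> w; apply.
  - by move=> w /= h T _; apply: contrapT => h'; apply: h; exists T.
have : {ae P, forall w, forall k : nat, exists T : nat, ~ (\bigcup_l above k.+1%:R^-1 T%:R l) w}.
  by apply: ae_foralln => k; apply: small; rewrite invr_gt0.
apply: filterS => w h; apply/cvgrPdist_le => e e0.
have [k ke] : exists k : nat, k.+1%:R^-1 <= e.
  by exists (Num.truncn e^-1); rewrite invf_ple ?posrE // ltW // truncnS_gt.
have [T hT] := h k; near=> t.
have Tt : T%:R < t by near: t; exact: nbhs_pinfty_gt.
have t0 : 0 <= t by rewrite (le_trans _ (ltW Tt)).
rewrite sub0r normrN ger0_norm; last exact: Y0.
rewrite (le_trans _ ke) // leNgt; apply/negP => hY; apply: hT.
exact: above_cover Tt hY.
Unshelve. all: by end_near. Qed.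

End maximal_inequality.

(** * Means of solutions and stability *)

Section mean_states.
Context d (Omega : measurableType d) (R : realType) (P : probability Omega R) (m : nat).
Variable X : Omega -> 'M[R[i]]_m.
Hypotheses (sX : forall w, states (X w))
  (mX : forall phi, rlin phi -> measurable_fun setT (phi \o X)).

Lemma rlin_state_integrable phi : rlin phi -> P.-integrable setT (EFin \o (phi \o X)).
Proof.
move=> hp; have [K [_ hK]] := rlin_state_bound hp.
by apply: (@integrable_bounded _ _ R P _ K) => [|w]; [exact: mX|exact: hK].
Qed.

Lemma rlin_mean_state phi : rlin phi -> phi (mean_state P X) = \int[P]_w phi (X w).
Proof.
move=> hp; rewrite -(@rlin_Rintegral _ _ R P setT m X phi measurableT hp); last first.
  move=> j k; split; first exact: (rlin_state_integrable (@rlin_re R m j k)).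
  exact: (rlin_state_integrable (@rlin_im R m j k)).
apply: (congr1 phi); apply/matrixP => j k; rewrite !mxE /=.
by apply: complex_eqP => /=; rewrite unlock.
Qed.

(** Through the dual description: functionals that are nonnegative on states stay nonnegative after
    averaging. *)
Lemma states_mean_state : states (mean_state P X).
Proof.
apply: states_dual => [phi hp p0|].
  by rewrite rlin_mean_state //; apply: Rintegral_ge0 => w _; exact: p0.
rewrite (rlin_mean_state (rlin_trace R m).1).
transitivity (\int[P]_w (1 : R)); last exact: Rintegral_cst_prob.
by apply: eq_Rintegral => w _; have [_ ->] := sX w.
Qed.

End mean_states.

Section vanishing.
Context d (Omega : measurableType d) (R : realType) (P : probability Omega R).

Lemma ae0_Rintegral (f : Omega -> R) : (forall w, 0 <= f w) -> measurable_fun setT f ->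
  P.-integrable setT (EFin \o f) ->
  \int[P]_w f w = 0 <-> {ae P, forall w, f w = 0}.
Proof.
move=> f0 mf if_.
have mfE : measurable_fun setT (EFin \o f) by exact/measurable_EFinP.
have iE : (\int[P]_w `|(f w)%:E|)%E = (\int[P]_w f w)%:E.
  rewrite /Rintegral fineK ?(integrable_fin_num measurableT if_) //.
  by apply: eq_integral => w _ /=; rewrite ger0_norm.
split=> [h|h].
  have /(ae_eq_integral_abs P measurableT mfE) : (\int[P]_w `|(EFin \o f) w| = 0)%E.
    by rewrite [LHS]iE h.
  by apply: filterS => w /= /(_ I) [].
suff : (\int[P]_w `|(EFin \o f) w| = 0)%E by rewrite [LHS]iE => -[].
apply/(ae_eq_integral_abs P measurableT mfE); apply: filterS h => w /= -> _ //.
Qed.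

(** Integrals of simple processes are 0 at time 0, so the distances E[I^2] to I are constant in l
    and yet tend to 0. *)
Lemma ito_integral_at0 F (W : R -> Omega -> R) (Y : R -> Omega -> R) I :
  ito_integral P F W Y 0 I -> {ae P, forall w, I w = 0}.
Proof.
move=> [_ mI [f [pf _ hI]]].
have e l w : (sp_integral (f l) W 0 w - I w) ^+ 2 = I w ^+ 2.
  rewrite /sp_integral big1 ?sub0r ?sqrrN // => k _.
  have [t0 tm _] := pf l.
  have tk j : 0 <= sp_time (f l) j by elim: j => // j; move/le_trans; apply.
  by rewrite !min_l // subrr mulr0.
have h0 : (\int[P]_w ((I w) ^+ 2)%:E = 0)%E.
  apply: (cvg_unique (@ereal_hausdorff R) _ hI) => //.
  by apply: cvg_near_cst; apply: nearW => l; apply: eq_integral => w _; rewrite e.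
have mI2 : measurable_fun setT (EFin \o (fun w => I w ^+ 2)).
  by apply/measurable_EFinP; exact: measurable_funX.
have /(ae_eq_integral_abs P measurableT mI2) : (\int[P]_w `|(EFin \o (fun w => I w ^+ 2)%R) w| = 0)%E.
  by rewrite -h0; apply: eq_integral => w _ /=; rewrite ger0_norm // sqr_ge0.
apply: filterS => w /= /(_ Logic.I) [] /eqP; rewrite sqrf_eq0 => /eqP //.
Qed.

End vanishing.

Section solutions.
Context d (Omega : measurableType d) (R : realType) (P : probability Omega R).
Variables (m n p : nat) (H : 'M[R[i]]_m) (C : 'I_n.+1 -> 'M[R[i]]_m).
Notation RR := (measurableTypeR R * measurableTypeR R)%type.
Variables (F : R -> set_system Omega) (W : 'I_n.+1 -> R -> Omega -> R)
  (N : 'I_n.+1 -> Omega -> {measure set RR -> \bar R}).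
Hypotheses (hnoise : driving_noises P p W N) (hF : usual_conditions P F)
  (hFnat : forall t : R, 0 <= t -> F t = natural_filtration P p W N t).
Variables (rho0 : 'M[R[i]]_m) (rho : R -> Omega -> 'M[R[i]]_m).
Hypothesis sol : sme_solution P p H C W N F rho0 rho.

Lemma sol_states t w : 0 <= t -> states (rho t w).
Proof. by case: sol => h _ _ _; exact: h. Qed.

Lemma sol_cadlag w : mx_all (@cadlag R) (rho ^~ w). Proof. by case: sol. Qed.

Lemma sol_mean phi t : 0 <= t -> rlin phi ->
  phi (mean_state P (rho t)) = \int[P]_w phi (rho t w).
Proof.
move=> t0; apply: rlin_mean_state => [w|psi hs]; first exact: sol_states.
exact: (adapted_measurable hF sol t0 hs).
Qed.

Lemma sol_mean_states t : 0 <= t -> states (mean_state P (rho t)).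
Proof.
move=> t0; apply: states_mean_state => [w|psi hs]; first exact: sol_states.
exact: (adapted_measurable hF sol t0 hs).
Qed.

Lemma sol_integrable phi t : 0 <= t -> rlin phi ->
  P.-integrable setT (EFin \o (fun w => phi (rho t w))).
Proof.
move=> t0; apply: rlin_state_integrable => [w|psi hs]; first exact: sol_states.
exact: (adapted_measurable hF sol t0 hs).
Qed.

(** The equation at t = 0 has empty domains of integration, but its Ito terms and the equation
    itself are controlled only almost surely. *)
Lemma sol_initial : {ae P, forall w, rho 0 w = rho0}.
Proof.
case: (sol) => _ _ _ [M [hM hE]].
have hM0 : {ae P, forall w, forall (i : 'I_n.+1) j k, (i <= p)%N ->
    re (M i 0 w j k) = 0 /\ im (M i 0 w j k) = 0}.
  apply: filter_forall => i; apply: filter_forall => j; apply: filter_forall => k.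
  case: (boolP (i <= p)%N) => [ip|_]; last exact: nearW.
  have [h1 h2] := hM i 0 j k ip (lexx 0).
  apply: filterS2 (ito_integral_at0 h1) (ito_integral_at0 h2) => w e1 e2 _.
  by rewrite e1 e2.
apply: filterS2 hM0 (hE 0 (lexx 0)) => w h ->.
have int0 (d' : measure_display) (T : measurableType d') (mu : {measure set T -> \bar R}) (f : T -> 'M[R[i]]_m) :
    mx_lift (fun g => \int[mu]_(z in set0) g z) f = 0.
  by apply/matrixP => j k; rewrite !mxE !Rintegral_set0.
have strip0 : strip `]0, (0 : R)] = set0.
  by apply/seteqP; split=> // -[x u] [_ /=]; rewrite in_itv /= => /andP[a b];
    have := lt_le_trans a b; rewrite ltxx.
rewrite (_ : mx_lift _ _ = 0); last by rewrite set_itvoc0; exact: int0.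
rewrite addr0 big1 ?addr0 => [|i ip]; last first.
  by apply/matrixP => j k; rewrite mxE; have [h1 h2] := h i j k ip; exact: complex_eqP.
by rewrite big1 ?addr0 // => i ip; rewrite /compensated_integral strip0 !int0 subrr.
Qed.

Lemma sol_mean_initial phi : rlin phi -> \int[P]_w phi (rho 0 w) = phi rho0.
Proof.
move=> hp; transitivity (\int[P]_w (\1_setT w * phi (rho 0 w))).
  by apply: eq_Rintegral => w _; rewrite indicT mul1r.
transitivity (\int[P]_w (\1_setT w * phi rho0)).
  apply: ae_eq_Rintegral_indic => //; first exact: (adapted_measurable hF sol).
  by apply: filterS sol_initial => w ->.
transitivity (\int[P]_w phi rho0); last exact: Rintegral_cst_prob.
by apply: eq_Rintegral => w _; rewrite indicT mul1r.
Qed.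

End solutions.

Section leakage_convergence.
Variables (R : realType) (m : nat) (V : {vspace 'cV[R[i]]_m}) (PS : 'M[R[i]]_m).
Hypothesis hPS : orth_projector V PS.

Lemma hs_norm_cvg0 (T : Type) (G : set_system T) (x : T -> 'M[R[i]]_m) : Filter G ->
  (\forall s \near G, states (x s)) ->
  hs_norm (x s - PS *m x s *m PS) @[s --> G] --> (0 : R) <-> leakage PS (x s) @[s --> G] --> 0.
Proof.
move=> FG sx; split=> [h|h].
  have hm : m%:R * hs_norm (x s - PS *m x s *m PS) @[s --> G] --> m%:R * (0 : R).
    by apply: cvgM => //; exact: cvg_cst.
  rewrite mulr0 in hm; apply: (squeeze_cvgr (f := fun=> 0) _ _ hm).
    by apply: filterS sx => s ss; rewrite (leakage_ge0 hPS ss) /=; exact: leakage_le_hs_norm.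
  exact: cvg_cst.
(* The bound c (tau leakage + 1 / tau) holds for every tau > 0. Taking tau = 2 c / e makes the
   second term e / 2, and a leakage below e / (2 c tau) does the same for the first; the added 1
   keeps c positive when m = 0. *)
apply/cvgrPdist_le => e e0; pose c : R := (2 * m)%:R + 1.
have c0 : 0 < c by rewrite ltr_wpDl.
pose tau := 2 * c / e; have tau0 : 0 < tau by rewrite divr_gt0 // mulr_gt0.
have d0 : 0 < e / (2 * c * tau) by apply: divr_gt0 => //; apply: mulr_gt0 => //; exact: mulr_gt0.
move/cvgrPdist_le: h => /(_ _ d0) h.
apply: filterS2 sx h => s ss; rewrite sub0r normrN (ger0_norm (leakage_ge0 hPS ss)) => hl.
rewrite sub0r normrN ger0_norm ?sqrtr_ge0 //.
apply: le_trans (hs_norm_le_leakage hPS ss tau0) _.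
have l0 := leakage_ge0 hPS ss.
apply: (@le_trans _ _ (c * (tau * leakage PS (x s) + tau^-1))).
  by rewrite ler_wpM2r ?lerDl // addr_ge0 ?invr_ge0 ?(ltW tau0) // mulr_ge0 // ltW.
have e1 : c * (tau * leakage PS (x s)) <= e / 2.
  have : c * tau * leakage PS (x s) <= c * tau * (e / (2 * c * tau)).
    by rewrite ler_wpM2l // mulr_ge0 // ltW.
  by rewrite mulrA => /le_trans; apply; rewrite le_eqVlt; apply/orP; left; apply/eqP; field; rewrite !gt_eqF.
have e2 : c * tau^-1 = e / 2 by rewrite /tau; field; rewrite !gt_eqF.
by rewrite mulrDr e2; move: e1; lra.
Qed.

End leakage_convergence.

(** Positive rationals approach t from the right. This turns countably many almost sure statements
    into one valid at all times; the numerators k + 1 avoid time 0, at which invariance says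
    nothing. *)
Lemma grid_right_cvg0 (R : realType) (f : R -> R) t : 0 <= t -> f s @[s --> t^'+] --> f t ->
  (forall k l : nat, f (k.+1%:R / l.+1%:R) = 0) -> f t = 0.
Proof.
move=> t0 ft f0.
pose k (l : nat) := Num.truncn (t * l.+1%:R).
pose u (l : nat) : R := (k l).+1%:R / l.+1%:R.
have l0 l : 0 < l.+1%:R :> R by [].
have kE l : (k l)%:R <= t * l.+1%:R < (k l).+1%:R by apply: truncn_itv; rewrite mulr_ge0.
have gtu l : t < u l by have /andP[_ h] := kE l; rewrite ltr_pdivlMr.
have ule l : u l <= t + l.+1%:R^-1.
  have /andP[h _] := kE l.
  by rewrite /u ler_pdivrMr // mulrDl mulVf ?gt_eqF // -natr1 lerD2r.
have cu : u l @[l --> \oo] --> t.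
  apply: (@squeeze_cvgr _ _ _ _ (fun=> t) (fun l => t + l.+1%:R^-1)).
  - by apply: nearW => l; rewrite ule (ltW (gtu l)).
  - exact: cvg_cst.
  - rewrite -[X in _ --> X]addr0; apply: cvgD; first exact: cvg_cst.
    exact: cvg_harmonic.
have cf : f (u l) @[l --> \oo] --> f t by move/cvg_at_rightP: ft => /(_ u); apply.
apply: (cvg_unique (@norm_hausdorff _ R^o) cf).
by apply: cvg_near_cst; apply: nearW => l; exact: f0.
Qed.

(** * Equivalence of the two notions of invariance and of stability *)

Section stability_equivalence.
Context d (Omega : measurableType d) (R : realType) (P : probability Omega R).
Variables (m n p : nat) (H : 'M[R[i]]_m) (C : 'I_n.+1 -> 'M[R[i]]_m).
Notation RR := (measurableTypeR R * measurableTypeR R)%type.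
Variables (F : R -> set_system Omega) (W : 'I_n.+1 -> R -> Omega -> R)
  (N : 'I_n.+1 -> Omega -> {measure set RR -> \bar R}).
Hypotheses (hnoise : driving_noises P p W N) (hF : usual_conditions P F)
  (hFnat : forall t : R, 0 <= t -> F t = natural_filtration P p W N t).
Variable rho : 'M[R[i]]_m -> R -> Omega -> 'M[R[i]]_m.
Hypothesis hrho : forall rho0, states rho0 -> sme_solution P p H C W N F rho0 (rho rho0).
Variables (V : {vspace 'cV[R[i]]_m}) (PS : 'M[R[i]]_m).
Hypothesis hPS : orth_projector V PS.

Let mean rho0 t := mean_state P (rho rho0 t).

Let rleak := rlin_leakage PS.

Let stw rho0 t w : states rho0 -> 0 <= t -> states (rho rho0 t w).
Proof. by move=> s0 t0; exact: (sol_states (hrho s0)). Qed.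

Let mean_st rho0 t : states rho0 -> 0 <= t -> states (mean rho0 t).
Proof. by move=> s0 t0; exact: (sol_mean_states hF (hrho s0)). Qed.

Lemma states_on_mean_ae rho0 t : states rho0 -> 0 <= t ->
  states_on PS (mean rho0 t) <-> {ae P, forall w, leakage PS (rho rho0 t w) = 0}.
Proof.
move=> s0 t0; rewrite (states_on_leakage hPS (mean_st s0 t0)).
rewrite (sol_mean hF (hrho s0) t0 rleak); apply: ae0_Rintegral.
- by move=> w; exact: (leakage_ge0 hPS (stw w s0 t0)).
- exact: (adapted_measurable hF (hrho s0) t0 rleak).
- exact: (sol_integrable hF (hrho s0) t0 rleak).
Qed.

Lemma invariance_equivalence :
  invariant_in_mean P PS rho <-> invariant_almost_surely P PS rho.
Proof.
split=> hinv rho0 on0; have s0 := on0.1.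
- have aet (t : R) : 0 < t -> {ae P, forall w, leakage PS (rho rho0 t w) = 0}.
    by move=> t0; apply/(states_on_mean_ae s0 (ltW t0)); exact: hinv.
  have : {ae P, forall w, forall k l : nat, leakage PS (rho rho0 (k.+1%:R / l.+1%:R) w) = 0}.
    by apply: ae_foralln => k; apply: ae_foralln => l; apply: aet; rewrite divr_gt0.
  apply: filterS => w hw t t0.
  apply/(states_on_leakage hPS (stw w s0 (ltW t0))).
  apply: (@grid_right_cvg0 _ (fun s => leakage PS (rho rho0 s w))) => //; first exact: ltW.
  exact: (cvg_right (sol_cadlag (hrho s0) w) (ltW t0) rleak).
- move=> t t0; apply/(states_on_mean_ae s0 (ltW t0)).
  apply: filterS (hinv _ on0) => w /(_ t t0).
  by move/(states_on_leakage hPS (stw w s0 (ltW t0))).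
Qed.

Let near_states rho0 w : states rho0 -> \forall t \near +oo, states (rho rho0 t w).
Proof.
by move=> s0; near=> t; apply: stw.
Unshelve. all: by end_near. Qed.

Let near_mean rho0 : states rho0 -> \forall t \near +oo, states (mean rho0 t).
Proof.
by move=> s0; near=> t; apply: mean_st.
Unshelve. all: by end_near. Qed.

Lemma GAS_almost_surely_in_mean : GAS_almost_surely P PS rho -> GAS_in_mean P PS rho.
Proof.
move=> hG rho0 s0; apply/(hs_norm_cvg0 hPS _ (near_mean s0)).
(* Dominated convergence is stated for sequences; times are cut at 0 because rho is state-valued
   only from time 0 on. *)
apply/cvg_pinftyP => u ucv; pose v l := Num.max 0 (u l).
have v0 l : 0 <= v l by rewrite le_max lexx.
have vcv : v l @[l --> \oo] --> +oo.
  apply/cvgryPge => A; move/cvgryPge: ucv => /(_ A); apply: filterS => l h.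
  by rewrite le_max h orbT.
have vu : \forall l \near \oo, leakage PS (mean rho0 (v l)) = leakage PS (mean rho0 (u l)).
  move/cvgryPge: ucv => /(_ 0); apply: filterS => l h.
  by rewrite /v max_r.
apply: cvg_trans (near_eq_cvg vu) _.
have mv l := adapted_measurable hF (hrho s0) (v0 l) rleak.
have [|||||_ _ hc] := @dominated_convergence _ _ R P setT measurableT
  (fun l w => (leakage PS (rho rho0 (v l) w))%:E) (fun=> 0%E) (fun=> 1%E).
- by move=> l; apply/measurable_EFinP; exact: mv.
- exact: measurable_cst.
- apply: filterS (hG rho0 s0) => w /(hs_norm_cvg0 hPS _ (near_states w s0)) hw _.
  apply/fine_cvgP; split; first exact: nearW.
  by move/cvg_pinftyP: hw => /(_ v vcv).
- exact: (finite_measure_integrable_cst P 1 measurableT).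
- apply: nearW => w l _; have sv := stw w s0 (v0 l).
  by rewrite /= lee_fin ger0_norm ?(leakage_ge0 hPS) ?(leakage_le1 hPS).
have -> : (fun l => leakage PS (mean rho0 (v l))) =
    (fun l => fine (\int[P]_w (leakage PS (rho rho0 (v l) w))%:E)%E).
  by apply/funext => l; rewrite (sol_mean hF (hrho s0) (v0 l) rleak).
by move: hc; rewrite integral0 => /fine_cvgP[].
Qed.

Let FT s : 0 <= s -> F s setT.
Proof.
by move=> h0; case: (filtration_sigma hF h0) => e hC _; rewrite -(setD0 setT); exact: hC.
Qed.

Let meanE phi rho0 t : states rho0 -> 0 <= t -> rlin phi ->
  \int[P]_w (\1_setT w * phi (rho rho0 t w)) = phi (mean rho0 t).
Proof.
move=> s0 t0 hp; rewrite (sol_mean hF (hrho s0) t0 hp).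
by apply: eq_Rintegral => w _; rewrite indicT mul1r.
Qed.

Let hL phi : rlin phi -> rlin (fun r => phi (lindblad H C r)).
Proof. exact: (rlin_comp (lindblad H C)). Qed.

Lemma mean_lipschitz phi K rho0 s t : rlin phi -> 0 <= K ->
  (forall r, states r -> `|phi (lindblad H C r)| <= K) -> states rho0 -> 0 <= s <= t ->
  `|phi (mean rho0 t) - phi (mean rho0 s)| <= K * (t - s).
Proof.
move=> hp K0 hK s0 st; have /andP[h0 ht] := st; have t0 := le_trans h0 ht.
have := sme_lipschitz hnoise hF hFnat (hrho s0) hp K0 hK st (FT h0).
by rewrite !meanE.
Qed.

Lemma mean_euler phi : rlin phi -> exists K, 0 < K /\ forall rho0 s t, states rho0 -> 0 <= s <= t ->
  `|phi (mean rho0 t) - phi (mean rho0 s) - (t - s) * phi (lindblad H C (mean rho0 s))|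
    <= K * (t - s) ^+ 2.
Proof.
move=> hp; have [K1 [K10 hK1]] := rlin_state_bound (hL hp).
have [K [K0 hK]] := rlin_state_bound (hL (hL hp)).
(* A strictly positive constant is wanted, since later choices of h divide by it. *)
exists (K + 1); split; first by rewrite ltr_wpDl.
move=> rho0 s t s0 st; have /andP[h0 ht] := st; have t0 := le_trans h0 ht.
have := sme_euler hnoise hF hFnat (hrho s0) hp K10 K0 hK1 hK st (FT h0).
rewrite !meanE // (meanE s0 h0 (hL hp)) => /le_trans; apply.
by rewrite ler_wpM2r ?sqr_ge0 // lerDl.
Qed.

Lemma mean_initial phi rho0 : states rho0 -> rlin phi -> phi (mean rho0 0) = phi rho0.
Proof.
by move=> s0 hp; rewrite (sol_mean hF (hrho s0) (lexx 0) hp) (sol_mean_initial hF (hrho s0) hp).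
Qed.

(* Barbalat: the second derivative of the mean is bounded, so its first derivative vanishes with it. *)
Lemma mean_generator_cvg0 phi rho0 : states rho0 -> rlin phi ->
  phi (mean rho0 t) @[t --> +oo] --> 0 ->
  phi (lindblad H C (mean rho0 t)) @[t --> +oo] --> 0.
Proof.
move=> s0 hp hc; have [K [K0 hK]] := mean_euler hp.
(* With this h the remainder K h^2 equals h e / 2, and the means at t and t + h contribute at most h
   e / 4 each; dividing by h leaves e. *)
apply/cvgrPdist_le => e e0; pose h := e / (2 * K).
have h0 : 0 < h by apply: divr_gt0 => //; exact: mulr_gt0.
have d0 : 0 < h * e / 4 by apply: divr_gt0 => //; exact: mulr_gt0.
have hn : \forall t \near +oo, `|phi (mean rho0 t)| <= h * e / 4.
  by move/cvgrPdist_le: hc => /(_ _ d0); apply: filterS => t; rewrite sub0r normrN.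
have [A [Ar hA]] := hn; near=> t.
rewrite sub0r normrN.
have At : A < t by near: t; exact: nbhs_pinfty_gt.
have t0 : 0 <= t by near: t; exact: nbhs_pinfty_ge.
have tth : 0 <= t <= t + h by rewrite t0 lerDl ltW.
have := hK rho0 t (t + h) s0 tth.
have Ath : A < t + h by rewrite (lt_le_trans At) // lerDl ltW.
have := hA t At; have := hA (t + h) Ath.
have -> : t + h - t = h by rewrite addrAC subrr add0r.
set a := phi (mean rho0 (t + h)); set b := phi (mean rho0 t).
set g := phi (lindblad H C _).
have Kh : K * h ^+ 2 = h * e / 2.
  by rewrite /h; field; rewrite gt_eqF.
rewrite Kh => ha hb hg; rewrite -(ler_pM2l h0) -{1}(gtr0_norm h0) -normrM.
have -> : h * g = a - b - (a - b - h * g) by ring.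
apply: le_trans (ler_normB _ _) _; apply: le_trans (lerD (ler_normB _ _) hg) _.
by have := lerD ha hb; lra.
Unshelve. all: by end_near. Qed.

(** If phi o L vanishes on states, the mean of phi is constant in time; since it tends to 0, its
    initial value phi r is 0. *)
Lemma mean_generator_inj phi : rlin phi ->
  (forall rho0, states rho0 -> phi (mean rho0 t) @[t --> +oo] --> 0) ->
  (forall r, states r -> phi (lindblad H C r) = 0) -> forall r, states r -> phi r = 0.
Proof.
move=> hp hc h0 r sr.
have ct t : 0 <= t -> phi (mean r t) = phi r.
  move=> t0; have K0 r' : states r' -> `|phi (lindblad H C r')| <= 0.
    by move=> s'; rewrite h0 // normr0.
  have := @mean_lipschitz phi 0 r 0 t hp (lexx 0) K0 sr; rewrite lexx t0 mul0r.
  by move=> /(_ isT); rewrite normr_le0 subr_eq0 mean_initial // => /eqP.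
apply: (cvg_unique (@norm_hausdorff _ R^o) _ (hc r sr)).
apply: cvg_near_cst; near=> t; apply: ct.
by near: t; exact: nbhs_pinfty_ge.
Unshelve. all: by end_near. Qed.

(** An instance of [vanishing_potential], with matrices flattened to rows of length m * m. The
    linear form f is complex-valued, and the coefficient c gives access to both of its real
    parts. *)
Lemma leakage_potential : (0 < m)%N -> GAS_in_mean P PS rho -> exists phi, [/\ rlin phi,
  forall rho0, states rho0 -> phi (mean rho0 t) @[t --> +oo] --> 0 &
  forall r, states r -> phi (lindblad H C r) = - leakage PS r].
Proof.
move=> m0 hG; pose f (x : 'rV[R[i]]_(m * m)) := \tr ((1%:M - PS) *m vec_mx x).
pose obs c (A : 'M[R[i]]_(m * m)) r := re (c * f (mxvec r *m A)).
have hobs c A : rlin (obs c A).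
  have lin a x y : f (mxvec (a *: x + y) *m A) = a * f (mxvec x *m A) + f (mxvec y *m A).
    rewrite /f; move: (1%:M - PS) => Q.
    rewrite (linearP mxvec) /= mulmxDl -scalemxAl (linearP vec_mx) /= mulmxDr -scalemxAr.
    by rewrite mxtraceD mxtraceZ.
  split=> [x y|a x]; rewrite /obs.
    by have := lin 1 x y; rewrite scale1r mul1r => ->; rewrite mulrDr reD.
  have := lin a%:C x 0; rewrite addr0 linear0 mul0mx => ->.
  by rewrite /f linear0 mulmx0 mxtrace0 addr0 mulrCA [LHS]reM /= mul0r subr0.
pose van (g : 'rV[R[i]]_(m * m) -> R) :=
  forall rho0, states rho0 -> g (mxvec (mean rho0 t)) @[t --> +oo] --> 0.
have obsL c A r : re (c * f (mxvec r *m (lin_mx (lindblad H C) *m A))) = obs c A (lindblad H C r).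
  by rewrite /obs mulmxA mul_vec_lin.
have [|||||||c [A [hv hA]]] := @vanishing_potential R (m * m) (lin_mx (lindblad H C)) f _ _
  [set x | exists2 r, states r & x = mxvec r] van.
- by move=> x y; rewrite /f linearD mulmxDr linearD.
- by move=> c x; rewrite /f linearZ /= -scalemxAr linearZ.
- move=> g h hg hh r0 s0; rewrite -[0]addr0; apply: cvgD; [exact: hg|exact: hh].
- move=> c r0 s0.
  have hl : leakage PS (mean r0 t) @[t --> +oo] --> 0.
    by apply/(hs_norm_cvg0 hPS _ (near_mean s0)); exact: hG.
  have hcl : re c * leakage PS (mean r0 t) @[t --> +oo] --> re c * 0.
    by apply: cvgM => //; exact: cvg_cst.
  rewrite mulr0 in hcl; apply: cvg_trans hcl; apply: near_eq_cvg.
  apply: filterS (near_mean s0) => t st.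
  (* On states the trace is real, so c only contributes the factor [re c]. *)
  rewrite /f mxvecK reM /leakage; set z := \tr _.
  suff -> : im z = 0 by rewrite mulr0 subr0.
  rewrite /z mulmxBl mul1mx linearB /= imD imN (im_tr_projector hPS st).
  by have [_ ->] := st; rewrite /= oppr0 addr0.
- move=> c A hv r0 s0; have := mean_generator_cvg0 s0 (hobs c A) (hv r0 s0).
  apply: cvg_trans; apply: near_eq_cvg; apply: nearW => t; rewrite obsL //.
- move=> c A hv h x [r sr ->]; apply: (mean_generator_inj (hobs c A) hv _ sr) => r' sr'.
  by rewrite -obsL; apply: h; exists r'.
- by rewrite muln_gt0 m0.
exists (obs c A); split=> //.
move=> r sr; rewrite -obsL hA; last by exists r.
by rewrite /f mxvecK.
Qed.

Lemma GAS_in_mean_almost_surely : GAS_in_mean P PS rho -> GAS_almost_surely P PS rho.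
Proof.
move=> hG rho0 s0.
(* In dimension 0 the trace is 0, so there is no state at all. *)
have m0 : (0 < m)%N.
  rewrite lt0n; apply/eqP => m0; have [_ tr1] := s0; move: tr1.
  have -> : \tr rho0 = 0.
    rewrite /mxtrace big1 // => j _; have jm : (j < 0)%N by rewrite -[X in (_ < X)%N]m0 ltn_ord.
    by rewrite ltn0 in jm.
  by move/eqP; rewrite eq_sym oner_eq0.
have [phi [hp hc hL1]] := leakage_potential m0 hG.
have [K [K0 hK]] := mean_euler hp.
have super r s t B : states r -> 0 <= s <= t -> F s B ->
    \int[P]_w (\1_B w * phi (rho r t w)) <= \int[P]_w (\1_B w * phi (rho r s w)).
  move=> sr st FB; rewrite -subr_ge0.
  (* For - phi the drift is the leakage at the left limits, which is nonnegative. *)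
  have := sme_increment hnoise hF hFnat (hrho sr) (rlin_opp hp) st FB.
  have eN u : 0 <= u -> \int[P]_w (\1_B w * - phi (rho r u w)) = - \int[P]_w (\1_B w * phi (rho r u w)).
    move=> u0; have mB : measurable B.
      by case/andP: st => h0 _; exact: (filtration_measurable hF h0).
    rewrite -mulN1r -RintegralZl //; last first.
      by apply: integrable_indicM => //; exact: (sol_integrable hF (hrho sr) u0 hp).
    by apply: eq_Rintegral => w _; rewrite mulrN mulN1r.
  have /andP[h0 ht] := st; have t0 := le_trans h0 ht; rewrite !eN // => e.
  rewrite opprK addrC in e; rewrite e; apply: Rintegral_ge0 => w _.
  apply: mulr_ge0; first by rewrite indicE.
  apply: Rintegral_ge0 => u /=; rewrite in_itv /= => /andP[su _].
  have u0 := le_lt_trans h0 su.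
  have sl := left_state_states (fun t w h => @stw r t w sr h) (sol_cadlag (hrho sr)) w u0.
  by rewrite hL1 // opprK (leakage_ge0 hPS).
(* Along the solution started at r, the mean of phi stays below its initial value phi r and tends to
   0. *)
have p0 r : states r -> 0 <= phi r.
  move=> sr; have : phi (mean r t) @[t --> +oo] --> 0 by exact: hc.
  move/cvgr_to_le; apply; near=> t.
  have t0 : 0 <= t by near: t; exact: nbhs_pinfty_ge.
  have := @super r 0 t setT sr; rewrite lexx t0 => /(_ isT (FT (lexx 0))).
  by rewrite !meanE // mean_initial.
(* [phi r] exceeds [h * leakage r - K * h ^+ 2] for every [h]; take the best one. *)
have quad r : states r -> leakage PS r ^+ 2 <= 4 * K * phi r.
  move=> sr; have l0 := leakage_ge0 hPS sr.
  pose h := leakage PS r / (2 * K).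
  have h0 : 0 <= h by apply: divr_ge0 => //; apply: mulr_ge0 => //; exact: ltW.
  have := hK r 0 h sr; rewrite lexx h0 => /(_ isT).
  rewrite subr0 (mean_initial sr hp) (mean_initial sr (hL hp)).
  rewrite hL1 // mulrN opprK => /(le_trans (ler_norm _)) hh.
  have ph := p0 _ (mean_st sr h0).
  have : h * leakage PS r - K * h ^+ 2 <= phi r by move: hh ph; lra.
  have -> : h * leakage PS r - K * h ^+ 2 = leakage PS r ^+ 2 / (4 * K).
    by rewrite /h; field; rewrite gt_eqF.
  by rewrite ler_pdivrMr ?mulr_gt0 // mulrC.
have [M [M0 hM]] := rlin_state_bound hp.
have hY : {ae P, forall w, phi (rho rho0 t w) @[t --> +oo] --> 0}.
  apply: (@supermartingale_cvg0 _ _ R P F (filtration_sigma hF) (filtration_measurable hF)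
    (filtration_mono hF) (fun t w => phi (rho rho0 t w)) M).
  - move=> t t0; have [_ _ ad _] := hrho s0.
    exact: (rlin_adapted (filtration_sigma hF) ad t0 hp).
  - by move=> t w t0; apply/p0/stw.
  - by move=> t w t0; apply: le_trans (ler_norm _) (hM _ (stw w s0 t0)).
  - by move=> s t B st FB; exact: super.
  - by move=> t w t0; exact: (cvg_right (sol_cadlag (hrho s0) w) t0 hp).
  - have := hc rho0 s0; apply: cvg_trans; apply: near_eq_cvg; near=> t.
    have t0 : 0 <= t by near: t; exact: nbhs_pinfty_ge.
    exact: (sol_mean hF (hrho s0) t0 hp).
apply: filterS hY => w hw; apply/(hs_norm_cvg0 hPS _ (near_states w s0)).
apply/cvgrPdist_le => e e0.
(* By [quad], phi below this threshold forces the leakage below e. *)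
have d0 : 0 < e ^+ 2 / (4 * K) by apply: divr_gt0; [exact: exprn_gt0|exact: mulr_gt0].
move/cvgrPdist_le: hw => /(_ _ d0) hw.
apply: filterS2 (near_states w s0) hw => t sr; rewrite !sub0r !normrN => h.
have l0 := leakage_ge0 hPS sr; rewrite ger0_norm //.
rewrite -(@ler_pXn2r _ 2) ?nnegrE ?(ltW e0) //; apply: le_trans (quad _ sr) _.
rewrite mulrC -ler_pdivlMr ?mulr_gt0 //; exact: le_trans (ler_norm _) h.
Unshelve. all: by end_near. Qed.

End stability_equivalence.

Theorem theorem1p1 (R : realType) (m n p : nat) (hpn : (p <= n)%N)
  (H : 'M[R[i]]_m) (hH : H ^t* = H) (C : 'I_n.+1 -> 'M[R[i]]_m)
  (d : measure_display) (Omega : measurableType d) (P : probability Omega R)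
  (F : R -> set_system Omega)
  (W : 'I_n.+1 -> R -> Omega -> R)
  (N : 'I_n.+1 -> Omega ->
       {measure set (measurableTypeR R * measurableTypeR R)%type -> \bar R})
  (hnoise : driving_noises P p W N)
  (hF : usual_conditions P F)
  (hFnat : forall t : R, 0 <= t -> F t = natural_filtration P p W N t)
  (rho : 'M[R[i]]_m -> R -> Omega -> 'M[R[i]]_m)
  (hrho : forall rho0, states rho0 ->
     sme_solution P p H C W N F rho0 (rho rho0))
  (HS : {vspace 'cV[R[i]]_m}) (PS : 'M[R[i]]_m)
  (hPS : orth_projector HS PS) :
  (invariant_in_mean P PS rho <-> invariant_almost_surely P PS rho) /\
  (GAS_in_mean P PS rho <-> GAS_almost_surely P PS rho).
Proof.
split; first exact: (invariance_equivalence hF hrho hPS).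
split; first exact: (GAS_in_mean_almost_surely hnoise hF hFnat hrho hPS).
exact: (GAS_almost_surely_in_mean hF hrho hPS).
Qed.
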